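(* Let $F_\hbar[[G]]$ be a QFSHA, and let $\mathcal F=\exp(\hbar^{-1}\phi)$ be a polar twist for it. Then the procedure of twist deformation by $\mathcal F$ applied to the QUEA $F_\hbar[[G]]^\vee$ — i.e. replacing the coproduct by $\Delta^{\mathcal F}(x)=\mathcal F\,\Delta(x)\,\mathcal F^{-1}$ and correspondingly the antipode, keeping product, unit and counit — restricts to $F_\hbar[[G]]$ (in particular $\Delta^{\mathcal F}$ maps $F_\hbar[[G]]$ into $F_\hbar[[G]]^{\widetilde\otimes 2}$), making $F_\hbar[[G]]$ into a new QFSHA.
   Context: $\Bbbk$ is a field of characteristic $0$. $\widehat\otimes$ is the $\hbar$-adically completed tensor product of topologically free $\Bbbk[[\hbar]]$-modules (those isomorphic to $V[[\hbar]]$). For topological $\Bbbk[[\hbar]]$-modules isomorphic to $\Bbbk[[\hbar]]^{E}$ with the weak (product) topology, $\widetilde\otimes$ is the completed tensor product with $\Bbbk[[\hbar]]^{E_1}\widetilde\otimes\,\Bbbk[[\hbar]]^{E_2}\cong\Bbbk[[\hbar]]^{E_1\times E_2}$. QUEA: a topologically free topological Hopf algebra $U_\hbar$ (for $\widehat\otimes$) with $U_\hbar/\hbar U_\hbar\cong U(\mathfrak g)$ as Hopf algebras for a Lie algebra $\mathfrak g$. QFSHA: a topological Hopf algebra $F_\hbar$ of the type $\Bbbk[[\hbar]]^E$ (for $\widetilde\otimes$) such that $F_\hbar/\hbar F_\hbar$ is commutative and complete in the adic topology of its augmentation ideal, i.e. $\cong F[[G]]$, the function algebra of a formal group $G$ (finite-dimensional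 here); one writes $F_\hbar=F_\hbar[[G]]$. Drinfeld functor: $F_\hbar[[G]]^\vee$ is the $\hbar$-adic completion of $\sum_{n\ge0}\hbar^{-n}I^n$, where $I:=\hbar F_\hbar[[G]]+\mathrm{Ker}(\epsilon)$; it is a QUEA, contains $F_\hbar[[G]]$, and $(F_\hbar[[G]]^{\widetilde\otimes2})^\vee=(F_\hbar[[G]]^\vee)^{\widehat\otimes 2}$. Twist of a (topological) Hopf algebra $H$: an invertible $\mathcal F\in H\otimes H$ (completed) with $(\epsilon\otimes\mathrm{id})(\mathcal F)=1=(\mathrm{id}\otimes\epsilon)(\mathcal F)$ and $\mathcal F_{12}(\Delta\otimes\mathrm{id})(\mathcal F)=\mathcal F_{23}(\mathrm{id}\otimes\Delta)(\mathcal F)$. The antipode of $H^{\mathcal F}$ is $\mathcal S^{\mathcal F}(x)=v\,\mathcal S(x)\,v^{-1}$ with $v=\sum\mathcal S(f'_1)f'_2$, $\mathcal F^{-1}=\sum f'_1\otimes f'_2$. Polar twist of $F_\hbar[[G]]$: an element of $(F_\hbar[[G]]^\vee)^{\widehat\otimes2}$ of the form $\mathcal F=\exp(\hbar^{-1}\phi)$, for some $\phi\in F_\hbar[[G]]^{\widetilde\otimes2}$ with $(\mathrm{id}\otimes\epsilon)(\phi)=0=(\epsilon\otimes\mathrm{id})(\phi)$, which is a twist for the QUEA $F_\hbar[[G]]^\vee$. (Such $\phi$ lies in $\hbar^2(F_\hbar[[G]]^\vee)^{\widehat\otimes2}$, so the exponential converges.)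
   Formalization: The antipode of the twisted Hopf algebra is taken as v^{-1} S(x) v, with v = sum S(f'_1) f'_2, instead of v S(x) v^{-1}, which is not an antipode for F Delta(x) F^{-1} (it fails for the Jordanian twist). *)

(* Defs.v *)
From HB Require Import structures.
From mathcomp Require Import all_boot all_order all_algebra.
From mathcomp Require Import all_classical.

Set Implicit Arguments.
Unset Strict Implicit.
Unset Printing Implicit Defensive.
Import GRing.Theory.
Local Open Scope ring_scope.

(** * Formal power series in one variable *)

Record fps (R : comNzRingType) := Fps { fcoef : nat -> R }.

HB.instance Definition _ (R : comNzRingType) := gen_eqMixin (fps R).
HB.instance Definition _ (R : comNzRingType) := gen_choiceMixin (fps R).

Section FpsRing.
Variable R : comNzRingType.
Implicit Types a b c : fps R.

Lemma fpsP a b : fcoef a =1 fcoef b -> a = b.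
Proof. by case: a b => [a] [b] /= ab; congr Fps; apply/funext. Qed.

Definition fps_const (c : R) : fps R := Fps (fun n => if n == 0%N then c else 0).
Definition fps_zero : fps R := Fps (fun=> 0).
Definition fps_opp a : fps R := Fps (fun n => - fcoef a n).
Definition fps_add a b : fps R := Fps (fun n => fcoef a n + fcoef b n).
Definition fps_mul a b : fps R :=
  Fps (fun n => \sum_(i < n.+1) fcoef a i * fcoef b (n - i)%N).

Fact fps_addA : associative fps_add.
Proof. by move=> a b c; apply: fpsP => n /=; rewrite addrA. Qed.
Fact fps_addC : commutative fps_add.
Proof. by move=> a b; apply: fpsP => n /=; rewrite addrC. Qed.
Fact fps_add0 : left_id fps_zero fps_add.
Proof. by move=> a; apply: fpsP => n /=; rewrite add0r. Qed.
Fact fps_addN : left_inverse fps_zero fps_opp fps_add.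
Proof. by move=> a; apply: fpsP => n /=; rewrite addNr. Qed.

HB.instance Definition _ :=
  GRing.isZmodule.Build (fps R) fps_addA fps_addC fps_add0 fps_addN.

Let trunc N a : {poly R} := \poly_(i < N) fcoef a i.

Let trunc_mul N a b n : (n < N)%N ->
  (trunc N a * trunc N b)`_n = fcoef (fps_mul a b) n.
Proof.
move=> nN; rewrite coefM; apply: eq_bigr => i _.
rewrite !coef_poly (leq_ltn_trans _ nN) ?(leq_ltn_trans (leq_subr _ _) nN) //.
by rewrite -ltnS.
Qed.

Fact fps_mulC : commutative fps_mul.
Proof.
by move=> a b; apply: fpsP => n; rewrite -!(@trunc_mul n.+1) // mulrC.
Qed.

Let trunc_coefE N a n : (n < N)%N -> (trunc N a)`_n = fcoef a n.
Proof. by move=> nN; rewrite coef_poly nN. Qed.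

Fact fps_mulA : associative fps_mul.
Proof.
move=> a b c; apply: fpsP => n.
transitivity ((trunc n.+1 a * (trunc n.+1 b * trunc n.+1 c))`_n).
  rewrite coefM /=; apply: eq_bigr => i _.
  by rewrite trunc_coefE ?ltn_ord // trunc_mul // ltnS leq_subr.
rewrite mulrA coefM /=; apply: eq_bigr => i _.
by rewrite trunc_mul ?ltn_ord // trunc_coefE // ltnS leq_subr.
Qed.

Fact fps_mul1 : left_id (fps_const 1) fps_mul.
Proof.
move=> a; apply: fpsP => n /=; rewrite big_ord_recl /= mul1r subn0.
by rewrite big1 ?addr0 // => i _; rewrite mul0r.
Qed.

Fact fps_mulD : left_distributive fps_mul fps_add.
Proof.
move=> a b c; apply: fpsP => n /=.
by rewrite -big_split; apply: eq_bigr => i _; rewrite mulrDl.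
Qed.

Fact fps_1neq0 : fps_const 1 != 0.
Proof.
apply/eqP => /(congr1 (fun a => fcoef a 0%N)) /= /eqP.
by rewrite oner_eq0.
Qed.

HB.instance Definition _ := GRing.Zmodule_isComNzRing.Build (fps R)
  fps_mulA fps_mulC fps_mul1 fps_mulD fps_1neq0.

(* The unit group is described classically, as for an abstract ring. *)
Definition fps_unit : {pred fps R} := fun a => `[< exists b, b * a = 1 >].
Definition fps_inv a : fps R :=
  if a \in fps_unit then xget a [set b | b * a = 1]%classic else a.

Fact fps_mulVx : {in fps_unit, left_inverse 1 fps_inv *%R}.
Proof.
move=> a au; rewrite /fps_inv au.
by case/asboolP: (au) => b ba; apply: (@xgetPex _ a [set b | b * a = 1]%classic); exists b.
Qed.
Fact fps_unitP a b : b * a = 1 -> fps_unit a.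
Proof. by move=> ba; apply/asboolP; exists b. Qed.
Fact fps_inv_out : {in [predC fps_unit], fps_inv =1 id}.
Proof. by move=> a; rewrite inE /= /fps_inv => /negbTE ->. Qed.

HB.instance Definition _ := GRing.ComNzRing_hasMulInverse.Build (fps R)
  fps_mulVx fps_unitP fps_inv_out.

End FpsRing.

Section FpsIdomain.
Variable R : idomainType.

Fact fps_idomain : GRing.integral_domain_axiom (fps R).
Proof.
move=> a b ab0; apply/norP => -[a0 b0].
have ex (c : fps R) : c != 0 -> exists n, fcoef c n != 0.
  move=> c0; apply: contrapT => H; move/eqP: c0; apply; apply: fpsP => n /=.
  by apply/eqP; apply: contrapT => /negP ?; apply: H; exists n.
case: (ex_minnP (ex _ a0)) => p ap pmin; case: (ex_minnP (ex _ b0)) => q bq qmin.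
have small (c : fps R) r i : (forall n, fcoef c n != 0 -> (r <= n)%N) ->
    (i < r)%N -> fcoef c i = 0.
  by move=> H ir; apply/eqP; apply: contraTT ir => /H; rewrite -leqNgt.
move/(congr1 (fun c => fcoef c (p + q)%N)): ab0 => /=.
have pl : (p < (p + q).+1)%N by rewrite ltnS leq_addr.
rewrite (bigD1 (Ordinal pl)) //= addKn big1 ?addr0.
  by move/eqP; rewrite mulf_eq0 (negbTE ap) (negbTE bq).
move=> i ni; case: (ltngtP i p) => [ip|pi|ip].
- by rewrite (small a p) ?mul0r.
- rewrite (small b q) ?mulr0 // ltn_subLR ?ltn_add2r //.
  by rewrite -ltnS.
- by case/eqP: ni; apply: val_inj.
Qed.

HB.instance Definition _ := GRing.ComUnitRing_isIntegral.Build (fps R) fps_idomain.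

End FpsIdomain.

(* k[[x_1,...,x_n]] = k[[x_1]]...[[x_n]] *)
Fixpoint mfps (R : comNzRingType) (n : nat) : comNzRingType :=
  if n is m.+1 then (fps (mfps R m) : comNzRingType) else R.

Fixpoint mfps_const (R : comNzRingType) (n : nat) : R -> mfps R n :=
  if n is m.+1 then fun c => fps_const (mfps_const m c) else id.

Definition hbar {R : comNzRingType} : fps R := Fps (fun n => (n == 1%N)%:R).

(** * hbar-adic notions for k[[hbar]]-modules *)

Section HbarAdic.
Variable k : fieldType.
Local Notation K := (fps k).

Definition hdvd (M : lmodType K) (n : nat) (x : M) : Prop :=
  exists y, x = hbar ^+ n *: y.

(* Separated and complete *)
Definition hcomplete (M : lmodType K) : Prop :=
  (forall x : M, (forall n, hdvd n x) -> x = 0) /\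
  (forall u : nat -> M, (forall n, hdvd n (u n.+1 - u n)) ->
     exists l, forall n, hdvd n (l - u n)).

Definition hlim (M : lmodType K) (u : nat -> M) (l : M) : Prop :=
  forall m, exists N, forall n, (N <= n)%N -> hdvd m (l - u n).

Definition is_hexp (A : algType K) (x y : A) : Prop :=
  hlim (fun n => \sum_(i < n) fps_const (i`!%:R^-1 : k) *: x ^+ i) y.

Definition bilinear_fun (M N P : lmodType K) (b : M -> N -> P) : Prop :=
  (forall x, linear (b x)) /\ (forall y, linear (b^~ y)).

(* (T, tau) is the hbar-adic completion of the algebraic tensor product of M and
   N, expressed by its universal property. *)
Record is_htensor (M N T : lmodType K) (tau : M -> N -> T) : Prop := {
  htensor_complete : hcomplete T;
  htensor_bilinear : bilinear_fun tau;
  htensor_universal : forall (P : lmodType K) (b : M -> N -> P),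
    hcomplete P -> bilinear_fun b ->
    exists! g : T -> P, linear g /\ forall x y, g (tau x y) = b x y
}.

Record is_halgtensor (A B T : algType K) (tau : A -> B -> T) : Prop := {
  halgtensor_htensor : is_htensor tau;
  halgtensor_one : tau 1 1 = 1;
  halgtensor_mul : forall a a' b b', tau a b * tau a' b' = tau (a * a') (b * b')
}.

(* The linear map of source T attached to a bilinear map b; it is the junk value
   0 only when no such linear map exists. *)
Definition hlift (M N T P : lmodType K) (tau : M -> N -> T) (b : M -> N -> P) :
    T -> P :=
  xget (fun=> 0) [set g | linear g /\ forall x y, g (tau x y) = b x y]%classic.

End HbarAdic.

(** * Modules k[[hbar]]^E and topological Hopf algebras on them *)

Section WeakModules.
Variable k : fieldType.
Local Notation K := (fps k).

Definition wmod (E : Type) : Type := E -> K^o.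
HB.instance Definition _ (E : Type) := GRing.Lmodule.on (wmod E).

(* Continuity at 0 for the product topology on the source, where each factor
   k[[hbar]] carries the hbar-adic topology. *)
Definition wcontinuous_form (A : Type) (f : wmod A -> K^o) : Prop :=
  forall n, exists m (s : set A), finite_set s /\
    forall x : wmod A, (forall a, s a -> hdvd m (x a)) -> hdvd n (f x).

Definition wform (A : Type) (f : wmod A -> K^o) : Prop :=
  linear f /\ wcontinuous_form f.

Definition wmap (A B : Type) (f : wmod A -> wmod B) : Prop :=
  linear f /\ forall b, wcontinuous_form (f^~ b).

Definition wtensor (A B : Type) (x : wmod A) (y : wmod B) : wmod (A * B) :=
  fun p => x p.1 * y p.2.

(* f (x) id and id (x) g, on k[[hbar]]^A (x) k[[hbar]]^B = k[[hbar]]^(A * B) *)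
Definition wtensl (A C B : Type) (f : wmod A -> wmod C) (t : wmod (A * B)) :
    wmod (C * B) :=
  fun p => f (fun a => t (a, p.2)) p.1.
Definition wtensr (A B D : Type) (g : wmod B -> wmod D) (t : wmod (A * B)) :
    wmod (A * D) :=
  fun p => g (fun b => t (p.1, b)) p.2.
Definition wslicel (A B : Type) (e : wmod A -> K^o) (t : wmod (A * B)) : wmod B :=
  fun b => e (fun a => t (a, b)).
Definition wslicer (A B : Type) (e : wmod B -> K^o) (t : wmod (A * B)) : wmod A :=
  fun a => e (fun b => t (a, b)).

Definition wswap23 (A B C D : Type) (t : wmod ((A * B) * (C * D))) :
    wmod ((A * C) * (B * D)) :=
  fun p => t ((p.1.1, p.2.1), (p.1.2, p.2.2)).

(* Product (as a map on the tensor square), unit and counit. *)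
Record augAlg (E : Type) := AugAlg {
  amul : wmod (E * E) -> wmod E;
  aone : wmod E;
  aeps : wmod E -> K^o
}.

Definition aprod (E : Type) (A : augAlg E) (x y : wmod E) : wmod E :=
  amul A (wtensor x y).

Definition augAlg_sq (E : Type) (A : augAlg E) : augAlg (E * E) := AugAlg
  (fun t => wtensl (amul A) (wtensr (amul A) (wswap23 t)))
  (wtensor (aone A) (aone A))
  (fun t => aeps A (wslicer (aeps A) t)).

Record is_augAlg (E : Type) (A : augAlg E) : Prop := {
  amul_map : wmap (amul A);
  amulA : associative (aprod A);
  amul1l : left_id (aone A) (aprod A);
  amul1r : right_id (aone A) (aprod A);
  aeps_form : wform (aeps A);
  aeps_mul : forall x y, aeps A (aprod A x y) = aeps A x * aeps A y;
  aeps_one : aeps A (aone A) = 1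
}.

Record is_wHopf (E : Type) (A : augAlg E)
    (D : wmod E -> wmod (E * E)) (S : wmod E -> wmod E) : Prop := {
  wHopf_alg : is_augAlg A;
  wHopf_comul_map : wmap D;
  wHopf_antip_map : wmap S;
  wHopf_coassoc : forall x a b c,
    wtensl D (D x) ((a, b), c) = wtensr D (D x) (a, (b, c));
  wHopf_counitl : forall x, wslicel (aeps A) (D x) = x;
  wHopf_counitr : forall x, wslicer (aeps A) (D x) = x;
  wHopf_comulM : forall x y, D (aprod A x y) = aprod (augAlg_sq A) (D x) (D y);
  wHopf_comul1 : D (aone A) = aone (augAlg_sq A);
  wHopf_antipl : forall x, amul A (wtensl S (D x)) = aeps A x *: aone A;
  wHopf_antipr : forall x, amul A (wtensr S (D x)) = aeps A x *: aone A
}.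

(* I = hbar F + Ker eps, and its powers (finite sums of products) *)
Definition augI (E : Type) (A : augAlg E) (x : wmod E) : Prop :=
  exists y z, x = hbar *: y + z /\ aeps A z = 0.

Fixpoint augIpow (E : Type) (A : augAlg E) (n : nat) (x : wmod E) : Prop :=
  if n is m.+1 then
    exists (N : nat) (a b : nat -> wmod E),
      (forall i, augI A (a i) /\ augIpow A m (b i)) /\
      x = \sum_(i < N) aprod A (a i) (b i)
  else True.

(* F / hbar F is commutative, its topology (the one of k^E) is the adic topology
   of its augmentation ideal, and it is isomorphic to k[[x_1,...,x_n]]; pi is the
   composite F -> F / hbar F -> k[[x_1,...,x_n]].  The coproduct mod hbar, once
   transported to k[[x_1,...,x_n]], is then that of a formal group; the
   isomorphism automatically respects counits, as k[[x_1,...,x_n]] is local with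
   a unique k-algebra morphism to k.  F / hbar F = k^E is complete. *)
Record is_formal_group_limit (E : Type) (A : augAlg E) : Prop := {
  flimit_comm : forall x y, hdvd 1 (aprod A x y - aprod A y x);
  flimit_open : forall n, exists s : set E, finite_set s /\
    forall x : wmod E, (forall a, s a -> hdvd 1 (x a)) ->
      exists y, augIpow A n y /\ hdvd 1 (x - y);
  flimit_sep : forall a, exists n, forall x, augIpow A n x -> hdvd 1 (x a);
  flimit_iso : exists (n : nat) (pi : wmod E -> mfps k n),
    [/\ (forall x y, pi (x + y) = pi x + pi y),
        (forall c x, pi (c *: x) = mfps_const n (fcoef c 0) * pi x),
        (forall x y, pi (aprod A x y) = pi x * pi y),
        pi (aone A) = 1 &
        (forall z, exists x, pi x = z) /\ (forall x, pi x = 0 <-> hdvd 1 x)]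
}.

Record is_QFSHA (E : Type) (A : augAlg E)
    (D : wmod E -> wmod (E * E)) (S : wmod E -> wmod E) : Prop := {
  QFSHA_Hopf : is_wHopf A D S;
  QFSHA_limit : is_formal_group_limit A
}.

End WeakModules.

(** * The Drinfeld functor *)

Section Drinfeld.
Variable k : fieldType.
Local Notation K := (fps k).

(* {fraction K} = k((hbar)), so that F[hbar^-1] embeds into k((hbar))^E *)
Definition lwmod (E : Type) : Type := E -> {fraction K}.
HB.instance Definition _ (E : Type) := GRing.Zmodule.on (lwmod E).

Definition lscale (E : Type) (c : K) (g : lwmod E) : lwmod E :=
  fun e => FracField.tofrac c * g e.

(* hbar^-n f *)
Definition hfrac (E : Type) (n : nat) (f : wmod k E) : lwmod E :=
  fun e => FracField.tofrac (f e : K) / FracField.tofrac hbar ^+ n.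

(* The sum over n of the hbar^-n I^n, inside F[hbar^-1] *)
Definition veeLattice (E : Type) (A : augAlg k E) (g : lwmod E) : Prop :=
  exists (N : nat) (f : nat -> wmod k E),
    (forall n, augIpow A n (f n)) /\ g = \sum_(n < N) hfrac n (f n).

(* U, with iota : veeLattice A -> U, is the hbar-adic completion of the algebra
   veeLattice A.  The values of iota outside veeLattice A are irrelevant. *)
Record is_vee (E : Type) (A : augAlg k E) (U : algType K) (iota : lwmod E -> U) :
    Prop := {
  vee_add : forall g g', veeLattice A g -> veeLattice A g' ->
    iota (g + g') = iota g + iota g';
  vee_scale : forall c g, veeLattice A g -> iota (lscale c g) = c *: iota g;
  vee_one : iota (hfrac 0 (aone A)) = 1;
  vee_mul : forall n m x y, augIpow A n x -> augIpow A m y ->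
    iota (hfrac (n + m) (aprod A x y)) = iota (hfrac n x) * iota (hfrac m y);
  vee_complete : hcomplete U;
  vee_inj : forall m g, veeLattice A g -> hdvd m (iota g) ->
    exists2 g', veeLattice A g' & g = lscale (hbar ^+ m) g';
  vee_dense : forall m u, exists2 g, veeLattice A g & hdvd m (u - iota g)
}.

(* The canonical map from F to its dual *)
Definition vee_in (E : Type) (U : algType K) (iota : lwmod E -> U)
    (x : wmod k E) : U := iota (hfrac 0 x).

(* The dual U of F together with its completed tensor powers: U2 is both
   U (x) U and the dual of F (x) F, compatibly, and U3 = U2 (x) U.  All of them
   are determined up to unique isomorphism; statements quantify over all
   choices. *)
Record veeDual (E : Type) (A : augAlg k E) := VeeDual {
  vU : algType K;
  vU2 : algType K;
  vU3 : algType K;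
  viota : lwmod E -> vU;
  viota2 : lwmod (E * E) -> vU2;
  vtau : vU -> vU -> vU2;
  vtau3 : vU2 -> vU -> vU3;
  vUP : is_vee A viota;
  vU2P : is_vee (augAlg_sq A) viota2;
  vtauP : is_halgtensor vtau;
  vtau3P : is_halgtensor vtau3;
  vtau_in : forall x y : wmod k E,
    vee_in viota2 (wtensor x y) = vtau (vee_in viota x) (vee_in viota y)
}.

Section Twist.
Variables (E : Type) (A : augAlg k E).
Variables (D : wmod k E -> wmod k (E * E)) (S : wmod k E -> wmod k E).
Variable V : veeDual A.
Local Notation U := (vU V).
Local Notation U2 := (vU2 V).
Local Notation U3 := (vU3 V).
Local Notation j := (vee_in (viota V)).
Local Notation j2 := (vee_in (@viota2 _ _ V)).

(* The unique linear extension to U of a linear map defined on F *)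
Definition vee_ext (P : lmodType K) (f : wmod k E -> P) : U -> P :=
  xget (fun=> 0) [set g : U -> P | linear g /\ forall x, g (j x) = f x]%classic.

Definition vcomul : U -> U2 := vee_ext (fun x => j2 (D x)).
Definition vcounit : U -> K^o := vee_ext (aeps A).
Definition vantip : U -> U := vee_ext (fun x => j (S x)).

Definition vcounitl : U2 -> U := hlift (@vtau _ _ V) (fun a b => vcounit a *: b).
Definition vcounitr : U2 -> U := hlift (@vtau _ _ V) (fun a b => vcounit b *: a).

(* t_12, t_23, (Delta (x) id)(t), (id (x) Delta)(t) *)
Definition v12 (t : U2) : U3 := vtau3 t 1.
Definition vput (a : U) : U2 -> U3 :=
  hlift (@vtau _ _ V) (fun b c => vtau3 (vtau a b) c).
Definition v23 : U2 -> U3 := vput 1.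
Definition vcomull : U2 -> U3 :=
  hlift (@vtau _ _ V) (fun a b => vtau3 (vcomul a) b).
Definition vcomulr : U2 -> U3 :=
  hlift (@vtau _ _ V) (fun a b => vput a (vcomul b)).

(* Finv is the inverse of F *)
Record is_twist (F Finv : U2) : Prop := {
  twist_invr : F * Finv = 1;
  twist_invl : Finv * F = 1;
  twist_counitl : vcounitl F = 1;
  twist_counitr : vcounitr F = 1;
  twist_cocycle : v12 F * vcomull F = v23 F * vcomulr F
}.

Record is_polar_twist (phi : wmod k (E * E)) (F Finv : U2) : Prop := {
  polar_counitl : wslicel (aeps A) phi = 0;
  polar_counitr : wslicer (aeps A) phi = 0;
  polar_exp : is_hexp (viota2 V (hfrac 1 phi)) F;
  polar_twist : is_twist F Finv
}.

Definition twist_comul (F Finv : U2) (u : U) : U2 := F * vcomul u * Finv.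

(* m (S (x) id)(Finv) *)
Definition twist_v (Finv : U2) : U :=
  hlift (@vtau _ _ V) (fun a b => vantip a * b) Finv.

(* u |-> v^-1 S(u) v for v = m (S (x) id)(Finv).  This is the side on which
   conjugation yields the antipode of F Delta(-) Finv: writing F = f_1 (x) f_2 and
   Finv = f'_1 (x) f'_2, it rests on S(f_1) v f_2 = m (S (x) id)(Finv F) = 1. *)
Definition twist_antip (v vinv u : U) : U := vinv * vantip u * v.

End Twist.
End Drinfeld.

(* Main.v *)
(* Write F2 for the completed tensor square of F, and I for hbar F + Ker eps. The
   counit conditions put phi in I2^2, and commutators of elements of I lie in
   hbar I, so delta = hbar^-1 [phi, -] is a derivation of F2 raising the I2-adic
   filtration by one. Hence exp(delta) converges on F2, and it is conjugation by
   the twist: D^F = exp(delta) o D maps F to F2.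

   Identities of the dual U = F^vee descend to F because F meets hbar^m U exactly
   in I^m. This holds since ordered monomials in lifts of the coordinates of G form
   a topological basis of F adapted to I^n, a Poincare-Birkhoff-Witt argument
   resting on [I, I^n] in hbar I^n. The basis also lets maps on F (x) F or
   F (x) F (x) F be compared on pure tensors modulo powers of I.

   The twisted antipode T = v^-1 S v of U satisfies T = eps - T * (id - eps) for the
   twisted convolution. Iterating this equation inside F converges I-adically,
   since id - eps maps F to I, and the limit is T; hence T preserves F. *)

From HB Require Import structures.
Require Import Defs.
From mathcomp Require Import all_boot all_order all_algebra.
From mathcomp Require Import all_classical.
Local Open Scope ring_scope.

Set Implicit Arguments.
Unset Strict Implicit.
Unset Printing Implicit Defensive.
Import GRing.Theory.

(** * Power series and hbar-adic modules *)

(** Three topologies meet: the weak one of F = k[[hbar]]^E, the I-adic one, and the hbar-adic one of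
    U. Limits are evident in the weak topology, size is measured I-adically, and U knows only powers
    of hbar. The first two are reconciled by finite generation: I^(n+m) is a sum of w_i I^m over one
    finite family of w_i in I^n, so that weak limits of I-adically small terms stay small.

    The tensor powers of U are known through universal properties, and the map F2 -> U2 is
    prescribed on pure tensors only. Finite sums of pure tensors approximate t up to slices in I^m
    in the last factor; hence the continuity notion [tcont]. It does not see the middle factor of F
    (x) F (x) F, so id (x) Delta requires I2^(2m) to be split into a part small in one leg and a
    part small in the other.

    The inverse of v = m (S (x) id)([Twi]) is w = m (id (x) S)([Tw]): the cocycle identity is
    evaluated under a (x) b (x) c |-> S(a) b S(c) and under a (x) b (x) c |-> a S(b) c.
    Characteristic 0 enters through exp(x) y = exp(ad x)(y) exp(x). *)

Section FpsFacts.
Variable R : comNzRingType.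
Implicit Types a b : fps R.

Lemma fcoefD a b n : fcoef (a + b) n = fcoef a n + fcoef b n. Proof. by []. Qed.
Lemma fcoefB a b n : fcoef (a - b) n = fcoef a n - fcoef b n. Proof. by []. Qed.
Lemma fcoefM a b n :
  fcoef (a * b) n = \sum_(i < n.+1) fcoef a i * fcoef b (n - i)%N.
Proof. by []. Qed.

Lemma fcoef_sum (I : Type) (r : seq I) (P : pred I) (f : I -> fps R) n :
  fcoef (\sum_(i <- r | P i) f i) n = \sum_(i <- r | P i) fcoef (f i) n.
Proof. by elim/big_rec2: _ => // i x y _ <-. Qed.

Lemma fcoef_constM (c : R) a n : fcoef (fps_const c * a) n = c * fcoef a n.
Proof.
rewrite fcoefM big_ord_recl /= subn0 big1 ?addr0 // => i _.
by rewrite mul0r.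
Qed.

Lemma fcoef_hbarM a n :
  fcoef (hbar * a) n = if n is m.+1 then fcoef a m else 0.
Proof.
rewrite fcoefM; case: n => [|n]; first by rewrite big_ord1 /= mul0r.
rewrite big_ord_recl /= mul0r add0r big_ord_recl /= mul1r subSS subn0.
by rewrite big1 ?addr0 // => i _; rewrite mul0r.
Qed.

Lemma fcoef_hbarXM m a n :
  fcoef (hbar ^+ m * a) n = if (n < m)%N then 0 else fcoef a (n - m)%N.
Proof.
elim: m n => [|m IH] n; first by rewrite expr0 mul1r subn0.
by rewrite exprS -mulrA fcoef_hbarM; case: n => [|n] //; rewrite IH subSS ltnS.
Qed.

Fact fps_const_is_zmod : zmod_morphism (@fps_const R).
Proof. by move=> c d; apply: fpsP => -[|n] //=; rewrite subrr. Qed.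
Fact fps_const_is_monoid : monoid_morphism (@fps_const R).
Proof.
split=> // c d; apply: fpsP => n; rewrite fcoef_constM /=.
by case: eqP; rewrite ?mulr0.
Qed.
HB.instance Definition _ := GRing.isZmodMorphism.Build R (fps R) (@fps_const R)
  fps_const_is_zmod.
HB.instance Definition _ := GRing.isMonoidMorphism.Build R (fps R) (@fps_const R)
  fps_const_is_monoid.

End FpsFacts.

Section Hadic.
Variable k : fieldType.
Local Notation K := (fps k).

Lemma hbar_neq0 : (hbar : K) != 0.
Proof.
apply/eqP => /(congr1 (fun a => fcoef a 1%N)) /= /eqP.
by rewrite oner_eq0.
Qed.

Section Module.
Variable M : lmodType K.
Implicit Types x y : M.

Lemma hdvd0 n : hdvd n (0 : M). Proof. by exists 0; rewrite scaler0. Qed.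
Lemma hdvd00 x : hdvd 0 x. Proof. by exists x; rewrite scale1r. Qed.
Lemma hdvdD n x y : hdvd n x -> hdvd n y -> hdvd n (x + y).
Proof. by move=> [a ->] [b ->]; exists (a + b); rewrite scalerDr. Qed.
Lemma hdvdN n x : hdvd n x -> hdvd n (- x).
Proof. by move=> [a ->]; exists (- a); rewrite scalerN. Qed.
Lemma hdvdB n x y : hdvd n x -> hdvd n y -> hdvd n (x - y).
Proof. by move=> ? ?; apply/hdvdD/hdvdN. Qed.
Lemma hdvdZ n c x : hdvd n x -> hdvd n (c *: x).
Proof. by move=> [a ->]; exists (c *: a); rewrite !scalerA mulrC. Qed.
Lemma hdvd_sum (I : Type) (r : seq I) (P : pred I) (f : I -> M) n :
  (forall i, P i -> hdvd n (f i)) -> hdvd n (\sum_(i <- r | P i) f i).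
Proof. by move=> H; elim/big_rec: _ => [|i x Pi]; [apply: hdvd0|apply/hdvdD/H]. Qed.
Lemma hdvd_le m n x : (m <= n)%N -> hdvd n x -> hdvd m x.
Proof.
move=> mn [y ->]; exists (hbar ^+ (n - m) *: y).
by rewrite scalerA -exprD subnKC.
Qed.
Lemma hdvd_hbarZ m n x : hdvd n x -> hdvd (m + n) (hbar ^+ m *: x).
Proof. by move=> [y ->]; exists y; rewrite scalerA -exprD. Qed.
Lemma hdvd_hbar n x : hdvd n (hbar ^+ n *: x). Proof. by exists x. Qed.
Lemma hdvd_sub n x y : hdvd n (x - y) -> hdvd n y -> hdvd n x.
Proof. by move=> xy y0; rewrite -(subrK y x); apply: hdvdD. Qed.
Lemma hdvd_subC n x y : hdvd n (x - y) -> hdvd n (y - x).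
Proof. by move/hdvdN; rewrite opprB. Qed.
Lemma hdvd_trans n x y z : hdvd n (x - y) -> hdvd n (y - z) -> hdvd n (x - z).
Proof. by move=> xy /(hdvdD xy); rewrite addrA subrK. Qed.

Definition htfree := forall x : M, hbar *: x = 0 -> x = 0.

Lemma htfreeX n x : htfree -> hbar ^+ n *: x = 0 -> x = 0.
Proof.
move=> tf; elim: n => [|n IH]; first by rewrite scale1r.
by rewrite exprS -scalerA => /tf.
Qed.

Lemma htfree_inj n x y : htfree -> hbar ^+ n *: x = hbar ^+ n *: y -> x = y.
Proof.
move=> tf xy; apply/eqP; rewrite -subr_eq0; apply/eqP/(@htfreeX n) => //.
by rewrite scalerBr xy subrr.
Qed.

Lemma htfree_hdvd m n x : htfree -> hdvd (m + n) (hbar ^+ m *: x) -> hdvd n x.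
Proof. by move=> tf [y]; rewrite exprD -scalerA => /(htfree_inj tf) ->; exists y. Qed.

Hypothesis cM : hcomplete M.

Lemma hsep x y : (forall n, hdvd n (x - y)) -> x = y.
Proof. by move=> H; apply/eqP; rewrite -subr_eq0; apply/eqP/cM.1. Qed.

Lemma hsep0 x : (forall n, hdvd n x) -> x = 0.
Proof. exact: cM.1. Qed.

Lemma hlim_seq (u : nat -> M) : (forall n, hdvd n (u n.+1 - u n)) ->
  exists l, forall n, hdvd n (l - u n).
Proof. exact: cM.2. Qed.

End Module.

Lemma linear_hdvd (M N : lmodType K) (f : M -> N) n x : linear f ->
  hdvd n x -> hdvd n (f x).
Proof.
move=> lf [y ->]; exists (f y).
have f0 : f 0 = 0.
  by have := lf (-1) 0 0; rewrite scaler0 addr0 scaleN1r addNr.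
by have := lf (hbar ^+ n) y 0; rewrite !addr0 f0 addr0.
Qed.

Section LinFun.
Variables (R : nzRingType) (M N : lmodType R) (f : M -> N).
Hypothesis lf : linear f.
Lemma linf0 : f 0 = 0.
Proof. by have := lf (-1) 0 0; rewrite scaler0 addr0 scaleN1r addNr. Qed.
Lemma linfD x y : f (x + y) = f x + f y.
Proof. by have := lf 1 x y; rewrite !scale1r. Qed.
Lemma linfZ c x : f (c *: x) = c *: f x.
Proof. by have := lf c x 0; rewrite !addr0 linf0 addr0. Qed.
Lemma linfN x : f (- x) = - f x.
Proof. by rewrite -scaleN1r linfZ scaleN1r. Qed.
Lemma linfB x y : f (x - y) = f x - f y.
Proof. by rewrite linfD linfN. Qed.
Lemma linf_sum (I : Type) (r : seq I) (P : pred I) (g : I -> M) :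
  f (\sum_(i <- r | P i) g i) = \sum_(i <- r | P i) f (g i).
Proof.
by elim/big_rec2: _ => [|i x y _ <-]; rewrite ?linf0 ?linfD.
Qed.
End LinFun.

Lemma fps_scaleE (c : K) (a : K^o) : c *: a = c * (a : K). Proof. by []. Qed.

Lemma hdvd_fpsP (a : K^o) n : hdvd n a <-> forall i, (i < n)%N -> fcoef a i = 0.
Proof.
split=> [[b ->] i ni|H]; first by rewrite fps_scaleE fcoef_hbarXM ni.
exists (Fps (fun i => fcoef a (n + i)%N)); apply: fpsP => i.
by rewrite fps_scaleE fcoef_hbarXM /=; case: ltnP => [/H//|ni]; rewrite subnKC.
Qed.

Lemma hdvdM m n (a b : K^o) : hdvd m a -> hdvd n b -> hdvd (m + n) (a * b : K^o).
Proof.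
by move=> [x ->] [y ->]; exists (x * y); rewrite exprD /GRing.scale /= mulrACA.
Qed.

Lemma fps_htfree : htfree K^o.
Proof. by move=> x /eqP; rewrite mulf_eq0 (negbTE hbar_neq0) => /eqP. Qed.

Lemma fps_hcomplete : hcomplete (K^o).
Proof.
split=> [x H|u H].
  by apply: fpsP => n; have /hdvd_fpsP := H n.+1; apply.
(* Coefficient i no longer changes from [u i.+1] on, so the limit is read off diagonally. *)
exists (Fps (fun i => fcoef (u i.+1) i)) => n; apply/hdvd_fpsP => i ni.
rewrite fcoefB /=; elim: n ni => // n IH; rewrite ltnS leq_eqVlt => /predU1P[->|ni].
  by rewrite subrr.
have /hdvd_fpsP/(_ _ ni) := H n; rewrite fcoefB => /eqP; rewrite subr_eq0 => /eqP ->.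
exact: IH.
Qed.

End Hadic.

(** * The modules k[[hbar]]^E *)

Section Weak.
Variable k : fieldType.
Local Notation K := (fps k).

Section One.
Variable A : Type.
Implicit Types (x y : wmod k A) (f g : wmod k A -> K^o).

Lemma wmodD x y a : (x + y) a = x a + y a. Proof. by []. Qed.
Lemma wmodB x y a : (x - y) a = x a - y a. Proof. by []. Qed.
Lemma wmodZ (c : K) x a : (c *: x) a = c * x a. Proof. by []. Qed.
Lemma wmod_sum (I : Type) (r : seq I) (P : pred I) (h : I -> wmod k A) a :
  (\sum_(i <- r | P i) h i) a = \sum_(i <- r | P i) h i a.
Proof. by elim/big_rec2: _ => // i x y _ <-. Qed.

Lemma hdvd_wmodP n x : hdvd n x <-> forall a, hdvd n (x a).
Proof.
split=> [[y ->] a|/choice[y xy]]; first by exists (y a).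
by exists y; apply/funext => a; rewrite xy.
Qed.

Lemma wmod_htfree : htfree (wmod k A).
Proof.
move=> x hx; apply/funext => a; apply: fps_htfree.
by move: hx => /(congr1 (fun z : wmod k A => z a)).
Qed.

Definition wbase (a : A) : wmod k A := fun b => (`[< a = b >]%:R : K^o).

Lemma wcont_approx f :
  (forall n, exists2 g, wcontinuous_form g & forall x, hdvd n (f x - g x)) ->
  wcontinuous_form f.
Proof.
move=> H n; have [g gc fg] := H n; have [m [s [fs gs]]] := gc n.
exists m, s; split=> // x xs; apply: hdvd_sub (fg x) _; exact: gs.
Qed.

Lemma wcont_le f n (s t : set A) m m' : (s `<=` t)%classic -> (m <= m')%N ->
  (forall x, (forall a, s a -> hdvd m (x a)) -> hdvd n (f x)) ->
  forall x, (forall a, t a -> hdvd m' (x a)) -> hdvd n (f x).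
Proof. by move=> st mm H x xt; apply: H => a /st/xt; apply: hdvd_le. Qed.

Lemma wcontD f g : wcontinuous_form f -> wcontinuous_form g ->
  wcontinuous_form (fun x => f x + g x).
Proof.
move=> fc gc n; have [m [s [fs fP]]] := fc n; have [p [t [ft gP]]] := gc n.
exists (maxn m p), (s `|` t)%classic; split; first by rewrite finite_setU.
move=> x xs; apply: hdvdD.
  by apply: (wcont_le _ _ fP xs) => [|]; [exact: subsetUl|rewrite leq_maxl].
by apply: (wcont_le _ _ gP xs) => [|]; [exact: subsetUr|rewrite leq_maxr].
Qed.

Lemma wcontZ c f : wcontinuous_form f -> wcontinuous_form (fun x => c * f x : K^o).
Proof.
move=> fc n; have [m [s [fs fP]]] := fc n.
by exists m, s; split=> // x /fP; apply: hdvdZ.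
Qed.

Lemma wcont0 : wcontinuous_form (fun _ : wmod k A => 0 : K^o).
Proof. by move=> n; exists 0%N, set0; split=> // x _; apply: hdvd0. Qed.

Lemma wcont_coord a : wcontinuous_form (fun x : wmod k A => x a).
Proof. by move=> n; exists n, [set a]%classic; split=> // x; apply. Qed.

Lemma wcont_sum (I : Type) (r : seq I) (F : I -> wmod k A -> K^o) :
  (forall i, wcontinuous_form (F i)) ->
  wcontinuous_form (fun x => \sum_(i <- r) F i x : K^o).
Proof.
move=> H; elim: r => [|i r IH].
  by under eq_fun do rewrite big_nil; apply: wcont0.
by under eq_fun do rewrite big_cons; apply: wcontD.
Qed.

(** Gives the continuity of hbar^-1 [phi, -] from that of the commutator. *)
Lemma wcont_div n f : wcontinuous_form (fun x => hbar ^+ n * f x : K^o) ->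
  wcontinuous_form f.
Proof.
move=> fc m; have [p [s [fs fP]]] := fc (n + m)%N.
by exists p, s; split=> // x /fP/htfree_hdvd; apply; apply: fps_htfree.
Qed.

(** Modulo hbar^n a continuous form depends on finitely many coordinates only, and x may be replaced
    by its restriction to these. The type [{classic A}] supplies the decidable equality that [undup]
    requires. *)
Lemma wform_approx f n : wform f ->
  exists l : seq {classic A}, forall x, hdvd n (f x - \sum_(a <- l) x a * f (wbase a) : K^o).
Proof.
move=> [lf fc]; have [m [s [fs fP]]] := fc n.
have /finite_seqP[l sl] : @finite_set {classic A} s by exact: fs.
exists (undup l) => x; have -> : \sum_(a <- undup l) x a * f (wbase a) =
    f (\sum_(a <- undup l) x a *: (wbase a : wmod k A)).
  by rewrite (linf_sum lf); apply: eq_bigr => a _; rewrite (linfZ lf).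
rewrite -(linfB lf); apply: fP => a sa; rewrite wmodB wmod_sum.
have al : (a : {classic A}) \in undup l by rewrite mem_undup; move: sa; rewrite sl.
rewrite (bigD1_seq (a : {classic A})) ?undup_uniq //= wmodZ /wbase asboolT // mulr1.
rewrite big1 ?addr0 ?subrr; first exact: hdvd0.
by move=> b ba; rewrite wmodZ asboolF ?mulr0 // => bea; rewrite bea eqxx in ba.
Qed.

Lemma wform_dvd f n : wform f -> (forall a, hdvd n (f (wbase a))) ->
  forall x, hdvd n (f x).
Proof.
move=> ff H x; have [l /(_ x)] := wform_approx n ff => /hdvd_sub; apply.
by apply: hdvd_sum => a _; apply: hdvdZ.
Qed.

Lemma wform_ext f g : wform f -> wform g -> (forall a, f (wbase a) = g (wbase a)) ->
  f =1 g.
Proof.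
move=> ff fg H x; apply: (hsep (fps_hcomplete k)) => n.
have fgf : wform (fun x => f x - g x : K^o).
  split=> [c y z|]; first by rewrite ff.1 fg.1 scalerBr opprD addrACA.
  have := wcontD ff.2 (wcontZ (-1) fg.2).
  by congr wcontinuous_form; apply/funext => y; rewrite mulN1r.
by apply: (wform_dvd fgf) => a; rewrite H subrr; apply: hdvd0.
Qed.

End One.

Lemma wform_coord (A B : Type) (f : wmod k A -> wmod k B) b :
  wmap f -> wform (f^~ b).
Proof. by move=> [lf cf]; split=> // c x y; rewrite lf. Qed.

Lemma wmap_coord (A B : Type) (f : wmod k A -> wmod k B) :
  (forall b, wform (f^~ b)) -> wmap f.
Proof.
move=> H; split=> [c x y|b]; last by have [] := H b.
by apply/funext => b; have [lf _] := H b; apply: lf.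
Qed.

Lemma wmap_ext (A B : Type) (f g : wmod k A -> wmod k B) :
  wmap f -> wmap g -> (forall a, f (wbase a) = g (wbase a)) -> f =1 g.
Proof.
move=> wf wg H x; apply/funext => b.
apply: (@wform_ext _ (f^~ b) (g^~ b)); try exact: wform_coord.
by move=> a; rewrite H.
Qed.

Lemma wform_comp (A B : Type) (e : wmod k B -> K^o) (f : wmod k A -> wmod k B) :
  wform e -> wmap f -> wform (e \o f).
Proof.
move=> fe [lf cf]; split=> [c x y|]; first by rewrite /= lf fe.1.
apply: wcont_approx => n; have [l H] := wform_approx n fe.
exists (fun x => \sum_(b <- l) f x b * e (wbase b) : K^o); last by move=> x; apply: H.
apply: wcont_sum => b; have := wcontZ (e (wbase b)) (cf b).
by congr wcontinuous_form; apply/funext => x; rewrite mulrC.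
Qed.

Lemma wmap_comp (A B C : Type) (g : wmod k B -> wmod k C) (f : wmod k A -> wmod k B) :
  wmap g -> wmap f -> wmap (g \o f).
Proof.
by move=> wg wf; apply: wmap_coord => c; apply: (wform_comp (wform_coord c wg)).
Qed.

Lemma wmap_id (A : Type) : wmap (@id (wmod k A)).
Proof. by split=> // a; apply: wcont_coord. Qed.

Lemma wmap_reindex (A B : Type) (h : B -> A) :
  wmap (fun t : wmod k A => (fun b => t (h b)) : wmod k B).
Proof. by split=> // b; apply: wcont_coord. Qed.

Lemma wmapD (A B : Type) (f g : wmod k A -> wmod k B) :
  wmap f -> wmap g -> wmap (fun x => f x + g x).
Proof.
move=> [lf cf] [lg cg]; split=> [c x y|b]; last exact: wcontD.
by rewrite lf lg scalerDr addrACA.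
Qed.

Lemma wmapZ (A B : Type) c (f : wmod k A -> wmod k B) :
  wmap f -> wmap (fun x => c *: f x).
Proof.
move=> [lf cf]; split=> [d x y|b]; last exact: wcontZ.
by rewrite lf scalerDr !scalerA mulrC.
Qed.

Lemma wmapB (A B : Type) (f g : wmod k A -> wmod k B) :
  wmap f -> wmap g -> wmap (fun x => f x - g x).
Proof.
move=> wf wg; have := wmapD wf (wmapZ (-1) wg).
by congr wmap; apply/funext => x; rewrite scaleN1r.
Qed.

Lemma wmap_sum (A B I : Type) (r : seq I) (f : I -> wmod k A -> wmod k B) :
  (forall i, wmap (f i)) -> wmap (fun x => \sum_(i <- r) f i x).
Proof.
move=> H; elim: r => [|i r IH].
  split=> [c x y|b]; first by rewrite !big_nil scaler0 addr0.
  by under eq_fun do rewrite big_nil; apply: wcont0.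
by under eq_fun do rewrite big_cons; apply: wmapD.
Qed.

Lemma wform_wmap (A B : Type) (e : wmod k A -> K^o) (y : wmod k B) :
  wform e -> wmap (fun x => e x *: y).
Proof.
move=> [le ce]; split=> [c x x'|b]; first by rewrite le scalerDl -scalerA.
have := wcontZ (y b) ce.
by congr wcontinuous_form; apply/funext => x; rewrite mulrC.
Qed.

Lemma wtensorZl (A B : Type) (x : wmod k A) (y : wmod k B) b :
  (fun a => wtensor x y (a, b)) = y b *: x.
Proof. by apply/funext => a; rewrite /wtensor wmodZ mulrC. Qed.

Lemma wtensorZr (A B : Type) (x : wmod k A) (y : wmod k B) a :
  (fun b => wtensor x y (a, b)) = x a *: y.
Proof. by []. Qed.

Lemma wmap_tensor_r (A B : Type) (x : wmod k A) : wmap (@wtensor k A B x).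
Proof.
split=> [c y z|[a b]].
  by apply/funext => -[a b]; rewrite /wtensor !wmodD !wmodZ mulrDr mulrCA.
by apply: wcontZ; apply: wcont_coord.
Qed.

Lemma wmap_tensor_l (A B : Type) (y : wmod k B) : wmap (fun x => @wtensor k A B x y).
Proof.
split=> [c x z|[a b]].
  by apply/funext => -[a b]; rewrite /wtensor !wmodD !wmodZ mulrDl mulrA.
have := wcontZ (y b) (wcont_coord (a : A)).
by congr wcontinuous_form; apply/funext => x; rewrite /wtensor mulrC.
Qed.

Lemma wmap_tensl (A B C : Type) (f : wmod k A -> wmod k C) :
  wmap f -> wmap (@wtensl k A C B f).
Proof.
move=> wf; apply: wmap_coord => -[c b].
exact: (wform_comp (wform_coord c wf) (wmap_reindex (fun a => (a, b)))).
Qed.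

Lemma wmap_tensr (A B D : Type) (g : wmod k B -> wmod k D) :
  wmap g -> wmap (@wtensr k A B D g).
Proof.
move=> wg; apply: wmap_coord => -[a d].
exact: (wform_comp (wform_coord d wg) (wmap_reindex (fun b => (a, b)))).
Qed.

Lemma wmap_slicel (A B : Type) (e : wmod k A -> K^o) :
  wform e -> wmap (@wslicel k A B e).
Proof.
move=> we; apply: wmap_coord => b.
exact: (wform_comp we (wmap_reindex (fun a => (a, b)))).
Qed.

Lemma wmap_slicer (A B : Type) (e : wmod k B -> K^o) :
  wform e -> wmap (@wslicer k A B e).
Proof.
move=> we; apply: wmap_coord => a.
exact: (wform_comp we (wmap_reindex (fun b => (a, b)))).
Qed.

Lemma wtensl_tensor (A B C : Type) (f : wmod k A -> wmod k C) x (y : wmod k B) :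
  linear f -> wtensl f (wtensor x y) = wtensor (f x) y.
Proof.
move=> lf; apply/funext => -[c b]; rewrite /wtensl.
by rewrite (_ : (fun a => _) = y b *: x) ?wtensorZl // (linfZ lf) wmodZ mulrC.
Qed.

Lemma wtensr_tensor (A B D : Type) (g : wmod k B -> wmod k D) (x : wmod k A) y :
  linear g -> wtensr g (wtensor x y) = wtensor x (g y).
Proof.
by move=> lg; apply/funext => -[a d]; rewrite /wtensr wtensorZr (linfZ lg).
Qed.

Lemma wslicel_tensor (A B : Type) (e : wmod k A -> K^o) x (y : wmod k B) :
  linear e -> wslicel e (wtensor x y) = e x *: y.
Proof.
move=> le; apply/funext => b; rewrite /wslicel.
by rewrite (_ : (fun a => _) = y b *: x) ?wtensorZl // (linfZ le) wmodZ mulrC.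
Qed.

Lemma wslicer_tensor (A B : Type) (e : wmod k B -> K^o) (x : wmod k A) y :
  linear e -> wslicer e (wtensor x y) = e y *: x.
Proof.
move=> le; apply/funext => a; rewrite /wslicer wtensorZr (linfZ le).
by rewrite wmodZ mulrC.
Qed.

Lemma wbase_tensor (A B : Type) (p : A * B) :
  wbase p = wtensor (wbase p.1) (wbase p.2).
Proof.
case: p => a b; apply/funext => -[a' b']; rewrite /wtensor /wbase /=.
rewrite -natrM mulnb -asbool_and; congr (_%:R); congr nat_of_bool.
by apply/asbool_equiv_eq; split=> [[-> ->]|[-> ->]].
Qed.

(** The base vectors of k[[hbar]]^(A * B) are themselves pure tensors, so weakly continuous maps are
    determined on pure tensors. *)
Lemma wmap_tensor_ext (A B C : Type) (f g : wmod k (A * B) -> wmod k C) :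
  wmap f -> wmap g -> (forall x y, f (wtensor x y) = g (wtensor x y)) -> f =1 g.
Proof. by move=> wf wg H; apply: wmap_ext => // p; rewrite wbase_tensor. Qed.

Lemma wform_tensor_ext (A B : Type) (f g : wmod k (A * B) -> K^o) :
  wform f -> wform g -> (forall x y, f (wtensor x y) = g (wtensor x y)) -> f =1 g.
Proof. by move=> wf wg H; apply: wform_ext => // p; rewrite wbase_tensor. Qed.

(** A Fubini rule: both sides are continuous in t, so the interchange is checked on pure tensors. *)
Lemma wslice_exchange (A B : Type) (e : wmod k A -> K^o) (e' : wmod k B -> K^o) t :
  wform e -> wform e' -> e' (wslicel e t) = e (wslicer e' t).
Proof.
move=> we we'.
apply: (@wform_tensor_ext A B (e' \o wslicel e) (e \o wslicer e')).
- exact/wform_comp/wmap_slicel.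
- exact/wform_comp/wmap_slicer.
- move=> x y /=; rewrite (wslicel_tensor _ _ we.1) (wslicer_tensor _ _ we'.1).
  by rewrite (linfZ we'.1) (linfZ we.1) /= !fps_scaleE mulrC.
Qed.

Lemma wmap_slicer_exchange (A B C : Type) (e : wmod k A -> K^o)
    (g : wmod k B -> wmod k C) t :
  wform e -> wmap g -> g (wslicel e t) = wslicel e (wtensr g t).
Proof.
move=> we wg; apply: (@wmap_tensor_ext A B C (g \o wslicel e) (wslicel e \o wtensr g)).
- exact/wmap_comp/wmap_slicel.
- exact/wmap_comp/wmap_tensr/wg/wmap_slicel.
- move=> x y /=; rewrite (wslicel_tensor _ _ we.1) (wtensr_tensor _ _ wg.1).
  by rewrite (wslicel_tensor _ _ we.1) (linfZ wg.1).
Qed.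

End Weak.

(** * Algebras on k[[hbar]]^E and the filtration I^n *)

(** A copy of [wmod k E] indexed by the proof [hB], on which the laws of B can be registered as a
    canonical algebra structure. The two types are convertible, and proofs pass freely between
    them. *)
Definition falg (k : fieldType) (E : Type) (B : augAlg k E) (hB : is_augAlg B) : Type :=
  wmod k E.

Section Falg.
Variables (k : fieldType) (E : Type) (B : augAlg k E) (hB : is_augAlg B).
Local Notation K := (fps k).
Local Notation F := (falg hB).

HB.instance Definition _ := GRing.Lmodule.on F.

Fact falg_mulDl : left_distributive (aprod B : F -> F -> F) +%R.
Proof.
move=> x y z; rewrite /aprod.
by rewrite (linfD (wmap_tensor_l _ z).1) (linfD (amul_map hB).1).
Qed.
Fact falg_mulDr : right_distributive (aprod B : F -> F -> F) +%R.
Proof.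
move=> x y z; rewrite /aprod.
by rewrite (linfD (wmap_tensor_r _ x).1) (linfD (amul_map hB).1).
Qed.
Fact falg_neq0 : (aone B : F) != 0.
Proof.
apply/eqP => /(congr1 (aeps B)); rewrite (aeps_one hB) (linf0 (aeps_form hB).1).
by apply/eqP; rewrite oner_eq0.
Qed.
HB.instance Definition _ := GRing.Zmodule_isNzRing.Build F
  (amulA hB) (amul1l hB) (amul1r hB) falg_mulDl falg_mulDr falg_neq0.
Fact falg_scaleAl (c : K) (x y : F) : c *: (x * y) = (c *: x) * y.
Proof.
rewrite [x * y]/(aprod B x y) [_ * y]/(aprod B (c *: x) y) /aprod.
by rewrite (linfZ (wmap_tensor_l _ y).1) (linfZ (amul_map hB).1).
Qed.
Fact falg_scaleAr (c : K) (x y : F) : c *: (x * y) = x * (c *: y).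
Proof.
rewrite [x * y]/(aprod B x y) [x * (c *: y)]/(aprod B x (c *: y)) /aprod.
by rewrite (linfZ (wmap_tensor_r _ x).1) (linfZ (amul_map hB).1).
Qed.
HB.instance Definition _ := GRing.Lmodule_isLalgebra.Build K F falg_scaleAl.
HB.instance Definition _ := GRing.Lalgebra_isAlgebra.Build K F falg_scaleAr.

Lemma wmap_mull (x : F) : wmap (fun y : wmod k E => x * (y : F) : F).
Proof. exact: (wmap_comp (amul_map hB) (wmap_tensor_r _ x)). Qed.
Lemma wmap_mulr (y : F) : wmap (fun x : wmod k E => (x : F) * y : F).
Proof. exact: (wmap_comp (amul_map hB) (wmap_tensor_l _ y)). Qed.

Local Notation eps := (aeps B).
Let leps := (aeps_form hB).1.

Lemma epsM (x y : F) : eps (x * y) = eps x * eps y. Proof. exact: aeps_mul. Qed.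
Lemma eps1 : eps (1 : F) = 1. Proof. exact: aeps_one. Qed.

Lemma augIP (x : F) : augI B x <-> hdvd 1 (eps x).
Proof.
split=> [[y [z [-> z0]]]|[c ec]].
  by rewrite (linfD leps) z0 addr0 (linfZ leps); exists (eps y).
exists (c *: (1 : F)), (x - hbar *: (c *: (1 : F))); split; first by rewrite addrC subrK.
by rewrite (linfB leps) !(linfZ leps) eps1 ec expr1 fps_scaleE [_ *: 1]mulr1 subrr.
Qed.

Local Notation I n := (augIpow B n).

Lemma augI_eps0 (x : F) : eps x = 0 -> augI B x.
Proof. by move=> x0; apply/augIP; rewrite x0; apply: hdvd0. Qed.

Lemma augID (x y : F) : augI B x -> augI B y -> augI B (x + y).
Proof. by rewrite !augIP (linfD leps); apply: hdvdD. Qed.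
Lemma augIMl (x y : F) : augI B y -> augI B (x * y).
Proof. by rewrite !augIP epsM; apply: hdvdZ. Qed.
Lemma augIMr (x y : F) : augI B x -> augI B (x * y).
Proof. by rewrite !augIP epsM mulrC; apply: hdvdZ. Qed.
Lemma augI_hbar (x : F) : augI B (hbar *: x : F).
Proof. by rewrite augIP (linfZ leps); exists (eps x). Qed.

Lemma augIpow_elim n (P : F -> Prop) : P 0 -> (forall x y, P x -> P y -> P (x + y)) ->
  (forall a b : F, augI B a -> I n b -> P (a * b)) -> forall x, I n.+1 x -> P x.
Proof.
move=> P0 PD PM x [N [a [b [ab ->]]]].
by elim/big_rec: _ => // i y _; apply: PD; apply: PM; have [] := ab i.
Qed.

Lemma augIpow_zero n : I n (0 : F).
Proof.
elim: n => // n IH; exists 0%N, (fun=> 0), (fun=> 0); split; last by rewrite big_ord0.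
by move=> _; split=> //; apply: augI_eps0; rewrite (linf0 leps).
Qed.

Lemma augIpow_base n (a b : F) : augI B a -> I n b -> I n.+1 (a * b : F).
Proof.
move=> aI bI; exists 1%N, (fun=> a), (fun=> b); split=> //.
by rewrite big_ord1.
Qed.

Lemma augIpowD n (x y : F) : I n x -> I n y -> I n (x + y).
Proof.
case: n => // n [N [a [b [ab xE]]]] [M [c [d [cd yE]]]].
exists (N + M)%N, (fun i => if (i < N)%N then a i else c (i - N)%N),
  (fun i => if (i < N)%N then b i else d (i - N)%N); split.
  by move=> i; case: ifP.
rewrite big_split_ord xE yE /=; congr (_ + _); apply: eq_bigr => i _.
  by rewrite ltn_ord.
by rewrite ltnNge leq_addr /= addKn.
Qed.

Lemma augIpow_sum n (J : Type) (r : seq J) (P : pred J) (f : J -> F) :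
  (forall i, P i -> I n (f i)) -> I n (\sum_(i <- r | P i) f i).
Proof.
by move=> H; elim/big_rec: _ => [|i x Pi]; [apply: augIpow_zero|apply/augIpowD/H].
Qed.

Lemma augIpowMl n (x y : F) : I n y -> I n (x * y : F).
Proof.
case: n => // n; elim/augIpow_elim => [|u v|a b aI bI].
- by rewrite mulr0; apply: augIpow_zero.
- by rewrite mulrDr; apply: augIpowD.
- by rewrite mulrA; apply: augIpow_base => //; apply: augIMl.
Qed.

Lemma augIpowMr n (x y : F) : I n x -> I n (x * y : F).
Proof.
elim: n x => // n IH x; elim/augIpow_elim => [|u v|a b aI bI].
- by rewrite mul0r; apply: augIpow_zero.
- by rewrite mulrDl; apply: augIpowD.
- by rewrite -mulrA; apply: augIpow_base => //; apply: IH.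
Qed.

Lemma augIpowZ n c (x : F) : I n x -> I n (c *: x : F).
Proof. by move=> xI; rewrite -[x]mul1r scalerAl; apply: augIpowMl. Qed.

Lemma augIpowN n (x : F) : I n x -> I n (- x).
Proof. by move=> xI; rewrite -scaleN1r; apply: augIpowZ. Qed.

Lemma augIpowB n (x y : F) : I n x -> I n y -> I n (x - y).
Proof. by move=> xI yI; apply/augIpowD/augIpowN. Qed.

Lemma augIpowM n m (x y : F) : I n x -> I m y -> I (n + m) (x * y : F).
Proof.
elim: n x => [|n IH] x; first by move=> _; apply: augIpowMl.
move=> xI yI; elim/augIpow_elim: xI => [|u v|a b aI bI].
- by rewrite mul0r; apply: augIpow_zero.
- by rewrite mulrDl; apply: augIpowD.
- by rewrite -mulrA; apply: augIpow_base => //; apply: IH.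
Qed.

Lemma augIpowS n (x : F) : I n.+1 x -> I n x.
Proof.
elim: n x => // n IH x; elim/augIpow_elim => [|u v|a b aI bI].
- exact: augIpow_zero.
- exact: augIpowD.
- by apply: augIpow_base => //; apply: IH.
Qed.

Lemma augIpow_le m n (x : F) : (m <= n)%N -> I n x -> I m x.
Proof. by move=> /subnK <-; elim: (n - m)%N => // d IH /augIpowS. Qed.

Lemma augIpow_hbar n (x : F) : I n x -> I n.+1 (hbar *: x : F).
Proof.
move=> xI; rewrite -[x]mul1r scalerAl; apply: augIpow_base => //.
exact: augI_hbar.
Qed.

Lemma augIpow_hbarX m n (x : F) : I n x -> I (m + n) (hbar ^+ m *: x : F).
Proof.
move=> xI; elim: m => [|m IH]; first by rewrite scale1r.
by rewrite exprS -scalerA; apply: augIpow_hbar.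
Qed.

Lemma hdvd_augIpow n (x : F) : hdvd n x -> I n x.
Proof. by move=> [y ->]; rewrite -[n in augIpow B n]addn0; exact: (@augIpow_hbarX n 0 y). Qed.

Lemma augIpow1 (x : F) : augI B x -> I 1 x.
Proof. by move=> xI; rewrite -[x]mulr1; apply: augIpow_base. Qed.

Lemma augIpow1E (x : F) : I 1 x -> augI B x.
Proof.
elim/augIpow_elim => [|u v|a b aI _].
- by apply: augI_eps0; rewrite (linf0 leps).
- exact: augID.
- exact: augIMr.
Qed.

Lemma augIpowX n (x : F) : augI B x -> I n (x ^+ n : F).
Proof. by move=> xI; elim: n => // n IH; rewrite exprS; apply: augIpow_base. Qed.

Lemma eps_augIpow n (x : F) : I n x -> hdvd n (eps x).
Proof.
elim: n x => [|n IH] x; first by move=> _; apply: hdvd00.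
elim/augIpow_elim => [|u v|a b /augIP aI /IH bI].
- by rewrite (linf0 leps); apply: hdvd0.
- by rewrite (linfD leps); apply: hdvdD.
- by rewrite epsM -add1n; apply: hdvdM.
Qed.

Definition hI n (x : F) := exists2 z : F, I n z & x = hbar *: z.

Lemma hI0 n : hI n 0.
Proof. by exists 0; [apply: augIpow_zero|rewrite scaler0]. Qed.
Lemma hID n (x y : F) : hI n x -> hI n y -> hI n (x + y).
Proof.
by move=> [a aI ->] [b bI ->]; exists (a + b); [apply: augIpowD|rewrite scalerDr].
Qed.
Lemma hIMl n m (x y : F) : I m x -> hI n y -> hI (m + n) (x * y).
Proof.
by move=> xI [z zI ->]; exists (x * z); [apply: augIpowM|rewrite scalerAr].
Qed.
Lemma hIMr n m (x y : F) : hI m x -> I n y -> hI (m + n) (x * y).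
Proof.
by move=> [z zI ->] yI; exists (z * y); [apply: augIpowM|rewrite scalerAl].
Qed.

Section Comm.
Hypothesis comm : forall x y : F, hdvd 1 (x * y - y * x).

Lemma commDr (x y z : F) : x * (y + z) - (y + z) * x = (x * y - y * x) + (x * z - z * x).
Proof. by rewrite mulrDr mulrDl opprD addrACA. Qed.

Lemma commMr (x a b : F) :
  x * (a * b) - a * b * x = (x * a - a * x) * b + a * (x * b - b * x).
Proof. by rewrite mulrBl mulrBr !mulrA addrA subrK. Qed.

Lemma commDl (x y z : F) : (x + y) * z - z * (x + y) = (x * z - z * x) + (y * z - z * y).
Proof. by rewrite mulrDr mulrDl opprD addrACA. Qed.

Lemma commMl (a b y : F) :
  a * b * y - y * (a * b) = a * (b * y - y * b) + (a * y - y * a) * b.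
Proof. by rewrite mulrBl mulrBr !mulrA addrA subrK. Qed.

(** By the Leibniz rule everything comes down to [x, a] = hbar z with a in I. The character eps has
    commutative values, so it kills the commutator, hence z, as k[[hbar]] has no torsion; thus z
    lies in I. *)
Lemma comm_augI n (x y : F) : augI B x -> I n y -> hI n (x * y - y * x).
Proof.
move=> xI; elim: n y => [|n IH] y; first by have [z ->] := comm x y; exists z.
elim/augIpow_elim => [|u v|a b aI bI].
- by rewrite mulr0 mul0r subrr; apply: hI0.
- by rewrite commDr; apply: hID.
rewrite commMr; apply: hID; last first.
  by rewrite -[n.+1]add1n; apply: hIMl; [apply: augIpow1|apply: IH].
rewrite -[n.+1]add1n; apply: hIMr => //; have [z zE] := comm x a.
exists z; last by rewrite zE expr1.
apply/augIpow1/augI_eps0; have := congr1 eps zE.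
rewrite (linfB leps) !epsM [X in _ - X]mulrC subrr expr1 (linfZ leps) => /esym.
exact: fps_htfree.
Qed.

(** An element of I^2 gains one degree more than an element of I. Applied to phi, this makes hbar^-1
    [phi, -] raise the filtration. *)
Lemma comm_augIpow2 n (x y : F) : I 2 x -> I n y -> hI n.+1 (x * y - y * x).
Proof.
move=> xI yI; elim/augIpow_elim: xI => [|u v|a b aI /augIpow1E bI].
- by rewrite mulr0 mul0r subrr; apply: hI0.
- by rewrite commDl; apply: hID.
rewrite commMl; apply: hID.
  by rewrite -add1n; apply: hIMl; [apply: augIpow1|apply: comm_augI].
by rewrite -addn1; apply: hIMr; [apply: comm_augI|apply: augIpow1].
Qed.

End Comm.
End Falg.

(** * Finite generation, separation and completeness of the I-adic filtration *)

Lemma sum_ord_unlift (V : nmodType) r (f : 'I_r -> V) (v : V) :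
  \sum_(i < r.+1) (if unlift ord0 i is Some j then f j else v) = v + \sum_i f i.
Proof.
by rewrite big_ord_recl unlift_none; congr (_ + _); apply: eq_bigr => i _; rewrite liftK.
Qed.

(** The consequences of the formal group limit that drive all convergence arguments, in a form that
    passes to the tensor square, see [sq_adic]. *)
Record is_adic (k : fieldType) (E : Type) (B : augAlg k E) (hB : is_augAlg B) : Prop := {
  adic_comm : forall x y : falg hB, hdvd 1 (x * y - y * x);
  adic_fg : exists r (X : 'I_r -> falg hB), (forall i, augI B (X i)) /\
    forall x : falg hB, augI B x -> exists (f : 'I_r -> falg hB) (w : falg hB),
      x = \sum_i X i * f i + hbar *: w;
  adic_sep : forall a, exists n, forall x : falg hB, augIpow B n x -> hdvd 1 (x a)
}.

Section FinGen.
Variables (k : fieldType) (E : Type) (B : augAlg k E) (hB : is_augAlg B).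
Local Notation K := (fps k).
Local Notation F := (falg hB).
Local Notation I n := (augIpow B n).

Hypothesis adic : is_adic hB.
Let comm := adic_comm adic.
Let fg := adic_fg adic.

(** As a right ideal I is generated by the X_i together with hbar 1; the index [ord0] carries
    hbar. *)
Let fgl1 : exists r (X : 'I_r -> F), (forall i, augI B (X i)) /\
  forall n (x : F), I n.+1 x -> exists f : 'I_r -> F, (forall i, I n (f i)) /\
    x = \sum_i X i * f i.
Proof.
have [r [X [XI H]]] := fg.
exists r.+1, (fun i => if unlift ord0 i is Some j then X j else hbar *: 1); split.
  by move=> i; case: unliftP => [j _|_] //; exact: augI_hbar.
move=> n x; elim/augIpow_elim => [|u v [f [fI ->]] [g [gI ->]]|a b /H[f [w ->]] bI].
- exists (fun=> 0); split=> [_|]; first exact: augIpow_zero.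
  by rewrite big1 // => i _; rewrite mulr0.
- exists (fun i => f i + g i); split=> [i|]; first exact: augIpowD.
  by rewrite -big_split; apply: eq_bigr => i _; rewrite mulrDr.
- exists (fun i => (if unlift ord0 i is Some j then f j else w) * b).
  split=> [i|]; first exact: augIpowMl.
  rewrite -(@eq_bigr _ _ _ _ _ _ (fun i => if unlift ord0 i is Some j then X j * f j * b
    else hbar *: w * b)); first by rewrite sum_ord_unlift mulrDl mulr_suml addrC.
  move=> i _; case: unliftP => [j _|_]; first by rewrite mulrA.
  by rewrite -!scalerAl mul1r.
Qed.

(** Commutativity modulo hbar moves the generators to the right; the error hbar g_i is absorbed by
    the additional generator hbar 1. *)
Let fgr1 : exists r (X : 'I_r -> F), (forall i, augI B (X i)) /\
  forall n (x : F), I n.+1 x -> exists f : 'I_r -> F, (forall i, I n (f i)) /\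
    x = \sum_i f i * X i.
Proof.
have [r [X [XI H]]] := fg.
exists r.+1, (fun i => if unlift ord0 i is Some j then X j else hbar *: 1); split.
  by move=> i; case: unliftP => [j _|_] //; exact: augI_hbar.
have H1 (x : F) : augI B x -> exists f (w : F), x = \sum_i f i * X i + hbar *: w.
  move=> /H[f [w ->]].
  have /choice[g gE] : forall i, exists g : F, X i * f i = f i * X i + hbar *: g.
    move=> i; have [g gE] := comm (X i) (f i); exists g.
    by rewrite -[hbar]expr1 -gE addrCA subrr addr0.
  exists f, (\sum_i g i + w); rewrite scalerDr addrA; congr (_ + _).
  by rewrite scaler_sumr -big_split; apply: eq_bigr => i _.
elim=> [|n IH] x.
  move=> /augIpow1E/H1[f [w ->]].
  exists (fun i => if unlift ord0 i is Some j then f j else w); split=> //.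
  rewrite -(@eq_bigr _ _ _ _ _ _ (fun i => if unlift ord0 i is Some j then f j * X j
    else hbar *: w)); first by rewrite sum_ord_unlift addrC.
  by move=> i _; case: unliftP => [j _|_] //; rewrite -scalerAr mulr1.
elim/augIpow_elim => [|u v [f [fI ->]] [g [gI ->]]|a b aI /IH[f [fI ->]]].
- exists (fun=> 0); split=> [_|]; first exact: augIpow_zero.
  by rewrite big1 // => i _; rewrite mul0r.
- exists (fun i => f i + g i); split=> [i|]; first exact: augIpowD.
  by rewrite -big_split; apply: eq_bigr => i _; rewrite mulrDl.
- exists (fun i => a * f i); split=> [i|]; first exact: augIpow_base.
  by rewrite mulr_sumr; apply: eq_bigr => i _; rewrite mulrA.
Qed.

(** The w_i are the products of n generators. That one finite family serves every x is what later
    controls infinite sums and infinite families of slices. *)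
Lemma augIpow_fgl n : exists (J : finType) (w : J -> F), (forall i, I n (w i)) /\
  forall m (x : F), I (n + m) x -> exists f : J -> F, (forall i, I m (f i)) /\
    x = \sum_i w i * f i.
Proof.
have [r [X [XI XP]]] := fgl1.
elim: n => [|n [L [w [wI wP]]]].
  exists unit, (fun=> 1); split=> // m x xI; exists (fun=> x); split=> //.
  by rewrite (bigD1 tt) //= mul1r big1 ?addr0 // => -[].
exists ('I_r * L)%type, (fun p => X p.1 * w p.2); split=> [p|m x].
  exact: augIpow_base.
move=> /XP[f [fI ->]].
have /choice[g gP] : forall i, exists g : L -> F,
    (forall l, I m (g l)) /\ f i = \sum_l w l * g l by move=> i; apply: wP.
exists (fun p => g p.1 p.2); split=> [p|]; first by have [] := gP p.1.
rewrite -(pair_bigA _ (fun i j => X i * w j * g i j)) /=; apply: eq_bigr => i _.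
by have [_ ->] := gP i; rewrite mulr_sumr; apply: eq_bigr => j _; rewrite mulrA.
Qed.

Lemma augIpow_fgr n : exists (J : finType) (w : J -> F), (forall i, I n (w i)) /\
  forall m (x : F), I (n + m) x -> exists f : J -> F, (forall i, I m (f i)) /\
    x = \sum_i f i * w i.
Proof.
have [r [X [XI XP]]] := fgr1.
elim: n => [|n [L [w [wI wP]]]].
  exists unit, (fun=> 1); split=> // m x xI; exists (fun=> x); split=> //.
  by rewrite (bigD1 tt) //= mulr1 big1 ?addr0 // => -[].
exists ('I_r * L)%type, (fun p => w p.2 * X p.1); split=> [p|m x].
  by rewrite -addn1; apply: augIpowM => //; apply: augIpow1.
move=> /XP[f [fI ->]].
have /choice[g gP] : forall i, exists g : L -> F,
    (forall l, I m (g l)) /\ f i = \sum_l g l * w l by move=> i; apply: wP.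
exists (fun p => g p.1 p.2); split=> [p|]; first by have [] := gP p.1.
rewrite -(pair_bigA _ (fun i j => g i j * (w j * X i))) /=; apply: eq_bigr => i _.
by have [_ ->] := gP i; rewrite mulr_suml; apply: eq_bigr => j _; rewrite mulrA.
Qed.

(** The I-adic topology refines the weak one. Modulo hbar^(m+2), coordinate a of a product w f is a
    finite bilinear expression in coordinates of w and f; if both factors lie deep enough in the
    filtration, each of these coordinates is divisible by hbar^(m+1), and 2(m+1) >= m+2. *)
Lemma augIpow_weak m a : exists n, forall x : F, I n x -> hdvd m (x a).
Proof.
case: m => [|m]; first by exists 0%N => x _; apply: hdvd00.
elim: m a => [|m IH] a; first exact: (adic_sep adic).
have [l lP] := wform_approx m.+2 (wform_coord a (amul_map hB)).
have /choice[N NP] := IH.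
(* A depth sufficient for the finitely many coordinates that occur, in both factors. *)
pose M := \max_(p <- l) maxn (N p.1) (N p.2).
have [J [w [wI wP]]] := augIpow_fgl M.
exists (M + M)%N => x /wP[f [fI ->]]; rewrite wmod_sum; apply: hdvd_sum => i _.
apply: hdvd_sub (lP (wtensor (w i) (f i))) _.
rewrite big_seq; apply: hdvd_sum => p pl; rewrite mulrC; apply: hdvdZ.
have pM : (maxn (N p.1) (N p.2) <= M)%N by rewrite /M (big_rem p) //= leq_maxl.
apply: (@hdvd_le _ _ _ (m.+1 + m.+1)); first by rewrite addSn ltnS addnS ltnS leq_addl.
rewrite geq_max in pM; case/andP: pM => p1 p2.
by apply: hdvdM; apply: NP; [apply: (augIpow_le (hB := hB) p1)|apply: (augIpow_le (hB := hB) p2)].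
Qed.

Lemma augIpow_sep (x y : F) : (forall n, I n (x - y)) -> x = y.
Proof.
move=> H; apply/eqP; rewrite -subr_eq0; apply/eqP/funext => a.
apply: (hsep0 (fps_hcomplete k)) => m; have [n] := augIpow_weak m a; exact.
Qed.

(** Convergence of a series in the weak topology, where completeness can be checked coordinate by
    coordinate; a scaffold for I-adic sums. *)
Definition wsum_to (d : nat -> F) (y : F) :=
  forall a n, exists N, forall M, (N <= M)%N -> hdvd n ((y - \sum_(i < M) d i) a).

Lemma wsum_to_unique d y z : wsum_to d y -> wsum_to d z -> y = z.
Proof.
move=> dy dz; apply/funext => a; apply: (hsep (fps_hcomplete k)) => n.
have [N NP] := dy a n; have [M MP] := dz a n.
apply: hdvd_trans (NP _ (leq_maxl N M)) _; apply: hdvd_subC.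
exact: MP (leq_maxr N M).
Qed.

Lemma wsum_toD d e y z : wsum_to d y -> wsum_to e z ->
  wsum_to (fun i => d i + e i) (y + z).
Proof.
move=> dy ez a n; have [N NP] := dy a n; have [M MP] := ez a n.
exists (maxn N M) => p; rewrite geq_max => /andP[Np Mp].
by rewrite big_split opprD addrACA; apply: hdvdD; [apply: NP|apply: MP].
Qed.

Lemma wsum_to_sum (J : finType) (d : J -> nat -> F) y :
  (forall j, wsum_to (d j) (y j)) -> wsum_to (fun i => \sum_j d j i) (\sum_j y j).
Proof.
move=> H; rewrite !unlock; elim: (index_enum J) => [|j r IH] /=.
  move=> a n; exists 0%N => M _; rewrite big1 ?subrr //; exact: hdvd0.
exact: wsum_toD.
Qed.

Lemma wsum_to_wmap d y (g : F -> F) :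
  wmap (g : wmod k E -> wmod k E) -> wsum_to d y -> wsum_to (g \o d) (g y).
Proof.
move=> wg dy a n; have [l lP] := wform_approx n (wform_coord a wg).
have /choice[N NP] := dy ^~ n; pose M := \max_(b <- l) N b.
exists M => p Mp; rewrite /= -(linf_sum wg.1) -(linfB wg.1).
apply: hdvd_sub (lP _) _; rewrite big_seq; apply: hdvd_sum => b bl.
rewrite mulrC; apply: hdvdZ; apply: NP; apply: leq_trans Mp.
by rewrite /M (big_rem b) //= leq_maxl.
Qed.

Lemma wsum_to_shift d y n : wsum_to d y ->
  wsum_to (fun i => d (n + i)%N) (y - \sum_(i < n) d i).
Proof.
move=> dy a m; have [N NP] := dy a m; exists N => M NM.
have -> : y - \sum_(i < n) d i - \sum_(i < M) d (n + i)%N = y - \sum_(i < n + M) d i.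
  by rewrite -addrA -opprD big_split_ord.
by apply: NP; rewrite (leq_trans NM) // leq_addl.
Qed.

Lemma wsum_exists d : (forall i, I i (d i)) -> exists y, wsum_to d y.
Proof.
move=> dI; have /choice[N NP] : forall p : E * nat, exists n, forall x : F,
  I n x -> hdvd p.2 (x p.1) by move=> p; apply: augIpow_weak.
pose s M : F := \sum_(i < M) d i.
have sE a n M M' : (N (a, n) <= M)%N -> (M <= M')%N -> hdvd n (s M' a - s M a).
  move=> NM /subnKC <-; rewrite /s big_split_ord /= wmodD addrAC subrr add0r.
  rewrite wmod_sum; apply: hdvd_sum => i _; apply: (NP (a, n)).
  by apply: (augIpow_le (hB := hB) _ (dI _)); rewrite (leq_trans NM) ?leq_addr.
(* From index [N (a, j.+1)] on, coordinate a of the partial sums is constant modulo hbar^(j+1), so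
   its coefficient j is final. *)
exists (fun a => Fps (fun j => fcoef (s (N (a, j.+1)) a : K) j)) => a n.
exists (\max_(j < n) N (a, j.+1)) => M /bigmax_leqP NM; apply/hdvd_fpsP => j jn.
rewrite wmodB fcoefB /=; apply/eqP; rewrite -fcoefB subr_eq0 eq_sym -subr_eq0 -fcoefB; apply/eqP.
have /hdvd_fpsP := sE a j.+1 _ M (leqnn _) (NM (Ordinal jn) isT).
exact.
Qed.

(** The weak sum is also the I-adic one: the tail from n on is a series of terms sum_j w_j f_ji with
    the finite family of [augIpow_fgl]. Its weak limit is sum_j w_j z_j, since left multiplication
    is continuous, and this lies in I^n. *)
Lemma augIpow_complete d : (forall i, I i (d i)) ->
  exists y : F, forall n, I n (y - \sum_(i < n) d i).
Proof.
move=> dI; have [y dy] := wsum_exists dI; exists y => n.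
have [J [w [wI wP]]] := augIpow_fgl n.
have /choice[f fP] : forall i, exists f : J -> F,
    (forall j, I i (f j)) /\ d (n + i)%N = \sum_j w j * f j by move=> i; apply: wP.
have /choice[z zP] : forall j, exists z : F, wsum_to (f ^~ j) z.
  by move=> j; apply: wsum_exists => i; have [] := fP i.
have -> : y - \sum_(i < n) d i = \sum_j w j * z j.
  apply: (wsum_to_unique (wsum_to_shift n dy)).
  have := wsum_to_sum (fun j => wsum_to_wmap (wmap_mull (w j)) (zP j)).
  by congr wsum_to; apply/funext => i /=; have [_ ->] := fP i.
by apply: augIpow_sum => j _; apply: augIpowMr.
Qed.

(** Stands for the completed tensor product of k[[hbar]]^A with I^m: smallness is imposed on the
    last factor only. *)
Definition slices_in (A : Type) m (t : wmod k (A * E)) := forall a, I m (fun e => t (a, e)).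

Lemma slices_in_fgl (A : Type) m : exists (J : finType) (w : J -> F), (forall i, I m (w i)) /\
  forall (t : wmod k (A * E)), slices_in m t -> exists f : J -> wmod k (A * E),
    t = \sum_i wtensr (fun y : wmod k E => w i * (y : F) : F) (f i).
Proof.
have [J [w [wI wP]]] := augIpow_fgl m; exists J, w; split=> // t tI.
have /choice[f fP] : forall a, exists f : J -> F, (fun e => t (a, e)) = \sum_i w i * f i.
  by move=> a; have [|f [_ ->]] := wP 0%N (fun e => t (a, e)); [rewrite addn0|exists f].
exists (fun i p => f p.1 i p.2); apply/funext => -[a e]; rewrite wmod_sum /wtensr /=.
have /(congr1 (fun z : wmod k E => z e)) /= -> := fP a.
by rewrite wmod_sum.
Qed.

Lemma slices_in_fgr (A : Type) m : exists (J : finType) (w : J -> F), (forall i, I m (w i)) /\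
  forall (t : wmod k (A * E)), slices_in m t -> exists f : J -> wmod k (A * E),
    t = \sum_i wtensr (fun y : wmod k E => (y : F) * w i : F) (f i).
Proof.
have [J [w [wI wP]]] := augIpow_fgr m; exists J, w; split=> // t tI.
have /choice[f fP] : forall a, exists f : J -> F, (fun e => t (a, e)) = \sum_i f i * w i.
  by move=> a; have [|f [_ ->]] := wP 0%N (fun e => t (a, e)); [rewrite addn0|exists f].
exists (fun i p => f p.1 i p.2); apply/funext => -[a e]; rewrite wmod_sum /wtensr /=.
have /(congr1 (fun z : wmod k E => z e)) /= -> := fP a.
by rewrite wmod_sum.
Qed.

(** A continuous form mixes infinitely many slices. Pulling the finite family w_i in front of it
    makes membership in I^m survive. *)
Lemma slices_in_slicel (A : Type) m (e : wmod k A -> K^o) t :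
  wform e -> slices_in m t -> I m (wslicel e t).
Proof.
move=> we tI; have [J [w [wI wP]]] := slices_in_fgl A m.
have [f ->] := wP t tI; rewrite (linf_sum (wmap_slicel _ we).1).
apply: (augIpow_sum (hB := hB)) => i _.
rewrite -(wmap_slicer_exchange _ we (wmap_mull (w i))).
exact: (augIpowMr (hB := hB)).
Qed.

Lemma slices_in_tensl (A C : Type) m (g : wmod k A -> wmod k C) (t : wmod k (A * E)) :
  wmap g -> slices_in m t -> slices_in m (wtensl g t).
Proof. by move=> wg tI c; apply: (slices_in_slicel (wform_coord c wg)). Qed.

(** The factors w_i are taken on the right, so that associativity carries them through the
    product. *)
Lemma slices_in_mul m t : slices_in m t -> I m (amul B t).
Proof.
move=> tI; have [J [w [wI wP]]] := slices_in_fgr E m.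
have [f ->] := wP t tI; rewrite (linf_sum (amul_map hB).1).
apply: (augIpow_sum (hB := hB)) => i _.
have -> : amul B (wtensr (fun y : wmod k E => (y : F) * w i : F) (f i)) =
    (amul B (f i) : F) * w i.
  apply: (@wmap_tensor_ext _ _ _ _ (amul B \o wtensr _) ((fun y : F => y * w i) \o amul B)).
  - exact/wmap_comp/wmap_tensr/wmap_mulr/(amul_map hB).
  - exact/wmap_comp/(amul_map hB)/wmap_mulr.
  - move=> x y /=; rewrite (wtensr_tensor _ _ (wmap_mulr (w i)).1).
    exact: (@mulrA F).
exact: (augIpowMl (hB := hB)).
Qed.

End FinGen.

(** * The tensor square *)

Section Square.
Variables (k : fieldType) (E : Type) (A : augAlg k E) (hA : is_augAlg A).
Local Notation F := (falg hA).
Local Notation A2 := (augAlg_sq A).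

Let m_map := amul_map hA.
Let e_form := aeps_form hA.

Lemma wmap_swap23 (X Y Z W : Type) : wmap (@wswap23 k X Y Z W).
Proof. exact: (@wmap_reindex k _ _ (fun p : (X * Z) * (Y * W) => ((p.1.1, p.2.1), (p.1.2, p.2.2)))). Qed.

Lemma sq_mul_map : wmap (amul A2).
Proof.
exact: (wmap_comp (wmap_tensl _ m_map) (wmap_comp (wmap_tensr _ m_map) (@wmap_swap23 E E E E))).
Qed.

Lemma sq_mul_tensor (x y z w : F) :
  aprod A2 (wtensor x y) (wtensor z w) = wtensor (x * z) (y * w).
Proof.
rewrite /aprod /=; have -> : wswap23 (wtensor (wtensor x y) (wtensor z w)) =
    wtensor (wtensor x z) (wtensor y w).
  by apply/funext => -[[a b] [c d]]; rewrite /wswap23 /wtensor /= mulrACA.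
by rewrite (wtensr_tensor _ _ m_map.1) (wtensl_tensor _ _ m_map.1).
Qed.

Lemma sq_mull_map s : wmap (aprod A2 s).
Proof. exact: (wmap_comp sq_mul_map (wmap_tensor_r _ s)). Qed.
Lemma sq_mulr_map t : wmap (aprod A2 ^~ t).
Proof. exact: (wmap_comp sq_mul_map (wmap_tensor_l _ t)). Qed.

Lemma sq_eps_form : wform (aeps A2).
Proof. exact: (wform_comp e_form (wmap_slicer _ e_form)). Qed.

Lemma sq_eps_tensor x y : aeps A2 (wtensor x y) = aeps A x * aeps A y.
Proof.
by rewrite /= (wslicer_tensor _ _ e_form.1) (linfZ e_form.1) fps_scaleE mulrC.
Qed.

Lemma sq_is_augAlg : is_augAlg A2.
Proof.
split.
- exact: sq_mul_map.
- move=> s t u; move: s; apply: wmap_tensor_ext => [||x y].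
  + exact: sq_mulr_map.
  + exact: (wmap_comp (sq_mulr_map u) (sq_mulr_map t)).
  move: t; apply: wmap_tensor_ext => [||z w].
  + exact: (wmap_comp (sq_mull_map _) (sq_mulr_map u)).
  + exact: (wmap_comp (sq_mulr_map u) (sq_mull_map _)).
  move: u; apply: wmap_tensor_ext => [||z' w'].
  + exact: (wmap_comp (sq_mull_map _) (sq_mull_map _)).
  + exact: (sq_mull_map _).
  by rewrite !sq_mul_tensor !mulrA.
- apply: wmap_tensor_ext => [||x y]; [exact: sq_mull_map|exact: wmap_id|].
  by rewrite (sq_mul_tensor 1 1) !mul1r.
- apply: wmap_tensor_ext => [||x y]; [exact: sq_mulr_map|exact: wmap_id|].
  by rewrite (sq_mul_tensor _ _ 1 1) !mulr1.
- exact: sq_eps_form.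
- move=> s t; move: s; apply: wform_tensor_ext => [||x y].
  + exact: (wform_comp sq_eps_form (sq_mulr_map _)).
  + split=> [c s s'|]; first by rewrite sq_eps_form.1 mulrDl scalerAl.
    have := wcontZ (aeps A2 t) sq_eps_form.2.
    by congr wcontinuous_form; apply/funext => s; rewrite mulrC.
  move: t; apply: wform_tensor_ext => [||z w].
  + exact: (wform_comp sq_eps_form (sq_mull_map _)).
  + split=> [c s s'|]; first by rewrite sq_eps_form.1 mulrDr scalerAr.
    exact: (wcontZ _ sq_eps_form.2).
  by rewrite sq_mul_tensor !sq_eps_tensor !epsM mulrACA.
- by rewrite sq_eps_tensor (aeps_one hA) mulr1.
Qed.

Local Notation F2 := (falg sq_is_augAlg).
Local Notation I n := (augIpow A n).
Local Notation I2 n := (augIpow A2 n).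

Definition tens (x y : F) : F2 := wtensor x y.

Lemma tensM x y z w : tens x y * tens z w = tens (x * z) (y * w).
Proof. exact: sq_mul_tensor. Qed.
Lemma tensDl x x' y : tens (x + x') y = tens x y + tens x' y.
Proof. exact: (linfD (wmap_tensor_l _ y).1). Qed.
Lemma tensDr x y y' : tens x (y + y') = tens x y + tens x y'.
Proof. exact: (linfD (wmap_tensor_r _ x).1). Qed.
Lemma tensZl c x y : tens (c *: x) y = c *: tens x y.
Proof. exact: (linfZ (wmap_tensor_l _ y).1). Qed.
Lemma tensZr c x y : tens x (c *: y) = c *: tens x y.
Proof. exact: (linfZ (wmap_tensor_r _ x).1). Qed.

Lemma tensBl x x' y : tens (x - x') y = tens x y - tens x' y.
Proof. exact: (linfB (wmap_tensor_l _ y).1). Qed.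
Lemma tensBr x y y' : tens x (y - y') = tens x y - tens x y'.
Proof. exact: (linfB (wmap_tensor_r _ x).1). Qed.

Lemma tens1M (x : F) (t : F2) :
  tens 1 x * t = wtensr (fun y : wmod k E => x * (y : F) : F) t.
Proof.
move: t; apply: wmap_tensor_ext => [||y z].
- exact: sq_mull_map.
- exact/wmap_tensr/wmap_mull.
- by rewrite (wtensr_tensor _ _ (wmap_mull x).1) [LHS]tensM mul1r.
Qed.

Lemma tensM1 (x : F) (t : F2) :
  tens x 1 * t = wtensl (fun y : wmod k E => x * (y : F) : F) t.
Proof.
move: t; apply: wmap_tensor_ext => [||y z].
- exact: sq_mull_map.
- exact/wmap_tensl/wmap_mull.
- by rewrite (wtensl_tensor _ _ (wmap_mull x).1) [LHS]tensM mul1r.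
Qed.

Lemma sq_augI_tens1 (x : F) : augI A x -> augI A2 (tens 1 x).
Proof.
move=> /augIP xI; apply/(augIP (hB := sq_is_augAlg) _).
by rewrite [aeps _ _]sq_eps_tensor (eps1 hA) mul1r.
Qed.

Lemma sq_augI_tensl (x : F) : augI A x -> augI A2 (tens x 1).
Proof.
move=> /augIP xI; apply/(augIP (hB := sq_is_augAlg) _).
by rewrite [aeps _ _]sq_eps_tensor (eps1 hA) mulr1.
Qed.

Lemma sq_augIpow_tensr n (x : F) : I n x -> I2 n (tens 1 x).
Proof.
elim: n x => // n IH x; elim/augIpow_elim => [|u v|a b aI bI].
- by rewrite -[0](scale0r (0 : F)) tensZr scale0r; apply: (augIpow_zero sq_is_augAlg).
- by rewrite tensDr; apply: (augIpowD (hB := sq_is_augAlg)).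
- rewrite -[1](mulr1 1) -tensM; apply: (augIpow_base (hB := sq_is_augAlg)).
    exact: sq_augI_tens1.
  exact: IH.
Qed.

Hypothesis adic : is_adic hA.

(** Divisibility by hbar of a continuous form is tested on base vectors, once for s and once for t.
    These are pure tensors, where the commutator is computed leg by leg. *)
Lemma sq_comm (s t : F2) : hdvd 1 (s * t - t * s).
Proof.
apply/hdvd_wmodP => p.
apply: (@wform_dvd _ _ (fun s : wmod k (E * E) => ((s : F2) * t - t * (s : F2)) p)).
  apply: (wform_coord p (f := fun s : wmod k (E * E) => (s : F2) * t - t * (s : F2))).
  exact: (wmapB (sq_mulr_map t) (sq_mull_map t)).
move=> {s} q; rewrite wbase_tensor.
apply: (@wform_dvd _ _ (fun t : wmod k (E * E) => (tens (wbase k q.1) (wbase k q.2) * (t : F2)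
   - (t : F2) * tens (wbase k q.1) (wbase k q.2)) p)).
  apply: (wform_coord p (f := fun t : wmod k (E * E) => 
    tens (wbase k q.1) (wbase k q.2) * (t : F2) - (t : F2) * tens (wbase k q.1) (wbase k q.2))).
  exact: (wmapB (sq_mull_map _) (sq_mulr_map _)).
move=> {t} q'; rewrite wbase_tensor.
set a : F := wbase k q.1; set b : F := wbase k q.2.
set c : F := wbase k q'.1; set d : F := wbase k q'.2.
suff /hdvd_wmodP/(_ p) : hdvd 1 (tens a b * tens c d - tens c d * tens a b) by [].
rewrite !tensM; have [u uE] := adic_comm adic a c; have [v vE] := adic_comm adic b d.
exists (tens u (b * d) + tens (c * a) v).
by rewrite scalerDr -tensZl -tensZr -uE -vE tensBl tensBr addrA subrK.
Qed.

(** Write t = u (x) 1 + (t - u (x) 1) with u = (id (x) eps)(t). Then u lies in I, and every slice of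
    the remainder lies in Ker eps, so both expand in the X_i modulo hbar, each in its own leg. *)
Lemma sq_fg_explicit : exists r (X : 'I_r -> F), (forall i, augI A (X i)) /\
  forall t : F2, augI A2 t -> exists (f g : 'I_r -> F2) (w : F2),
    t = \sum_i tens 1 (X i) * f i + \sum_i tens (X i) 1 * g i + hbar *: w.
Proof.
have [r [X [XI XP]]] := adic_fg adic.
exists r, X; split=> // t /(augIP (hB := sq_is_augAlg) _) tI.
pose u : F := wslicer (aeps A) t.
have /(augIP (hB := hA) _)/XP[g [z uE]] : hdvd 1 (aeps A u) by exact: tI.
have /choice[f /choice[w fP]] : forall a, exists (f : 'I_r -> F) (w : F),
    (fun e => t (a, e)) = u a *: (1 : F) + (\sum_i X i * f i + hbar *: w).
  move=> a; have /XP[f [w fw]] : augI A ((fun e => t (a, e)) - u a *: (1 : F) : F).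
    apply: (augI_eps0 (hB := hA)); rewrite (linfB e_form.1) (linfZ e_form.1) (eps1 hA).
    by rewrite fps_scaleE mulr1 subrr.
  by exists f, w; rewrite -fw addrC subrK.
exists (fun i p => f p.1 i p.2), (fun i => tens (g i) 1), ((fun p => w p.1 p.2) + tens z 1 : F2).
under eq_bigr => i _ do rewrite tens1M.
under [X in _ = _ + X + _]eq_bigr => i _ do rewrite tensM mulr1.
have -> : \sum_(i < r) tens (X i * g i) 1 = tens (\sum_(i < r) X i * g i) 1.
  exact: (esym (linf_sum (wmap_tensor_l _ (1 : F)).1 _ _ _)).
rewrite scalerDr addrACA -tensZl -tensDl -uE addrC; apply/funext => -[a e].
have /(congr1 (fun x : wmod k E => x e)) /= := fP a; rewrite !wmodD wmodZ => ->.
by rewrite !wmod_sum wmodZ.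
Qed.

Lemma sq_fg : exists r (X : 'I_r -> F2), (forall i, augI A2 (X i)) /\
  forall t : F2, augI A2 t -> exists f (w : F2), t = \sum_i X i * f i + hbar *: w.
Proof.
have [r [X [XI XP]]] := sq_fg_explicit.
exists (r + r)%N, (fun i => match fintype.split i with inl j => tens 1 (X j) | inr j => tens (X j) 1 end).
split=> [i|t /XP[f [g [w ->]]]].
  by case: fintype.split => j; [apply: sq_augI_tens1|apply: sq_augI_tensl].
exists (fun i => match fintype.split i with inl j => f j | inr j => g j end), w.
rewrite big_split_ord /=; congr (_ + _ + _); apply: eq_bigr => i _.
  by rewrite (unsplitK (inl i)).
by rewrite (unsplitK (inr i)).
Qed.

(** The finite family of [slices_in_fgl] enters through factors 1 (x) w_i, which lie in I2^m. *)
Lemma slices_in_augIpow m t : slices_in A m t -> I2 m t.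
Proof.
move=> tI; have [J [w [wI wP]]] := slices_in_fgl adic E m.
have [f ->] := wP t tI; apply: (augIpow_sum (hB := sq_is_augAlg)) => i _.
by rewrite -tens1M; apply: (augIpowMr (hB := sq_is_augAlg)); apply: sq_augIpow_tensr.
Qed.

Definition wflip (X Y : Type) (t : wmod k (X * Y)) : wmod k (Y * X) :=
  fun p => t (p.2, p.1).

Lemma slices_in_tensr_flip (X Y : Type) m (g : wmod k X -> wmod k Y) (t : wmod k (E * X)) :
  wmap g -> slices_in A m (wflip t) -> slices_in A m (wflip (wtensr g t)).
Proof.
by move=> wg tI; have := slices_in_tensl adic wg tI.
Qed.

(* Quantitative form of I2 = I (x) F + F (x) I. *)
Lemma sq_augIpow_split n p q (t : F2) : (p + q = n.+1)%N -> I2 n t ->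
  exists u v : F2, [/\ t = u + v, slices_in A p u & slices_in A q (wflip v)].
Proof.
elim: n p q t => [|n IH] [|p] q t pq tI.
- by exists t, 0; split=> //; [rewrite addr0|move=> a; apply: (augIpow_zero hA)].
- have -> : q = 0%N by case: p q pq => [|p] [].
  by exists 0, t; split=> //; [rewrite add0r|move=> a; apply: (augIpow_zero hA)].
- by exists t, 0; split=> //; [rewrite addr0|move=> a; apply: (augIpow_zero hA)].
case: q pq => [|q] pq.
  by exists 0, t; split=> //; [rewrite add0r|move=> a; apply: (augIpow_zero hA)].
(* A factor hbar or 1 (x) x raises the exponent of u, a factor x (x) 1 that of v. Each case starts
   from the instance in which the other exponent has already reached its target. *)
have IHp t' := IH p q.+1 t'; have {IH}IHq t' := IH p.+1 q t'.
have {}IHp t' := IHp t' (succn_inj pq).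
have {}IHq t' : I2 n t' -> _ := IHq t' (etrans (esym (addnS _ _)) (succn_inj pq)).
pose P (t : F2) := exists u v : F2,
  [/\ t = u + v, slices_in A p.+1 u & slices_in A q.+1 (wflip v)].
have P0 : P 0.
  by exists 0, 0; split; [rewrite addr0|move=> a; apply: (augIpow_zero hA)..].
have PD x y : P x -> P y -> P (x + y).
  move=> [u [v [-> ui vi]]] [u' [v' [-> ui' vi']]].
  exists (u + u'), (v + v'); split=> [|c|c]; first by rewrite addrACA.
    exact: (augIpowD (hB := hA) (ui c) (ui' c)).
  exact: (augIpowD (hB := hA) (vi c) (vi' c)).
have Ph y : I2 n y -> P (hbar *: y).
  move=> /IHp[u [v [-> ui vi]]]; exists (hbar *: u), (hbar *: v); split=> [|c|c].
  - by rewrite scalerDr.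
  - exact: (augIpow_hbar (hB := hA) (ui c)).
  - exact: (augIpowZ (hB := hA) _ (vi c)).
have P1 x y : augI A x -> I2 n y -> P (tens 1 x * y).
  move=> xI /IHp[u [v [-> ui vi]]]; exists (tens 1 x * u), (tens 1 x * v); split=> [|c|].
  - by rewrite mulrDr.
  - by rewrite tens1M; apply: (augIpow_base (hB := hA) xI (ui c)).
  - by rewrite tens1M; apply: slices_in_tensr_flip vi; apply: wmap_mull.
have P2 x y : augI A x -> I2 n y -> P (tens x 1 * y).
  move=> xI /IHq[u [v [-> ui vi]]]; exists (tens x 1 * u), (tens x 1 * v); split=> [||c].
  - by rewrite mulrDr.
  - by rewrite tensM1; apply: (slices_in_tensl adic _ ui); apply: wmap_mull.
  - by rewrite tensM1; apply: (augIpow_base (hB := hA) xI (vi c)).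
have [r [X [XI XP]]] := sq_fg_explicit.
move: tI; elim/augIpow_elim => // a b /XP[f [g [w ->]]] bI.
rewrite !mulrDl !mulr_suml; apply: (PD); last first.
  by rewrite -scalerAl; apply: Ph; apply: (augIpowMl (hB := sq_is_augAlg)).
apply: (PD); elim/big_rec: _ => // i x _ xP; apply: (PD) => //; rewrite -mulrA.
  by apply: P1 => //; apply: (augIpowMl (hB := sq_is_augAlg)).
by apply: P2 => //; apply: (augIpowMl (hB := sq_is_augAlg)).
Qed.

Lemma sq_sep1 p : exists n, forall t : F2, I2 n t -> hdvd 1 (t p).
Proof.
case: p => a b; have [n nP] := adic_sep adic b; have [m mP] := adic_sep adic a.
exists (n + m)%N => t tI.
have [u [v [-> ui vi]]] := sq_augIpow_split (addSn n m) tI.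
apply: hdvdD; last by have := mP _ (vi b).
by have := nP _ (augIpowS (hB := hA) (ui a)).
Qed.

Lemma sq_adic : is_adic sq_is_augAlg.
Proof. by split; [apply: sq_comm|apply: sq_fg|apply: sq_sep1]. Qed.

End Square.

(** * A topological basis of ordered monomials *)

(** In [fps (mfps R m)] the series named [hbar] is the outermost variable, not the deformation
    parameter. Indices out of range give 0. *)
Fixpoint mvar (R : comNzRingType) (n : nat) (i : nat) : mfps R n :=
  match n return mfps R n with
  | 0 => 0
  | m.+1 => if i == m then (hbar : fps (mfps R m)) else fps_const (mvar R m i)
  end.

Section MultiFps.
Variable R : comNzRingType.

(* f = sum of x^al f_al lies in the m-th step when G (m - |al|) holds of every f_al. *)
Fixpoint mfil (G : nat -> R -> Prop) (n m : nat) : mfps R n -> Prop :=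
  match n return mfps R n -> Prop with
  | 0 => G m
  | n'.+1 => fun f : fps (mfps R n') => forall i, mfil G (m - i) (fcoef f i)
  end.

(** Two instances occur. For R = k with G m = 0 when m > 0, [mfil] is the filtration of k[[x]] by
    order in x. For R = k[[hbar]] with G m = hbar^m R, hbar and the variables all have degree one,
    which is the pattern of I^m in F. *)
Record is_mulfil (G : nat -> R -> Prop) : Prop := {
  mulfil_all : forall x, G 0%N x;
  mulfil0 : forall m, G m 0;
  mulfilD : forall m x y, G m x -> G m y -> G m (x + y);
  mulfilM : forall m p x y, G m x -> G p y -> G (m + p)%N (x * y);
  mulfil_le : forall m p x, (m <= p)%N -> G p x -> G m x
}.

Section Fil.
Variable G : nat -> R -> Prop.
Hypothesis hG : is_mulfil G.
Local Notation W n m := (@mfil G n m).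

Lemma mfil_all n (f : mfps R n) : W n 0%N f.
Proof. by elim: n f => [|n IH] f /=; [exact: mulfil_all|move=> i; rewrite sub0n]. Qed.

Lemma mfil0 n m : W n m 0.
Proof. by elim: n m => [|n IH] m /=; [exact: mulfil0|move=> i]. Qed.

Lemma mfilD n m f g : W n m f -> W n m g -> W n m (f + g).
Proof.
elim: n m f g => [|n IH] m f g /=; first exact: mulfilD.
by move=> Wf Wg i; apply: IH.
Qed.

Lemma mfil_le n m p f : (m <= p)%N -> W n p f -> W n m f.
Proof.
elim: n m p f => [|n IH] m p f mp /=; first exact: mulfil_le.
by move=> Wf i; apply: IH (Wf i); rewrite leq_sub2r.
Qed.

Lemma mfil_sum n m (J : Type) (r : seq J) (P : pred J) (f : J -> mfps R n) :
  (forall i, P i -> W n m (f i)) -> W n m (\sum_(i <- r | P i) f i).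
Proof. by move=> H; elim/big_rec: _ => [|i x Pi]; [apply: mfil0|apply/mfilD/H]. Qed.

Lemma mfilM n m p f g : W n m f -> W n p g -> W n (m + p)%N (f * g).
Proof.
elim: n m p f g => [|n IH] m p f g /=; first exact: mulfilM.
move=> Wf Wg i; apply: mfil_sum => j _.
apply: (@mfil_le _ _ ((m - j) + (p - (i - j)))); last exact: IH.
have := ltn_ord j; rewrite ltnS => ji; rewrite leq_subLR -{1}(subnKC ji).
by rewrite addnACA leq_add // -leq_subLR.
Qed.

Lemma mfilMl n m (f g : mfps R n) : W n m g -> W n m (f * g).
Proof. by move=> Wg; rewrite -[m]add0n; apply: mfilM => //; apply: mfil_all. Qed.

Lemma mfilMr n m (f g : mfps R n) : W n m f -> W n m (f * g).
Proof. by move=> Wg; rewrite mulrC; apply: mfilMl. Qed.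

Lemma mfil_const n m c : G m c -> W n m (mfps_const n c).
Proof.
elim: n m => //= n IH m Gc [|i] /=; first by rewrite subn0; apply: IH.
exact: mfil0.
Qed.

Lemma mfil_var n i : (i < n)%N -> W n 1%N (mvar R n i).
Proof.
elim: n => // n IH; rewrite ltnS leq_eqVlt /=; case: eqP => [_ _|_ /= iN] [|j] /=.
- exact: mfil0.
- exact: mfil_all.
- by rewrite subn0; apply: IH.
- exact: mfil_all.
Qed.

Lemma mfilX n f i : W n 1%N f -> W n i (f ^+ i).
Proof.
by move=> Wf; elim: i => [|i IH]; [apply: mfil_all|rewrite exprS -add1n; apply: mfilM].
Qed.

Hypothesis sepG : forall x, (forall m, G m x) -> x = 0.

Lemma mfil_sep n (f : mfps R n) : (forall m, W n m f) -> f = 0.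
Proof.
elim: n f => [|n IH] f //=; first exact: sepG.
move=> Wf; apply: fpsP => i; apply: IH => m.
by have := Wf (m + i)%N i; rewrite addnK.
Qed.

End Fil.

Fact mfps_const_is_zmod n : zmod_morphism (@mfps_const R n).
Proof. by elim: n => //= n IH c d; rewrite IH rmorphB. Qed.
Fact mfps_const_is_monoid n : monoid_morphism (@mfps_const R n).
Proof.
elim: n => //= n [IH1 IHM]; split; first by rewrite IH1 rmorph1.
by move=> c d; rewrite IHM rmorphM.
Qed.
HB.instance Definition _ n :=
  GRing.isZmodMorphism.Build R (mfps R n) (@mfps_const R n) (@mfps_const_is_zmod n).
HB.instance Definition _ n :=
  GRing.isMonoidMorphism.Build R (mfps R n) (@mfps_const R n) (@mfps_const_is_monoid n).

Lemma fps_split m (f : fps R) : f = \sum_(i < m) hbar ^+ i * fps_const (fcoef f i) +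
  hbar ^+ m * Fps (fun j => fcoef f (m + j)%N).
Proof.
apply: fpsP => j; rewrite fcoefD fcoef_sum fcoef_hbarXM [fcoef (Fps _) _]/(fcoef f _).
case: ltnP => [jm|mj]; last first.
  rewrite subnKC // big1 ?add0r // => i _; rewrite fcoef_hbarXM.
  have im : (i < j)%N by apply: leq_trans mj.
  by rewrite ltnNge (ltnW im) /= subn_eq0 leqNgt im.
rewrite addr0 (bigD1 (Ordinal jm)) // big1 => [|i ij].
  by rewrite fcoef_hbarXM ltnn subnn /= addr0.
rewrite fcoef_hbarXM; case: ltnP => // ji; rewrite /= subn_eq0.
case: ltngtP ji => // ji _; case/eqP: ij; exact/val_inj.
Qed.

Lemma fps_geom (a : R) :
  (1 - fps_const a * hbar) * Fps (fun j => a ^+ j) = 1.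
Proof.
apply: fpsP => j; rewrite mulrBl mul1r fcoefB -mulrA fcoef_constM fcoef_hbarM.
by case: j => [|j] /=; rewrite ?mulr0 ?subr0 // -exprS subrr.
Qed.

End MultiFps.

Section MultiFpsField.
Variable k : fieldType.

(** The constant term -c is invertible, and 1/(x - c) = -c^-1 / (1 - c^-1 x) is a geometric series.
    This is what forces lifts of the coordinates into I. *)
Lemma mvar_unit n i (c : k) : (i < n)%N -> c != 0 ->
  exists u : mfps k n, u * (mvar k n i - mfps_const n c) = 1.
Proof.
elim: n => // n IH; rewrite ltnS leq_eqVlt /=; case: eqP => [_ _ c0|_ /= iN c0].
  exists (- fps_const (mfps_const n c^-1) * Fps (fun j => mfps_const n c^-1 ^+ j)).
  rewrite mulrC mulrA -(fps_geom (mfps_const n c^-1)); congr (_ * _).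
  rewrite mulrN -mulNr opprB mulrBl -rmorphM -rmorphM divff //.
  by rewrite !rmorph1 mulrC.
have [u uP] := IH iN c0; exists (fps_const u).
by rewrite -rmorphB -rmorphM uP rmorph1.
Qed.

Lemma mvar_decomp n (f : mfps k n) : exists (c : k) (g : 'I_n -> mfps k n),
  f = mfps_const n c + \sum_(i < n) mvar k n i * g i.
Proof.
elim: n f => [|n IH] f /=; first by exists f, (fun=> 0); rewrite big_ord0 addr0.
have [c [g gE]] := IH (fcoef f 0).
pose r : fps (mfps k n) := Fps (fun j => fcoef f (1 + j)%N).
exists c, (fun i => if unlift ord_max i is Some j then fps_const (g j) else r).
rewrite big_ord_recr /= unlift_none eqxx [LHS](fps_split 1) big_ord1 expr0 mul1r expr1.
rewrite gE rmorphD rmorph_sum addrA; congr (_ + _ + _); apply: eq_bigr => i _ /=.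
rewrite (_ : widen_ord _ i = lift ord_max i); last first.
  by apply: val_inj; rewrite /= /bump leqNgt ltn_ord.
by rewrite liftK ltn_eqF // rmorphM.
Qed.

Lemma mulfil_field : is_mulfil (fun m (c : k) => (0 < m)%N -> c = 0).
Proof.
split=> // [m x y xm ym m0|[|m] [|p] x y //= xm ym _|[|m] [|p] x //= _ xm _].
- by rewrite xm // ym // addr0.
- by rewrite ym // mulr0.
- by rewrite xm // mul0r.
- by rewrite xm // mul0r.
Qed.

Lemma mulfil_hdvd : is_mulfil (fun m (c : fps k) => hdvd m (c : (fps k)^o)).
Proof.
split=> [x|m|m x y|m p x y|m p x].
- exact: hdvd00.
- exact: hdvd0.
- exact: hdvdD.
- exact: hdvdM.
- exact: hdvd_le.
Qed.

End MultiFpsField.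

(* b spans F topologically, and c gives coordinates: the augmentation filtration
   is the one by the weights of the coordinates, b_al having weight m for al in H m. *)
Record adapted_basis (k : fieldType) (E : Type) (A : augAlg k E) (hA : is_augAlg A)
    (T : eqType) (H : nat -> seq T) (b : T -> falg hA) (c : T -> wmod k E -> (fps k)^o) :
    Prop := {
  ab_linear : forall al, linear (c al);
  ab_in : forall m al, al \in H m -> augIpow A m (b al);
  ab_coord : forall m p al x, al \in H m -> augIpow A p x ->
    hdvd p (hbar ^+ m *: c al x);
  ab_expand : forall m x,
    augIpow A m ((x : falg hA) - \sum_(i < m) \sum_(al <- H i) c al x *: b al)
}.

(** * Ordered monomials and the augmentation filtration *)

Section Pbw.
Variables (k : fieldType) (E : Type) (A : augAlg k E) (hA : is_augAlg A).
Local Notation K := (fps k).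
Local Notation F := (falg hA).
Local Notation I n := (augIpow A n).
Hypothesis adic : is_adic hA.
Implicit Types (d e : nat -> F) (x y z : F).

(** The sum of an I-adically convergent series, with default 0. The limit is unique because the
    intersection of the I^n is zero. *)
Definition isum (d : nat -> F) : F :=
  xget 0 [set y : F | forall n, I n (y - \sum_(i < n) d i)]%classic.

Lemma isumP d : (forall i, I i (d i)) -> forall n, I n (isum d - \sum_(i < n) d i).
Proof.
move=> dI; apply: (@xgetPex _ (0 : F)
  [set y : F | forall n, I n (y - \sum_(i < n) d i)]%classic).
exact: augIpow_complete.
Qed.

Lemma augIpow_tail_unique (d : nat -> F) (y z : F) :
  (forall n, I n (y - \sum_(i < n) d i)) ->
  (forall n, I n (z - \sum_(i < n) d i)) -> y = z.
Proof.
move=> dy dz; apply: (augIpow_sep adic) => n.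
have -> : y - z = (y - \sum_(i < n) d i) - (z - \sum_(i < n) d i).
  by rewrite opprB addrA subrK.
by apply: augIpowB; [apply: dy|apply: dz].
Qed.

Lemma isum_eq d y : (forall i, I i (d i)) ->
  (forall n, I n (y - \sum_(i < n) d i)) -> isum d = y.
Proof. by move=> dI; apply: augIpow_tail_unique; apply: isumP. Qed.

Lemma isum_in d m : (forall i, I (maxn i m) (d i)) -> I m (isum d).
Proof.
move=> dI; rewrite -(subrK (\sum_(i < m) d i) (isum d)); apply: augIpowD.
  by apply: isumP => i; apply: augIpow_le (dI i); apply: leq_maxl.
by apply: augIpow_sum => i _; apply: augIpow_le (dI i); apply: leq_maxr.
Qed.

Lemma isumD d e : (forall i, I i (d i)) -> (forall i, I i (e i)) ->
  isum (fun i => d i + e i) = isum d + isum e.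
Proof.
move=> dI eI; apply: isum_eq => [i|n]; first exact: augIpowD.
by rewrite big_split opprD addrACA; apply: augIpowD; apply: isumP.
Qed.

Lemma isumZ c d : (forall i, I i (d i)) -> isum (fun i => c *: d i) = c *: isum d.
Proof.
move=> dI; apply: isum_eq => [i|n]; first exact: augIpowZ.
by rewrite -scaler_sumr -scalerBr; apply/augIpowZ/isumP.
Qed.

Lemma isumMl x d : (forall i, I i (d i)) -> isum (fun i => x * d i) = x * isum d.
Proof.
move=> dI; apply: isum_eq => [i|n]; first exact: augIpowMl.
by rewrite -mulr_sumr -mulrBr; apply/augIpowMl/isumP.
Qed.

Lemma isum_recl d : (forall i, I i (d i)) -> d 0%N = 0 ->
  isum d = isum (fun i => d i.+1).
Proof.
move=> dI d0; apply/esym/isum_eq => [i|n]; first exact: augIpowS.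
have := isumP dI n.+1; rewrite big_ord_recl d0 add0r; exact: augIpowS.
Qed.

Lemma isum_hI d m : (forall i, @hI _ _ _ hA (maxn i m) (d i)) -> @hI _ _ _ hA m (isum d).
Proof.
move=> dI; have /choice[e eP] : forall i, exists z : F, I (maxn i m) z /\ d i = hbar *: z.
  by move=> i; have [z] := dI i; exists z.
exists (isum e); first by apply: isum_in => i; have [] := eP i.
rewrite -isumZ; last by move=> i; have [eI _] := eP i; apply: augIpow_le eI; rewrite leq_maxl.
by congr isum; apply/funext => i; have [] := eP i.
Qed.

Variables (n : nat) (X : nat -> F).
Hypothesis XI : forall i, (i < n)%N -> augI A (X i).
Hypothesis Xgen : forall x : F, augI A x ->
  exists (f : nat -> F) (w : F), x = \sum_(i < n) X i * f i + hbar *: w.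

Local Notation W l m := (@mfil (fps k) (fun p (c : fps k) => hdvd p (c : K^o)) l m).
Let hW := mulfil_hdvd k.

(** Ordered substitution x_i -> X_i with scalars in k[[hbar]], the outermost variable being written
    leftmost. The sum converges I-adically because X_l lies in I. *)
Fixpoint pbw (l : nat) : mfps K l -> F :=
  match l return mfps K l -> F with
  | 0 => fun c => c *: 1
  | l'.+1 => fun f : fps (mfps K l') => isum (fun i => X l' ^+ i * pbw (fcoef f i))
  end.

Let termI l i (y : F) : (l < n)%N -> I i (X l ^+ i * y).
Proof. by move=> ln; apply: augIpowMr; apply: augIpowX; apply: XI. Qed.

Lemma pbwS l (f : fps (mfps K l)) :
  @pbw l.+1 f = isum (fun i => X l ^+ i * pbw (fcoef f i)).
Proof. by []. Qed.

Lemma pbwD l (f g : mfps K l) : (l <= n)%N -> pbw (f + g) = pbw f + pbw g.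
Proof.
elim: l f g => [|l IH] f g ln /=; first by rewrite scalerDl.
rewrite -isumD => [|i|i]; try exact: termI.
by congr isum; apply/funext => i; rewrite (IH _ _ (ltnW ln)) mulrDr.
Qed.

Lemma pbwZ l c (f : mfps K l) : (l <= n)%N -> pbw (mfps_const l c * f) = c *: pbw f.
Proof.
elim: l f => [|l IH] f ln; first by rewrite /= scalerA.
rewrite !pbwS -isumZ => [|i]; last exact: termI.
congr isum; apply/funext => i.
by rewrite fcoef_constM (IH _ (ltnW ln)) scalerAr.
Qed.

Lemma pbw0 l : (l <= n)%N -> @pbw l 0 = 0.
Proof.
move=> ln; have := @pbwZ l 0 0 ln.
by rewrite mulr0 scale0r.
Qed.

Lemma pbwN l (f : mfps K l) : (l <= n)%N -> pbw (- f) = - pbw f.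
Proof. by move=> ln; apply/eqP; rewrite -addr_eq0 -pbwD // addNr pbw0. Qed.

Lemma pbwB l (f g : mfps K l) : (l <= n)%N -> pbw (f - g) = pbw f - pbw g.
Proof. by move=> ln; rewrite pbwD // pbwN. Qed.

Lemma pbw_sum l (J : Type) (r : seq J) (f : J -> mfps K l) : (l <= n)%N ->
  pbw (\sum_(i <- r) f i) = \sum_(i <- r) pbw (f i).
Proof.
move=> ln; elim: r => [|i r IH]; first by rewrite !big_nil pbw0.
by rewrite !big_cons pbwD // IH.
Qed.

Lemma pbw_in l m (f : mfps K l) : (l <= n)%N -> W l m f -> I m (pbw f).
Proof.
elim: l m f => [|l IH] m f ln /=.
  by move=> mf; apply/hdvd_augIpow; rewrite -[f]mulr1; case: mf => y ->; exists (y *: 1); rewrite mulr1 scalerA.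
move=> Wf; apply: isum_in => i.
have xI : I i (X l ^+ i) by apply: augIpowX; apply: XI.
case: (leqP i m) => im; last exact: augIpowMr.
rewrite -(subnKC im); apply: augIpowM => //; exact: IH (ltnW ln) (Wf i).
Qed.

(* Moving X_j to its place costs commutators, and [I, I^i] is contained in h I^i. *)
Lemma pbw_var l m j (f : mfps K l) : (l <= n)%N -> (j < l)%N -> W l m f ->
  @hI _ _ _ hA m (X j * pbw f - pbw (mvar K l j * f)).
Proof.
elim: l m f => // l IH m f ln jl Wf.
have ln' := ltnW ln; have fI i : I (m - i) (pbw (fcoef f i)) by apply: pbw_in (Wf i).
have xI i : I i (X l ^+ i) by apply: augIpowX; apply: XI.
have [jl'|jl'] := eqVneq j l.
  suff -> : X j * pbw f = pbw (mvar K l.+1 j * f) by rewrite subrr; apply: hI0.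
  rewrite [mvar _ _ _]/= jl' eqxx !pbwS -isumMl => [|i]; last exact: termI.
  rewrite [RHS]isum_recl => [|i|]; first last.
  - by rewrite fcoef_hbarM pbw0 // mulr0.
  - exact: termI.
  by congr isum; apply/funext => i; rewrite fcoef_hbarM exprS mulrA.
have {jl jl'} jl : (j < l)%N by rewrite ltn_neqAle jl' -ltnS.
rewrite [mvar _ _ _]/= (ltn_eqF jl) !pbwS -isumMl => [|i]; last exact: termI.
rewrite -scaleN1r -isumZ => [|i]; last exact: termI.
rewrite -isumD => [|i|i]; last 2 first.
- by apply: augIpowMl; apply: termI.
- by apply: augIpowZ; apply: termI.
apply: isum_hI => i; rewrite fcoef_constM scaleN1r.
have -> : X j * (X l ^+ i * pbw (fcoef f i)) - X l ^+ i * pbw (mvar K l j * fcoef f i) =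
  (X j * X l ^+ i - X l ^+ i * X j) * pbw (fcoef f i) +
    X l ^+ i * (X j * pbw (fcoef f i) - pbw (mvar K l j * fcoef f i)).
  by rewrite mulrBl mulrBr !mulrA addrA subrK.
have mi : (maxn i m <= i + (m - i))%N by rewrite geq_max leq_addr -leq_subLR leqnn.
have hI_le p q x : (p <= q)%N -> @hI _ _ _ hA q x -> @hI _ _ _ hA p x.
  by move=> pq [z zI ->]; exists z => //; apply: augIpow_le zI.
apply: (hI_le _ _ _ mi); apply: hID.
  apply: hIMr (fI i); apply: (comm_augI (adic_comm adic)) (xI i).
  by apply: XI; apply: leq_trans ln'.
by apply: hIMl (xI i) _; apply: IH.
Qed.

Hypothesis pbw_surj : forall x, exists f : mfps K n, pbw f = x.

Definition pbw_fil m x := exists2 f : mfps K n, W n m f & pbw f = x.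

(** By [pbw_var], X_i times an ordered series is again one up to hbar z with z in I^m. The induction
    hypothesis applies to z, and hbar supplies the missing degree, so no infinite chain of
    corrections arises. *)
Lemma augIpow_pbw m x : I m x -> pbw_fil m x.
Proof.
elim: m x => [|m IH] x.
  by move=> _; have [f <-] := pbw_surj x; exists f => //; apply: mfil_all.
have Padd x' y : pbw_fil m.+1 x' -> pbw_fil m.+1 y -> pbw_fil m.+1 (x' + y).
  move=> [f Wf <-] [g Wg <-]; exists (f + g); last by rewrite pbwD.
  exact: mfilD.
have Wh : W n 1%N (mfps_const n (hbar : K)).
  by apply: mfil_const => //; exists 1; rewrite fps_scaleE expr1 mulr1.
have Ph y : I m y -> pbw_fil m.+1 (hbar *: y).
  move=> /IH[g Wg <-]; exists (mfps_const n hbar * g); last by rewrite pbwZ.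
  by rewrite -add1n; apply: mfilM.
have PX i y : (i < n)%N -> I m y -> pbw_fil m.+1 (X i * y).
  move=> ni /IH[f Wf <-]; have [z zI] := pbw_var (leqnn n) ni Wf.
  move=> /eqP; rewrite subr_eq => /eqP ->; apply: Padd; first exact: Ph.
  by exists (mvar K n i * f) => //; rewrite -add1n; apply: mfilM => //; apply: mfil_var.
move: x; apply: (augIpow_elim (hB := hA)) => [|u v|a b /Xgen[f [w ->]] bI].
- by exists 0; [apply: mfil0|rewrite pbw0].
- exact: Padd.
rewrite mulrDl mulr_suml; apply: (Padd); last first.
  by rewrite -scalerAl; apply: Ph; apply: augIpowMl.
apply: (big_ind _ _ Padd) => [|i _].
  by exists 0; [apply: mfil0|rewrite pbw0].
by rewrite -mulrA; apply: PX => //; apply: augIpowMl.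
Qed.

Hypothesis pbw_inj : forall f : mfps K n, pbw f = 0 -> f = 0.

(** Multi-indices of length l and total degree m, with the exponent of the outermost variable at the
    head. *)
Fixpoint multis (l m : nat) : seq (seq nat) :=
  if l is l'.+1 then
    flatten [seq map (cons i) (multis l' (m - i)) | i <- iota 0 m.+1]
  else if m == 0%N then [:: [::]] else [::].

Fixpoint monom (l : nat) (al : seq nat) : mfps K l :=
  match l return mfps K l with
  | 0 => 1
  | l'.+1 => Fps (fun i => if i == head 0%N al then monom l' (behead al) else 0)
  end.

Fixpoint mcoef (l : nat) (al : seq nat) : mfps K l -> K :=
  match l return mfps K l -> K with
  | 0 => id
  | l'.+1 => fun f : fps (mfps K l') => mcoef (behead al) (fcoef f (head 0%N al))
  end.

Lemma multisS l m al : al \in multis l.+1 m ->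
  exists i be, [/\ al = i :: be, (i <= m)%N & be \in multis l (m - i)].
Proof.
move=> /flatten_mapP[i]; rewrite mem_iota ltnS => /= im /mapP[be beP ->].
by exists i, be.
Qed.

Lemma mcoefD l al (f g : mfps K l) : mcoef al (f + g) = mcoef al f + mcoef al g.
Proof. by elim: l al f g => //= l IH al f g; rewrite IH. Qed.
Lemma mcoefZ l al c (f : mfps K l) : mcoef al (mfps_const l c * f) = c * mcoef al f.
Proof.
elim: l al f => // l IH al f.
rewrite -[LHS]/(mcoef (behead al) (fcoef (fps_const (mfps_const l c) * f : fps (mfps K l))
  (head 0%N al))).
by rewrite fcoef_constM IH.
Qed.

Lemma monom_fil l m al : al \in multis l m -> W l m (monom l al).
Proof.
elim: l m al => [|l IH] m al.
  by rewrite /=; case: eqP => // -> _; apply: hdvd00.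
move=> /multisS[i [be [-> im beP]]] j /=; case: eqP => [->|_]; first exact: IH.
exact: mfil0.
Qed.

Lemma mcoef_fil l m p al (f : mfps K l) : al \in multis l m -> W l p f ->
  hdvd p (hbar ^+ m *: (mcoef al f : K^o)).
Proof.
elim: l m p al f => [|l IH] m p al f.
  by rewrite /=; case: eqP => // -> _; rewrite scale1r.
move=> /multisS[i [be [-> im beP]]] /(_ i) Wf /=.
rewrite -(subnKC im) exprD -scalerA.
apply: (@hdvd_le _ _ _ (i + (p - i))); first by rewrite -leq_subLR.
by apply: hdvd_hbarZ; apply: IH beP Wf.
Qed.

Lemma fcoef_monom l i be (f : fps (mfps K l)) j :
  fcoef (mfps_const l.+1 (@mcoef l.+1 (i :: be) f) * monom l.+1 (i :: be) : fps (mfps K l)) j =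
  if j == i then mfps_const l (mcoef be (fcoef f i)) * monom l be else 0.
Proof.
rewrite (_ : mfps_const l.+1 _ = fps_const (mfps_const l (mcoef be (fcoef f i)))) //.
by rewrite fcoef_constM /=; case: eqP; rewrite ?mulr0.
Qed.

(** The truncation is by total degree while the series are nested one variable at a time.
    Coefficient j of the outer variable selects the multi-indices with head j, and so sees the same
    truncation at m - j. *)
Lemma monom_expand l m (f : mfps K l) :
  W l m (f - \sum_(i < m) \sum_(al <- multis l i) mfps_const l (mcoef al f) * monom l al).
Proof.
elim: l m f => [|l IH] [|m] f; try exact: mfil_all.
  rewrite big_ord_recl /= big_seq1 big1 => [|i _]; last by rewrite big_nil.
  by rewrite addr0 mulr1 subrr; apply: hdvd0.
move: m.+1 => {}m j; have := IH (m - j)%N (fcoef f j).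
congr (@mfil _ _ l (m - j) _); rewrite fcoefB; congr (_ - _); rewrite fcoef_sum.
pose T i := \sum_(be <- multis l i) mfps_const l (mcoef be (fcoef f j)) * monom l be.
transitivity (\sum_(i < m) (if (j <= i)%N then T (i - j)%N else 0)); last first.
  apply: eq_bigr => i _; rewrite fcoef_sum big_flatten big_map.
  have -> : iota 0 i.+1 = index_iota 0 i.+1 by rewrite /index_iota subn0.
  rewrite big_mkord.
  have layer (i' : nat) : \sum_(al <- map (cons i') (multis l (i - i')))
      fcoef (mfps_const l.+1 (mcoef al f) * monom l.+1 al) j =
      if j == i' then T (i - j)%N else 0.
    rewrite big_map; under eq_bigr => be _ do rewrite fcoef_monom.
    by case: eqP => [ji'|_]; [rewrite /T -ji'|rewrite big1].
  under eq_bigr => i' _ do rewrite layer.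
  case: leqP => ji.
    rewrite (bigD1 (Ordinal (ji : j < i.+1)%N)) //= eqxx big1 ?addr0 // => i' ii'.
    by case: eqP => // jE; case/eqP: ii'; apply: val_inj.
  by rewrite big1 // => i' _; rewrite gtn_eqF // (leq_ltn_trans _ ji) // -ltnS.
case: (leqP j m) => [jm|mj]; last first.
  have /eqP -> : (m - j == 0)%N by rewrite subn_eq0 ltnW.
  by rewrite big_ord0 big1 // => i _; rewrite leqNgt (leq_trans (ltn_ord i) (ltnW mj)).
have -> : \sum_(i < m) (if (j <= i)%N then T (i - j)%N else 0) =
    \sum_(i < j + (m - j)) (if (j <= i)%N then T (i - j)%N else 0) by rewrite subnKC.
rewrite big_split_ord /= [X in _ = X + _]big1 ?add0r => [|i _].
  by apply: eq_bigr => i _; rewrite leq_addr addKn.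
by rewrite leqNgt ltn_ord.
Qed.

Let unpbw (x : F) : mfps K n := xget 0 [set f : mfps K n | pbw f = x]%classic.
Let unpbwK x : pbw (unpbw x) = x.
Proof. exact: (@xgetPex _ _ [set f : mfps K n | pbw f = x]%classic (pbw_surj x)). Qed.
Let pbwI (f g : mfps K n) : pbw f = pbw g -> f = g.
Proof.
move=> /eqP; rewrite -subr_eq0 -pbwB // => /eqP/pbw_inj/eqP.
by rewrite subr_eq0 => /eqP.
Qed.
Let pbwK f : unpbw (pbw f) = f.
Proof. exact/pbwI/unpbwK. Qed.

(** The coordinates are the coefficients of the inverse of [pbw]. Their weights are right because
    [pbw] matches the two filtrations in both directions, by [pbw_in] and [augIpow_pbw]. *)
Lemma pbw_adapted_basis : exists (b : seq nat -> F) (c : seq nat -> wmod k E -> K^o),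
  adapted_basis (multis n) b c.
Proof.
exists (fun al => pbw (monom n al)), (fun al x => mcoef al (unpbw x)); split.
- move=> al c x y; have -> : unpbw (c *: x + y) = mfps_const n c * unpbw x + unpbw y.
    by apply: pbwI; rewrite pbwD // pbwZ // !unpbwK.
  by rewrite mcoefD mcoefZ.
- by move=> m al /monom_fil/pbw_in; apply.
- by move=> m p al x alm /augIpow_pbw[f Wf <-]; rewrite pbwK; apply: mcoef_fil alm Wf.
- move=> m x; have := pbw_in (leqnn n) (monom_expand m (unpbw x)).
  rewrite pbwB // pbw_sum // unpbwK; congr augIpow; congr (_ - _).
  by apply: eq_bigr => i _; rewrite pbw_sum //; apply: eq_bigr => al _; rewrite pbwZ.
Qed.

End Pbw.

(** * Reduction modulo hbar and bijectivity of the ordered monomial map *)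

Fixpoint mred (k : fieldType) (l : nat) : mfps (fps k) l -> mfps k l :=
  match l return mfps (fps k) l -> mfps k l with
  | 0 => fun c : fps k => fcoef c 0
  | l'.+1 => fun f : fps (mfps (fps k) l') => Fps (fun i => mred (fcoef f i))
  end.

(** The exchange k[[x]][[hbar]] -> k[[hbar]][[x]]: [u i] becomes the coefficient of hbar^i. *)
Fixpoint massemble (k : fieldType) (l : nat) : (nat -> mfps k l) -> mfps (fps k) l :=
  match l return (nat -> mfps k l) -> mfps (fps k) l with
  | 0 => fun u => Fps u
  | l'.+1 => fun u : nat -> fps (mfps k l') =>
      Fps (fun j => massemble (fun i => fcoef (u i) j))
  end.

Section Assemble.
Variable k : fieldType.
Local Notation K := (fps k).

Lemma mred_massemble l (u : nat -> mfps k l) : mred (massemble u) = u 0%N.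
Proof. by elim: l u => [|l IH] u //=; apply: fpsP => j /=; rewrite IH. Qed.

Lemma mred_eq l (f g : mfps K l) : mred f = mred g ->
  exists q, f = g + mfps_const l hbar * q.
Proof.
elim: l f g => [|l IH] f g.
  move=> fg0; exists (Fps (fun i => fcoef (f - g : K) i.+1)).
  apply: fpsP => i; rewrite fcoefD fcoef_hbarM; case: i => [|i]; first by rewrite addr0.
  by rewrite /= addrC subrK.
move=> fg; have /choice[q qP] : forall i, exists q,
    fcoef f i = fcoef g i + mfps_const l hbar * q.
  by move=> i; apply: IH; apply: (congr1 (fun h : fps (mfps k l) => fcoef h i) fg).
exists (Fps q); apply: fpsP => i; rewrite [LHS]qP fcoefD; congr (_ + _).
by rewrite [mfps_const l.+1 _]/(fps_const (mfps_const l hbar)) fcoef_constM.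
Qed.

Lemma massemble_shift l (u : nat -> mfps k l) :
  massemble u = massemble (fun i => if i is _.+1 then 0 else u 0%N) +
    mfps_const l hbar * massemble (fun i => u i.+1).
Proof.
elim: l u => [|l IH] u.
  apply: fpsP => i; rewrite fcoefD fcoef_hbarM; case: i => [|i]; first by rewrite /= addr0.
  by rewrite /= add0r.
apply: fpsP => i; rewrite [LHS]IH fcoefD; congr (massemble _ + _).
  by apply/funext => -[|j].
by rewrite [mfps_const l.+1 _]/(fps_const (mfps_const l hbar)) fcoef_constM.
Qed.

End Assemble.

Section Limit.
Variables (k : fieldType) (E : Type) (A : augAlg k E) (hA : is_augAlg A).
Local Notation K := (fps k).
Local Notation F := (falg hA).
Local Notation I n := (augIpow A n).
Let e_lin := (aeps_form hA).1.

Variables (n : nat) (pi : F -> mfps k n).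
Hypotheses (piD : forall x y, pi (x + y) = pi x + pi y)
  (piZ : forall c x, pi (c *: x) = mfps_const n (fcoef c 0) * pi x)
  (piM : forall x y, pi (x * y) = pi x * pi y) (pi1 : pi 1 = 1)
  (pi_surj : forall z, exists x, pi x = z)
  (pi_ker : forall x, pi x = 0 <-> hdvd 1 x).

Let pi0 : pi 0 = 0. Proof. exact/pi_ker/hdvd0. Qed.
Let piN x : pi (- x) = - pi x.
Proof. by apply/eqP; rewrite -addr_eq0 -piD addNr pi0. Qed.
Let piB x y : pi (x - y) = pi x - pi y. Proof. by rewrite piD piN. Qed.
Let pi_sum (J : Type) (r : seq J) (f : J -> F) :
  pi (\sum_(i <- r) f i) = \sum_(i <- r) pi (f i).
Proof. by elim: r => [|i r IH]; rewrite ?big_nil // !big_cons piD IH. Qed.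
Let piX x m : pi (x ^+ m) = pi x ^+ m.
Proof. by elim: m => [|m IH]; rewrite ?expr0 // !exprS piM IH. Qed.

Variable X : nat -> F.
Hypothesis piXE : forall i, pi (X i) = mvar k n i.

(* Otherwise X_i - c is invertible modulo hbar, with eps (X_i - c) = 0 modulo hbar. *)
Lemma lift_var_augI i : (i < n)%N -> augI A (X i).
Proof.
move=> ni; apply/(augIP (hB := hA))/hdvd_fpsP => -[|//] _.
set c := fcoef _ _; apply/eqP; apply: contraT => c0.
have [u uP] := mvar_unit ni c0; have [z zu] := pi_surj u.
have : pi (z * (X i - fps_const c *: 1) - 1) = 0.
  by rewrite piB piM piB piZ pi1 piXE zu mulr1 uP subrr.
move=> /pi_ker/(linear_hdvd e_lin)/hdvd_fpsP/(_ 0%N isT).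
rewrite (linfB e_lin) epsM (linfB e_lin) (linfZ e_lin) (eps1 hA) fps_scaleE mulr1.
rewrite fcoefB fcoefM big_ord1 fcoefB /= -/c subrr mulr0 sub0r => /eqP.
by rewrite oppr_eq0 oner_eq0.
Qed.

Lemma lift_var_gen (x : F) : augI A x ->
  exists (f : nat -> F) (w : F), x = \sum_(i < n) X i * f i + hbar *: w.
Proof.
move=> xI; have [c [g gE]] := mvar_decomp (pi x).
have /choice[f fP] : forall i : 'I_n, exists y, pi y = g i by move=> i; apply: pi_surj.
pose s : F := \sum_(i < n) X i * f i.
have [w wE] : hdvd 1 (x - (fps_const c *: 1 + s)).
  apply/pi_ker; rewrite piB gE piD piZ pi1 mulr1 pi_sum; apply/eqP; rewrite subr_eq0.
  by apply/eqP; congr (_ + _); apply: eq_bigr => i _; rewrite piM piXE fP.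
have sI : augI A s.
  apply: (augIpow1E (hB := hA)); apply: (augIpow_sum (hB := hA)) => i _.
  by apply: augIpow_base => //; apply: lift_var_augI.
have eps0 (y : F) : augI A y -> fcoef (aeps A y) 0 = 0.
  by move=> /(augIP (hB := hA))/hdvd_fpsP; apply.
(* Modulo hbar, c is the counit of x, since the other terms of the decomposition lie in I. *)
have c0 : c = 0.
  have := congr1 (fun y => fcoef (aeps A y) 0) wE.
  rewrite expr1 (eps0 _ (augI_hbar _)) (linfB e_lin) (linfD e_lin) (linfZ e_lin).
  rewrite (eps1 hA) fcoefB fcoefD !eps0 // fps_scaleE mulr1 addr0 sub0r => /eqP.
  by rewrite oppr_eq0 => /eqP.
exists (fun i => if insub i is Some j then f j else 0), w.
move/eqP: wE; rewrite c0 rmorph0 scale0r add0r subr_eq addrC => /eqP ->.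
by rewrite expr1; congr (_ + _); apply: eq_bigr => i _; rewrite valK.
Qed.

Hypotheses (comm : forall x y : F, hdvd 1 (x * y - y * x))
  (sep : forall a, exists n, forall x : F, I n x -> hdvd 1 (x a)).

Lemma limit_adic : is_adic hA.
Proof.
split=> //; exists n, (fun i => X i); split=> [i|x /lift_var_gen[f [w ->]]].
  exact: lift_var_augI.
by exists (fun i => f i), w.
Qed.

Local Notation W l m := (@mfil k (fun p (c : k) => (0 < p)%N -> c = 0) l m).
Let hW := mulfil_field k.

Lemma limit_fil m x : I m x -> W n m (pi x).
Proof.
elim: m x => [|m IH] x; first by move=> _; apply: (mfil_all hW).
elim/augIpow_elim => [|u v|a b /lift_var_gen[f [w ->]] bI].
- by rewrite pi0; apply: (mfil0 hW).
- by rewrite piD; apply: (mfilD hW).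
rewrite piM -[m.+1]add1n; apply: (mfilM hW); last exact: IH.
rewrite piD piZ rmorph0 mul0r addr0 pi_sum; apply: (mfil_sum hW) => i _.
by rewrite piM piXE; apply: (mfilMr hW); apply: (mfil_var hW).
Qed.

Lemma limit_sep0 (f : mfps k n) : (forall m, W n m f) -> f = 0.
Proof.
apply: (mfil_sep (G := fun p (c : k) => (0 < p)%N -> c = 0)) => c cP.
exact: (cP 1%N).
Qed.

(** Allowing any morphism [iota] into k[[x_1,...,x_n]] lets the induction on l run inside one fixed
    target. As pi is only known to be additive and multiplicative, the infinite sum is compared
    modulo order m for each m, its tail being controlled by [limit_fil]. *)
Lemma limit_pbw_aux l (iota : {rmorphism mfps k l -> mfps k n}) : (l <= n)%N ->
  (forall c, iota (mfps_const l c) = mfps_const n c) ->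
  (forall i, (i < l)%N -> iota (mvar k l i) = mvar k n i) ->
  forall f : mfps K l, pi (pbw X f) = iota (mred f).
Proof.
elim: l iota => [|l IH] iota ln iotaC iotaX f.
  by rewrite /= piZ pi1 mulr1 -iotaC.
apply/eqP; rewrite -subr_eq0; apply/eqP/limit_sep0 => m.
pose iota' : {rmorphism mfps k l -> mfps k n} := iota \o @fps_const (mfps k l).
have {}IH := IH iota' (ltnW ln) iotaC.
have {}IH g : pi (pbw X g) = iota' (mred g).
  apply: IH => i il; rewrite -iotaX; last exact: ltnW.
  by rewrite /iota' /= ltn_eqF.
have XlI : augI A (X l) by apply: lift_var_augI.
have tI i : I i (X l ^+ i * pbw X (fcoef f i)) by apply/augIpowMr/augIpowX.
rewrite pbwS -(subrK (\sum_(i < m) X l ^+ i * pbw X (fcoef f i)) (isum _)).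
rewrite piD -addrA; apply: (mfilD hW).
  by apply/limit_fil/isumP; [apply: limit_adic|].
rewrite [X in iota X](fps_split m) rmorphD rmorph_sum pi_sum opprD addrA.
have -> : \sum_(i < m) pi (X l ^+ i * pbw X (fcoef f i)) -
  \sum_(i < m) iota (hbar ^+ i * fps_const (fcoef (mred f : fps (mfps k l)) i)) = 0.
  apply/eqP; rewrite subr_eq0; apply/eqP/eq_bigr => i _.
  rewrite rmorphM rmorphXn piM piX piXE IH /= -(iotaX l) //=.
  by rewrite eqxx.
rewrite add0r -rmorphN -mulrN rmorphM rmorphXn; apply: (mfilMr hW); apply: (mfilX hW).
by have := iotaX l (leqnn _); rewrite /= eqxx => ->; apply: (mfil_var hW).
Qed.

Lemma limit_pbw f : pi (@pbw _ _ _ hA X n f) = mred f.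
Proof. exact: (@limit_pbw_aux n idfun). Qed.

Let XI := lift_var_augI.
Let adic := limit_adic.

(** A series in the kernel reduces to 0 modulo hbar, so it is hbar q, and q is in the kernel since F
    has no torsion. Iterating, it is divisible by all powers of hbar. *)
Lemma limit_pbw_inj f : @pbw _ _ _ hA X n f = 0 -> f = 0.
Proof.
move=> f0; apply: (mfil_sep (G := fun p (c : K) => hdvd p (c : K^o))).
  by move=> c; apply/hsep0/fps_hcomplete.
move=> m; elim: m f f0 => [|m IH] f f0; first exact: (mfil_all (mulfil_hdvd k)).
have [q qE] : exists q, f = 0 + mfps_const n hbar * q.
  by apply: mred_eq; rewrite -!limit_pbw f0 (pbw0 adic XI (leqnn n)).
rewrite qE add0r -add1n; apply: (mfilM (mulfil_hdvd k)).
  apply: (mfil_const (mulfil_hdvd k)); exists 1.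
  by rewrite fps_scaleE expr1 mulr1.
apply: IH; apply: wmod_htfree.
by move: f0; rewrite qE add0r (pbwZ adic XI).
Qed.

(** Successive approximation: the reduction of x is lifted to an ordered series constant in hbar,
    the difference is divided by hbar, and the digits so obtained are put together by
    [massemble]. *)
Lemma limit_pbw_surj x : exists f, @pbw _ _ _ hA X n f = x.
Proof.
pose lift (u : mfps k n) := massemble (fun i => if i is _.+1 then 0 else u).
have /choice[next nextP] : forall x, exists y, x - pbw X (lift (pi x)) = hbar *: y.
  move=> y; have /pi_ker[z zE] : pi (y - pbw X (lift (pi y))) = 0.
    by rewrite piB limit_pbw mred_massemble subrr.
  by exists z; rewrite zE expr1.
pose xs i := iter i next x; pose u i := pi (xs i).
have step i : xs i - pbw X (massemble (fun j => u (i + j)%N)) =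
    hbar *: (xs i.+1 - pbw X (massemble (fun j => u (i.+1 + j)%N))).
  have -> : massemble (fun j => u (i + j)%N) =
      lift (u i) + mfps_const n hbar * massemble (fun j => u (i.+1 + j)%N).
    rewrite massemble_shift addn0; congr (_ + _ * massemble _).
    by apply/funext => j; rewrite addnS.
  rewrite (pbwD adic XI) // (pbwZ adic XI) // scalerBr opprD addrA.
  by congr (_ - _); apply: nextP.
exists (massemble u); apply: (augIpow_sep adic) => m; apply: hdvd_augIpow.
suff H i : hdvd m (xs i - pbw X (massemble (fun j => u (i + j)%N))).
  by have /hdvdN := H 0%N; rewrite opprB.
elim: m i => [|m IH] i; first exact: hdvd00.
by rewrite step -add1n -[hbar]expr1; apply: hdvd_hbarZ.
Qed.

Lemma limit_adapted_basis : exists (b : seq nat -> F) (c : seq nat -> wmod k E -> K^o),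
  adapted_basis (multis n) b c.
Proof.
exact: (pbw_adapted_basis adic XI lift_var_gen limit_pbw_surj limit_pbw_inj).
Qed.

End Limit.

Theorem formal_group_limit_basis (k : fieldType) (E : Type) (A : augAlg k E)
  (hA : is_augAlg A) : is_formal_group_limit A ->
  is_adic hA /\ exists H (b : seq nat -> falg hA) c, adapted_basis H b c.
Proof.
move=> [comm _ sep [n [pi [piD piZ piM pi1 [pi_surj pi_ker]]]]].
have /choice[X XP] : forall i, exists x : falg hA, pi x = mvar k n i.
  by move=> i; apply: pi_surj.
split; first exact: (limit_adic piD piZ piM pi1 pi_surj pi_ker XP comm sep).
exists (multis n).
exact: (limit_adapted_basis piD piZ piM pi1 pi_surj pi_ker XP comm sep).
Qed.

(** * The Drinfeld dual *)

Section Vee.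
Variables (k : fieldType) (E : Type) (A : augAlg k E) (hA : is_augAlg A).
Local Notation K := (fps k).
Local Notation F := (falg hA).
Local Notation I n := (augIpow A n).
Variables (U : algType K) (iota : lwmod k E -> U).
Hypothesis hU : is_vee A iota.
Local Notation L := (veeLattice A).
Local Notation j := (vee_in iota).
Local Notation toK := (@FracField.tofrac K).
Implicit Types (x y : F).

Let tofrac_hbar n : toK hbar ^+ n != 0.
Proof. by rewrite expf_neq0 // tofrac_eq0 hbar_neq0. Qed.

Lemma hfrac0 n : hfrac n (0 : F) = 0 :> lwmod k E.
Proof. by apply/funext => e; rewrite /hfrac tofrac0 mul0r. Qed.

Lemma hfracD n x y : hfrac n (x + y) = hfrac n x + hfrac n y.
Proof. by apply/funext => e; rewrite /hfrac tofracD mulrDl. Qed.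

Lemma hfrac_sum n (J : Type) (r : seq J) (f : J -> F) :
  hfrac n (\sum_(i <- r) f i) = \sum_(i <- r) hfrac n (f i).
Proof.
elim: r => [|i r IH]; first by rewrite !big_nil hfrac0.
by rewrite !big_cons hfracD IH.
Qed.

Lemma hfracZ n c x : hfrac n (c *: x) = lscale c (hfrac n x).
Proof. by apply/funext => e; rewrite /hfrac /lscale tofracM mulrA. Qed.

Lemma hfrac_shift m n x : hfrac (m + n) (hbar ^+ m *: x) = hfrac n x.
Proof.
apply/funext => e; rewrite /hfrac tofracM tofracXn exprD invfM.
by rewrite mulrACA divff ?mul1r.
Qed.

Lemma lscale_hfrac m n x : lscale (hbar ^+ m) (hfrac (m + n) x) = hfrac n x.
Proof. by rewrite -hfracZ hfrac_shift. Qed.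

Lemma hfrac_inj n x y : hfrac n x = hfrac n y -> x = y.
Proof.
move=> xy; apply/funext => e.
move: xy => /(congr1 (fun g : lwmod k E => g e)) /(mulIf (invr_neq0 (tofrac_hbar n))).
by move/eqP; rewrite tofrac_eq => /eqP.
Qed.

Lemma hfrac_lattice n x : I n x -> L (hfrac n x).
Proof.
move=> xI; exists n.+1, (fun i => if i == n then x else 0); split.
  by move=> i; case: eqP => [->|_] //; apply: (augIpow_zero hA).
rewrite big_ord_recr /= eqxx big1 ?add0r // => i _.
by rewrite ltn_eqF // hfrac0.
Qed.

(** Common denominator: hbar^-i f_i = hbar^-N (hbar^(N-i) f_i), and the numerator has gained N - i
    degrees. *)
Lemma latticeP g : L g -> exists N (x : F), I N x /\ g = hfrac N x.
Proof.
move=> [N [f [fI ->]]]; exists N, (\sum_(i < N) hbar ^+ (N - i) *: (f i : F)); split.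
  apply: augIpow_sum => i _; have := augIpow_hbarX (N - i) (x := f i : F) (fI i).
  by rewrite subnK // ltnW.
rewrite hfrac_sum; apply: eq_bigr => i _.
by rewrite -(hfrac_shift (N - i)) subnK // ltnW.
Qed.

Lemma iotaD n x y : I n x -> I n y ->
  iota (hfrac n (x + y)) = iota (hfrac n x) + iota (hfrac n y).
Proof. by move=> xI yI; rewrite hfracD (vee_add hU) //; apply: hfrac_lattice. Qed.

Lemma iotaZ n c x : I n x -> iota (hfrac n (c *: x)) = c *: iota (hfrac n x).
Proof. by move=> xI; rewrite hfracZ (vee_scale hU) //; apply: hfrac_lattice. Qed.

Lemma vj_linear : linear (j : F -> U).
Proof. by move=> c x y; rewrite /vee_in iotaD // iotaZ. Qed.

Lemma vjM x y : j (x * y) = j x * j y.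
Proof. exact: (vee_mul hU (n := 0) (m := 0)). Qed.

Lemma vj1 : j (1 : F) = 1. Proof. exact: vee_one. Qed.

Lemma vj_frac n x : I n x -> j x = hbar ^+ n *: iota (hfrac n x).
Proof.
move=> xI; rewrite -(vee_scale hU); last exact: hfrac_lattice.
by have := lscale_hfrac n 0 x; rewrite addn0 => ->.
Qed.

Lemma vj_dvd n x : I n x -> hdvd n (j x).
Proof. by move=> /vj_frac ->; apply: hdvd_hbar. Qed.

Lemma vee_dvd_hfrac m n x : I n x -> hdvd m (iota (hfrac n x)) ->
  exists N (y : F), I N y /\ hbar ^+ N *: x = hbar ^+ (m + n) *: y.
Proof.
move=> xI /(vee_inj hU (hfrac_lattice xI))[g /latticeP[N [y [yI ->]]] xg].
exists N, y; split=> //; apply: (@hfrac_inj (N + n)).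
rewrite hfrac_shift xg -hfracZ -(hfrac_shift n).
by rewrite scalerA -exprD addnC [(n + m)%N]addnC.
Qed.

Lemma vee_hdvd_intro m n N x y : I n x -> I N y ->
  hbar ^+ N *: x = hbar ^+ (m + n) *: y -> hdvd m (iota (hfrac n x)).
Proof.
move=> xI yI xy; rewrite -(hfrac_shift N) xy [(N + n)%N]addnC [(m + n)%N]addnC.
by rewrite exprD -scalerA hfrac_shift iotaZ //; apply: hdvd_hbar.
Qed.

(** Torsion-freeness is not part of [is_vee]. If hbar u = 0, a lattice element g near u has hbar g
    divisible by a high power of hbar in U; [vee_inj] brings this divisibility back to the lattice,
    where hbar can be cancelled. *)
Lemma vee_htfree : htfree U.
Proof.
move=> u hu; apply: (hsep0 (vee_complete hU)) => m.
have [g gL ug] := vee_dense hU m.+1 u; apply: hdvd_sub (hdvd_le (leqnSn m) ug) _.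
have [n [x [xI gE]]] := latticeP gL.
have hg : hdvd m.+1 (iota (hfrac n (hbar *: x))).
  rewrite iotaZ // -gE -[X in hdvd _ X]opprK -[X in - X]addr0 -hu -scaleN1r.
  have -> : - (hbar *: iota g) + hbar *: u = hbar *: (u - iota g).
    by rewrite scalerBr addrC.
  exact/hdvdZ/hdvdZ.
have [N [y [yI xy]]] := vee_dvd_hfrac (augIpowZ (hB := hA) hbar xI) hg.
rewrite gE; apply: (vee_hdvd_intro xI yI).
apply: (@htfree_inj _ _ 1 _ _ (@wmod_htfree _ _)); move: xy.
by rewrite !scalerA expr1 mulrC => ->; rewrite -exprS.
Qed.

Lemma vee_approx m u : exists n (x : F), I n x /\ hdvd m (u - iota (hfrac n x)).
Proof.
have [g /latticeP[n [x [xI ->]]] ug] := vee_dense hU m u.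
by exists n, x.
Qed.

Section Ext.
Variable P : lmodType K.
Hypotheses (cP : hcomplete P) (tP : htfree P).

(** Modulo hbar^m, u is some hbar^-n x, so hbar^n u agrees with j x modulo hbar^(n+m). The two maps
    agree on j x, and torsion-freeness of P removes hbar^n. *)
Lemma vee_ext_unique (g g' : U -> P) : linear g -> linear g' ->
  (forall x, g (j x) = g' (j x)) -> g =1 g'.
Proof.
move=> lg lg' gg' u; apply: (hsep cP) => m.
have [n [x [xI ux]]] := vee_approx m u.
apply: (@htfree_hdvd _ _ n) => //; rewrite scalerBr -(linfZ lg) -(linfZ lg').
have := hdvd_hbarZ n ux; rewrite scalerBr -vj_frac // => hx.
have := hdvdB (linear_hdvd lg hx) (linear_hdvd lg' hx).
by rewrite (linfB lg) (linfB lg') gg' opprB addrA subrK.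
Qed.

Section Basis.
Variables (T : eqType) (H : nat -> seq T) (b : T -> F) (c : T -> wmod k E -> K^o).
Hypothesis hb : adapted_basis H b c.

Lemma augIpow_coord m x :
  (forall i al, al \in H i -> hdvd m (hbar ^+ i *: c al x)) -> I m x.
Proof.
move=> cx; rewrite -[x](subrK (\sum_(i < m) \sum_(al <- H i) c al x *: b al)).
apply: (augIpowD (hB := hA)); first exact: ab_expand.
apply: augIpow_sum => i _; rewrite big_seq; apply: augIpow_sum => al alH.
have im := ltnW (ltn_ord i).
have [d ->] : hdvd (m - i) (c al x).
  apply: (@htfree_hdvd _ _ i); first exact: fps_htfree.
  by rewrite subnKC //; apply: cx.
rewrite -scalerA -{1}(subnK im); apply: augIpow_hbarX.
by apply: augIpowZ; apply: (ab_in hb).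
Qed.

(* The crux: F meets h^m F^vee in I^m. *)
Lemma vj_dvdE m x : hdvd m (j x) <-> I m x.
Proof.
split=> [/(vee_dvd_hfrac (n := 0))|]; last exact: vj_dvd.
move=> /(_ Logic.I)[N [y [yI]]]; rewrite addn0 => xy; apply: augIpow_coord => i al alH.
apply: (@htfree_hdvd _ _ N); first exact: fps_htfree.
rewrite scalerA mulrC -scalerA -(linfZ (ab_linear hb al)) xy (linfZ (ab_linear hb al)).
rewrite scalerA mulrC -scalerA addnC; apply: hdvd_hbarZ.
exact: (ab_coord hb alH yI).
Qed.

Hypothesis adic : is_adic hA.

Lemma vj_inj x y : j x = j y -> x = y.
Proof.
move=> xy; apply: (augIpow_sep adic) => n; apply/vj_dvdE.
by rewrite (linfB vj_linear) xy subrr; apply: hdvd0.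
Qed.

Variable f : wmod k E -> P.
Hypotheses (lf : linear f) (fI : forall n x, I n x -> hdvd n (f x)).

(** Here p is a value modulo hbar^m of the extension at u: u is close to hbar^-n x, and p is hbar^-n
    f x. *)
Let ext_rel u m p := exists n (x : F),
  [/\ I n x, hdvd m (u - iota (hfrac n x)) & f x = hbar ^+ n *: p].

Let ext_rel_ex u m : exists p, ext_rel u m p.
Proof.
have [n [x [xI ux]]] := vee_approx m u; have [p fx] := fI xI.
by exists p, n, x.
Qed.

Let ext_rel_linear a u v m p q : ext_rel u m p -> ext_rel v m q ->
  ext_rel (a *: u + v) m (a *: p + q).
Proof.
move=> [n [x [xI ux fx]]] [N [y [yI vy fy]]].
have xI' : I (N + n) (hbar ^+ N *: x) by apply: augIpow_hbarX.
have yI' : I (N + n) (hbar ^+ n *: y) by rewrite addnC; apply: augIpow_hbarX.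
exists (N + n)%N, (a *: (hbar ^+ N *: x) + hbar ^+ n *: y); split.
- by apply: augIpowD => //; apply: augIpowZ.
- rewrite iotaD //; last exact: augIpowZ.
  rewrite (iotaZ _ xI') hfrac_shift [(N + n)%N]addnC hfrac_shift opprD addrACA -scalerBr.
  by apply: hdvdD => //; apply: hdvdZ.
rewrite (linfD lf) !(linfZ lf) fx fy scalerDr !scalerA exprD.
by rewrite -[a * _ * _]mulrA [a * _]mulrC [hbar ^+ n * _]mulrC.
Qed.

(** Well-definedness of the extension. If hbar^m divides u, then hbar^(n+m) divides j x, so x lies
    in I^(n+m) by [vj_dvdE], and f x is divisible accordingly. *)
Let ext_rel_dvd u m p : ext_rel u m p -> hdvd m u -> hdvd m p.
Proof.
move=> [n [x [xI ux fx]]] mu; apply: (@htfree_hdvd _ _ n) => //; rewrite -fx.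
apply: fI; apply/vj_dvdE; rewrite (vj_frac xI); apply: hdvd_hbarZ.
by have := hdvdB mu ux; rewrite opprB addrCA subrr addr0.
Qed.

Let ext_rel_sub u v m p q : ext_rel u m p -> ext_rel v m q -> hdvd m (u - v) ->
  hdvd m (p - q).
Proof.
move=> up vq uv; have := ext_rel_linear (-1) vq up; rewrite !scaleN1r addrC.
by rewrite [- q + p]addrC => /ext_rel_dvd; apply.
Qed.

Let ext_rel_le u m n p : (m <= n)%N -> ext_rel u n p -> ext_rel u m p.
Proof.
by move=> mn [N [x [xI ux fx]]]; exists N, x; split=> //; apply: hdvd_le ux.
Qed.

(** By [ext_rel_sub] the approximate values at u are determined modulo hbar^m, so they form a Cauchy
    sequence in P. *)
Lemma vee_ext_exists : exists g : U -> P, linear g /\ forall x, g (j x) = f x.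
Proof.
have /choice[g gP] : forall u, exists l, forall m p, ext_rel u m p -> hdvd m (l - p).
  move=> u; have /choice[p pP] := ext_rel_ex u.
  have [l lP] : exists l, forall m, hdvd m (l - p m).
    apply: (hlim_seq cP) => m.
    apply: (ext_rel_sub (ext_rel_le (leqnSn m) (pP m.+1)) (pP m)).
    by rewrite subrr; apply: hdvd0.
  exists l => m q uq; apply: hdvd_trans (lP m) _.
  by apply: (ext_rel_sub (pP m) uq); rewrite subrr; apply: hdvd0.
exists g; split=> [a u v|x].
  apply: (hsep cP) => m; have [p up] := ext_rel_ex u m; have [q vq] := ext_rel_ex v m.
  apply: hdvd_trans (gP _ _ _ (ext_rel_linear a up vq)) _.
  rewrite opprD addrACA -scalerBr; apply: hdvdD.
    by apply/hdvdZ/hdvd_subC/gP.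
  exact/hdvd_subC/gP.
apply: (hsep cP) => m; apply: gP; exists 0%N, x; split=> //; last by rewrite scale1r.
by rewrite subrr; apply: hdvd0.
Qed.

End Basis.
End Ext.
End Vee.

(** * Maps out of completed tensor products *)

Section Htensor.
Variables (k : fieldType) (M N T P : lmodType (fps k)) (tau : M -> N -> T).
Hypotheses (ht : is_htensor tau) (cP : hcomplete P).

Lemma htensor_ext (g g' : T -> P) : linear g -> linear g' ->
  (forall x y, g (tau x y) = g' (tau x y)) -> g =1 g'.
Proof.
move=> lg lg' gg'; have bb : bilinear_fun (fun x y => g (tau x y)).
  have [lr ll] := htensor_bilinear ht.
  by split=> [x c y z|y c x z]; rewrite ?lr ?ll lg.
have [h [_ hP]] := htensor_universal ht cP bb.
have hg : h = g by apply: hP.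
have hg' : h = g' by apply: hP; split=> // x y; rewrite gg'.
by move=> t; rewrite -hg hg'.
Qed.

Variable b : M -> N -> P.
Hypothesis bb : bilinear_fun b.

Lemma hliftP : linear (hlift tau b) /\ forall x y, hlift tau b (tau x y) = b x y.
Proof.
apply: (@xgetPex _ (fun=> 0)
  [set g : T -> P | linear g /\ forall x y, g (tau x y) = b x y]%classic).
by have [g [gP _]] := htensor_universal ht cP bb; exists g.
Qed.

Lemma hlift_linear : linear (hlift tau b). Proof. by have [] := hliftP. Qed.
Lemma hliftE x y : hlift tau b (tau x y) = b x y. Proof. by have [_ ->] := hliftP. Qed.

End Htensor.

Section Tcont.
Variables (k : fieldType) (E : Type) (A : augAlg k E) (hA : is_augAlg A).
Local Notation K := (fps k).
Local Notation F := (falg hA).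
Local Notation I n := (augIpow A n).
Variables (T : eqType) (H : nat -> seq T) (b : T -> F) (c : T -> wmod k E -> K^o).
Hypothesis hb : adapted_basis H b c.
Variables (X : Type) (P : lmodType K).
Hypothesis cP : hcomplete P.
Implicit Types (t : wmod k (X * E)) (g : wmod k (X * E) -> P).

(** Maps into U or U2 have hbar-adic targets, to which [wmap] does not apply. What is asked instead
    is continuity for the I-adic filtration of the last factor. *)
Definition tcont g := linear g /\
  forall m, exists M, forall t, slices_in A M t -> hdvd m (g t).

(** Only the last factor is expanded, and each weight has finitely many basis elements; so finitely
    many pure tensors suffice, however large the first factor is. *)
Lemma slices_expand m t : slices_in A m
  (t - \sum_(i < m) \sum_(al <- H i) wtensor (wslicer (c al) t) (b al)).
Proof.
move=> a; have := ab_expand hb m (fun e => t (a, e)).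
congr augIpow; apply/funext => e; rewrite !wmodB; congr (_ - _).
rewrite !wmod_sum; apply: eq_bigr => i _; rewrite !wmod_sum; apply: eq_bigr => al _.
by [].
Qed.

Lemma tcont_dvd g n : tcont g -> (forall x y, hdvd n (g (wtensor x y))) ->
  forall t, hdvd n (g t).
Proof.
move=> [lg cg] gn t; have [M MP] := cg n.
apply: (@hdvd_sub _ _ _ _ (g (\sum_(i < M) \sum_(al <- H i)
  wtensor (wslicer (c al) t) (b al)))).
  by rewrite -(linfB lg); apply/MP/slices_expand.
rewrite (linf_sum lg); apply: hdvd_sum => i _; rewrite (linf_sum lg).
by apply: hdvd_sum => al _.
Qed.

Lemma tcontB g g' : tcont g -> tcont g' -> tcont (fun t => g t - g' t).
Proof.
move=> [lg cg] [lg' cg']; split=> [a s t|m].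
  by rewrite lg lg' scalerBr opprD addrACA.
have [M MP] := cg m; have [N NP] := cg' m; exists (maxn M N) => t tI.
apply: hdvdB; [apply: MP => a|apply: NP => a].
  exact: (augIpow_le (hB := hA) (leq_maxl M N) (tI a)).
exact: (augIpow_le (hB := hA) (leq_maxr M N) (tI a)).
Qed.

Lemma tcont_ext g g' : tcont g -> tcont g' ->
  (forall x y, g (wtensor x y) = g' (wtensor x y)) -> g =1 g'.
Proof.
move=> cg cg' gg' t; apply: (hsep cP) => n.
apply: (tcont_dvd (tcontB cg cg')) => x y; rewrite gg' subrr; exact: hdvd0.
Qed.

Section Extend.
Variable beta : wmod k X -> wmod k E -> P.
Hypotheses (bb : bilinear_fun beta)
  (bI : forall m x y, I m y -> hdvd m (beta x y)).

Let part m t := \sum_(i < m) \sum_(al <- H i) beta (wslicer (c al) t) (b al).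

Let slicerD al a s t :
  wslicer (c al) (a *: s + t) = a *: wslicer (c al) s + wslicer (c al) t.
Proof.
apply/funext => x; rewrite /wslicer wmodD wmodZ -[RHS](ab_linear hb al).
by [].
Qed.

Let part_linear m : linear (part m).
Proof.
move=> a s t; rewrite /part scaler_sumr -big_split; apply: eq_bigr => i _ /=.
rewrite scaler_sumr -big_split; apply: eq_bigr => al _ /=.
by rewrite slicerD bb.2.
Qed.

(** In weight i <= p the coordinate is divisible by hbar^(p-i), and the other i powers of hbar come
    from [b al] in I^i. *)
Let part_small m p t : slices_in A p t -> hdvd p (part m t).
Proof.
move=> tI; apply: hdvd_sum => i _; rewrite big_seq; apply: hdvd_sum => al alH.
case: (leqP i p) => ip; last first.
  by apply: hdvd_le (ltnW ip) _; apply: bI; apply: (ab_in hb).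
have [d ->] : hdvd (p - i) (wslicer (c al) t).
  apply/hdvd_wmodP => x; apply: (@htfree_hdvd _ _ i); first exact: fps_htfree.
  by rewrite subnKC //; apply: (ab_coord hb alH (tI x)).
rewrite (linfZ (bb.2 _)) -{1}(subnK ip); apply: hdvd_hbarZ.
by apply: bI; apply: (ab_in hb).
Qed.

(** The value at t is obtained by expanding the last factor in the adapted basis; the series
    converges because beta sends I^m to hbar^m P in its second argument. *)
Lemma tensor_extension : exists g : wmod k (X * E) -> P, [/\ linear g,
  forall x y, g (wtensor x y) = beta x y &
  forall m t, slices_in A m t -> hdvd m (g t)].
Proof.
have /choice[g gP] : forall t, exists l, forall m, hdvd m (l - part m t).
  move=> t; apply: (hlim_seq cP) => m; rewrite /part big_ord_recr /= addrAC subrr add0r.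
  by rewrite big_seq; apply: hdvd_sum => al alH; apply: bI; apply: (ab_in hb).
exists g; split=> [a s t|x y|m t tI].
- apply: (hsep cP) => m; apply: hdvd_trans (gP _ m) _; rewrite part_linear.
  rewrite opprD addrACA -scalerBr; apply: hdvdD; last exact/hdvd_subC/gP.
  exact/hdvdZ/hdvd_subC/gP.
- apply: (hsep cP) => m; apply: hdvd_trans (gP _ m) _.
  have -> : part m (wtensor x y) = beta x (\sum_(i < m) \sum_(al <- H i) c al y *: b al).
    rewrite (linf_sum (bb.1 x)); apply: eq_bigr => i _.
    rewrite (linf_sum (bb.1 x)); apply: eq_bigr => al _.
    rewrite (linfZ (bb.1 x)) -(linfZ (bb.2 _)); congr beta.
    exact: (wslicer_tensor _ _ (ab_linear hb al)).
  by apply: hdvd_subC; rewrite -(linfB (bb.1 x)); apply/bI/(ab_expand hb).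
- by apply: hdvd_sub (gP t m) _; apply: part_small.
Qed.

End Extend.
End Tcont.

(** * Hopf structures *)

Lemma addrBBACA (V : zmodType) (x y z t u v : V) :
  (x + y) - (z + t) - (u + v) = (x - z - u) + (y - t - v).
Proof. by rewrite !opprD (addrACA x) (addrACA (x - z)). Qed.

Section FilHopf.
Variables (k : fieldType) (E : Type) (A : augAlg k E) (hA : is_augAlg A).
Local Notation K := (fps k).
Local Notation F := (falg hA).
Local Notation A2 := (augAlg_sq A).
Local Notation hA2 := (sq_is_augAlg hA).
Local Notation F2 := (falg hA2).
Local Notation I n := (augIpow A n).
Local Notation I2 n := (augIpow A2 n).
Local Notation eps := (aeps A).
Hypothesis adic : is_adic hA.
Variables (T : eqType) (H : nat -> seq T) (b : T -> F) (c : T -> wmod k E -> K^o).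
Hypothesis hb : adapted_basis H b c.
Let e_form := aeps_form hA.
Implicit Types (x y z : F) (s t : F2).

Lemma tensMr1 x t : t * tens 1 x = wtensr (fun y : wmod k E => (y : F) * x : F) t.
Proof.
move: t; apply: wmap_tensor_ext => [||y z].
- exact: (sq_mulr_map hA).
- exact/wmap_tensr/wmap_mulr.
- by rewrite (wtensr_tensor _ _ (wmap_mulr x).1) [LHS]tensM mulr1.
Qed.

Lemma slices_in0 X m : slices_in A m (0 : wmod k (X * E)).
Proof. by move=> a; apply: (augIpow_zero hA). Qed.

Lemma slices_in_sum (X J : Type) (r : seq J) (f : J -> wmod k (X * E)) m :
  (forall i, slices_in A m (f i)) -> slices_in A m (\sum_(i <- r) f i).
Proof.
move=> fI; elim: r => [|i r IH]; first by rewrite big_nil; apply: slices_in0.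
by rewrite big_cons => a; apply: (augIpowD (hB := hA) (fI i a) (IH a)).
Qed.

Lemma slices_in_sqMr m s t : slices_in A m s -> slices_in A m (s * t).
Proof.
move=> sI; have [J [w [wI wP]]] := slices_in_fgl adic E m.
have [f ->] := wP s sI; rewrite mulr_suml; apply: slices_in_sum => i.
by rewrite -tens1M -mulrA tens1M => a; apply: (@augIpowMr _ _ _ hA m (w i) (fun e => ((f i : F2) * t) (a, e)) (wI i)).
Qed.

Lemma slices_in_sqMl m s t : slices_in A m t -> slices_in A m (s * t).
Proof.
move=> tI; have [J [w [wI wP]]] := slices_in_fgr adic E m.
have [f ->] := wP t tI; rewrite mulr_sumr; apply: slices_in_sum => i.
by rewrite -tensMr1 mulrA tensMr1 => a; apply: (@augIpowMl _ _ _ hA m (fun e => (s * (f i : F2)) (a, e)) (w i) (wI i)).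
Qed.

Lemma slices_in_tensr (X : Type) m p (g : wmod k E -> wmod k E) (t : wmod k (X * E)) :
  (forall x, I m x -> I p (g x)) -> slices_in A m t -> slices_in A p (wtensr g t).
Proof. by move=> gI tI a; apply: (gI _ (tI a)). Qed.

Lemma slices_in_eps (X : Type) m (t : wmod k (X * E)) :
  slices_in A m t -> hdvd m (wslicer eps t).
Proof. by move=> tI; apply/hdvd_wmodP => a; apply: (eps_augIpow (hB := hA)). Qed.

Lemma slices_dvd n (g : wmod k (E * E) -> F) : linear g ->
  (forall m t, slices_in A m t -> I m (g t)) ->
  (forall x y, I n (g (wtensor x y))) -> forall t, I n (g t).
Proof.
move=> lg gI gn t; rewrite -(subrK (\sum_(i < n) \sum_(al <- H i)
  wtensor (wslicer (c al) t) (b al)) t) (linfD lg); apply: augIpowD.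
  exact/gI/(slices_expand hb).
rewrite (linf_sum lg); apply: augIpow_sum => i _; rewrite (linf_sum lg).
by apply: augIpow_sum => al _.
Qed.

Variables (D : wmod k E -> wmod k (E * E)) (S : wmod k E -> wmod k E).
Hypothesis hH : is_wHopf A D S.
Let D_map := wHopf_comul_map hH.
Let S_map := wHopf_antip_map hH.

Lemma comul_eps x : aeps A2 (D x) = eps x.
Proof. by rewrite /= (wHopf_counitr hH). Qed.

(** D is multiplicative and respects the counits, hence sends I into I2. *)
Lemma comul_augIpow n x : I n x -> I2 n (D x).
Proof.
elim: n x => // n IH x; elim/augIpow_elim => [|u v|y z yI zI].
- by rewrite (linf0 D_map.1); apply: (augIpow_zero hA2).
- by rewrite (linfD D_map.1); apply: (augIpowD (hB := hA2)).
rewrite [D _](wHopf_comulM hH); apply: (augIpow_base (hB := hA2)); last exact: IH.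
by apply/(augIP (hB := hA2)); rewrite comul_eps; apply/(augIP (hB := hA)).
Qed.

Lemma antip_eps x : eps (S x) = eps x.
Proof.
have /(_ (D x)) : (eps \o amul A) \o wtensl S =1 (eps \o S) \o wslicer eps.
  apply: wform_tensor_ext => [||y z].
  - exact: (wform_comp (wform_comp e_form (amul_map hA)) (wmap_tensl _ S_map)).
  - exact: (wform_comp (wform_comp e_form S_map) (wmap_slicer _ e_form)).
  rewrite /= (wtensl_tensor _ _ S_map.1) [eps _](aeps_mul hA).
  rewrite (wslicer_tensor _ _ e_form.1) (linfZ S_map.1) (linfZ e_form.1).
  by rewrite fps_scaleE mulrC.
rewrite /= (wHopf_antipl hH) (wHopf_counitr hH) (linfZ e_form.1) (aeps_one hA).
by rewrite fps_scaleE mulr1.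
Qed.

(** On x (x) y this is S(x) z y. The middle slot allows nesting: G (G 1 s) t yields S(y_1) S(x_1)
    x_2 y_2. *)
Let G z t : F := amul A (wtensl S (wtensr (fun y : wmod k E => z * (y : F) : F) t)).

Let G_map z : wmap (G z).
Proof.
exact: (wmap_comp (amul_map hA) (wmap_comp (wmap_tensl _ S_map) (wmap_tensr _ (wmap_mull z)))).
Qed.

Let G_tens z x y : G z (tens x y) = (S x : F) * (z * y).
Proof. by rewrite /G (wtensr_tensor _ _ (wmap_mull z).1) (wtensl_tensor _ _ S_map.1). Qed.

Let G_slices z m t : slices_in A m t -> I m (G z t).
Proof.
move=> tI; apply: (slices_in_mul adic); apply: (slices_in_tensl adic) => //.
by apply: slices_in_tensr tI => y; apply: augIpowMl.
Qed.

Let G_small z m t : I m z -> I m (G z t).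
Proof.
move=> zI; apply: (slices_in_mul adic); apply: (slices_in_tensl adic) => // a.
exact: (@augIpowMr _ _ _ hA m z (fun e => t (a, e)) zI).
Qed.

Let GZ a z t : G (a *: z) t = a *: G z t.
Proof.
rewrite -[RHS](linfZ (amul_map hA).1); congr (amul A _).
rewrite -[RHS](linfZ (wmap_tensl _ S_map).1); congr (wtensl S _).
apply/funext => -[p q]; rewrite wmodZ /wtensr.
by rewrite -scalerAl.
Qed.

Let GD z z' t : G (z + z') t = G z t + G z' t.
Proof.
rewrite -[RHS](linfD (amul_map hA).1); congr (amul A _).
rewrite -[RHS](linfD (wmap_tensl _ S_map).1); congr (wtensl S _); apply/funext => -[p q].
by rewrite wmodD /wtensr mulrDl.
Qed.

Let G_comul x : G 1 (D x) = eps x *: (1 : F).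
Proof.
rewrite /G -(wHopf_antipl hH); congr (amul A (wtensl S _)).
by apply/funext => -[p q]; rewrite /wtensr mul1r.
Qed.

(* Both S(xy) and S(y)S(x) are left convolution inverses of the product; their
   difference kappa satisfies kappa * m = 0, hence lies in every I^n. *)
Lemma antipM x y : S (x * y) = (S y : F) * S x.
Proof.
pose kappa x y : F := S (x * y) - (S y : F) * S x.
have kappa_l y' : linear (kappa^~ y').
  move=> a u v; rewrite /kappa mulrDl -scalerAl S_map.1 S_map.1 mulrDr -scalerAr.
  by rewrite scalerBr opprD addrACA.
have kappa_r x' : linear (kappa x').
  move=> a u v; rewrite /kappa mulrDr -scalerAr S_map.1 S_map.1 mulrDl -scalerAl.
  by rewrite scalerBr opprD addrACA.
suff kI n : forall x y, I n (kappa x y) by apply: (augIpow_sep adic) => n; apply: kI.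
elim: n => [//|n IH] {}x {}y.
pose e : F2 -> F := wslicer eps.
have le : linear e := (wmap_slicer _ e_form).1.
(* On pure tensors L is kappa x1 y1 times x2 y2 - eps x2 eps y2, one degree better than kappa. At s
   = D x and t = D y both G-terms equal eps x eps y, and what remains is -kappa x y. *)
pose L s t : F := G 1 (s * t) - G (G 1 s) t - kappa (e s) (e t).
have L_l t : linear (L^~ t).
  move=> a u v; rewrite /L mulrDl -scalerAl (G_map 1).1 (G_map 1).1 GD GZ le.
  by rewrite kappa_l 2![in RHS]scalerBr addrBBACA.
have L_r s : linear (L s).
  move=> a u v; rewrite /L mulrDr -scalerAr (G_map 1).1 (G_map _).1 le.
  by rewrite kappa_r 2![in RHS]scalerBr addrBBACA.
have L_I s t : I n.+1 (L s t).
  move: s; apply: (slices_dvd (L_l t)) => [m s sI|x1 x2].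
    apply: augIpowB; first apply: augIpowB.
    - exact/G_slices/slices_in_sqMr.
    - exact/G_small/G_slices.
    - by apply: hdvd_augIpow; apply: (linear_hdvd (kappa_l _)); apply: slices_in_eps.
  move: t; apply: (slices_dvd (L_r _)) => [m t tI|y1 y2].
    apply: augIpowB; first apply: augIpowB.
    - exact/G_slices/slices_in_sqMl.
    - exact/G_slices.
    - by apply: hdvd_augIpow; apply: (linear_hdvd (kappa_r _)); apply: slices_in_eps.
  rewrite /L -![wtensor _ _]/(tens _ _) tensM !G_tens !mul1r /e.
  rewrite !(wslicer_tensor _ _ e_form.1) (linfZ (kappa_l _)) (linfZ (kappa_r _)).
  have -> : (S (x1 * y1) : F) * (x2 * y2) - (S y1 : F) * ((S x1 : F) * x2 * y2) -
      eps x2 *: (eps y2 *: kappa x1 y1) =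
      kappa x1 y1 * (x2 * y2 - (eps x2 * eps y2) *: 1).
    by rewrite mulrBr -scalerAr mulr1 scalerA /kappa mulrBl !mulrA.
  rewrite -addn1; apply: augIpowM; first exact: IH.
  apply/augIpow1/augI_eps0; rewrite (linfB e_form.1) epsM (linfZ e_form.1) (eps1 hA).
  by rewrite fps_scaleE mulr1 subrr.
have := L_I (D x) (D y); rewrite /L -[(D x : F2) * D y](wHopf_comulM hH) !G_comul GZ G_comul.
rewrite (aeps_mul hA) scalerA subrr sub0r /e !(wHopf_counitr hH) => /(augIpowN (hB := hA)).
by rewrite opprK.
Qed.

Lemma antip1 : S (1 : F) = (1 : F).
Proof.
have D1 : D (1 : F) = tens (1 : F) (1 : F) := wHopf_comul1 hH.
by have := G_comul 1; rewrite D1 G_tens mul1r mulr1 (eps1 hA) scale1r.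
Qed.

(** Anti-multiplicativity reduces this to S(I) in I, which is [antip_eps]. It is the condition under
    which S extends to the dual. *)
Lemma antip_augIpow n x : I n x -> I n (S x).
Proof.
elim: n x => // n IH x; elim/augIpow_elim => [|u v|y z yI zI].
- by rewrite (linf0 S_map.1); apply: (augIpow_zero hA).
- by rewrite (linfD S_map.1); apply: (augIpowD (hB := hA)).
rewrite antipM -addn1; apply: (augIpowM (hB := hA)); first exact: IH.
by apply/(augIpow1 (hB := hA))/(augIP (hB := hA)); rewrite antip_eps; apply/(augIP (hB := hA)).
Qed.

End FilHopf.

Record filtered_Hopf (k : fieldType) (E : Type) (A : augAlg k E) (hA : is_augAlg A)
    (T : eqType) (H : nat -> seq T) (b : T -> falg hA) (c : T -> wmod k E -> (fps k)^o)
    (D : wmod k E -> wmod k (E * E)) (S : wmod k E -> wmod k E) : Prop := {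
  fH_adic : is_adic hA;
  fH_basis : adapted_basis H b c;
  fH_Hopf : is_wHopf A D S
}.

Lemma bilinear_insert (k : fieldType) (M N : lmodType (fps k)) (U : algType (fps k))
    (f : M -> U) (g : N -> U) z : linear f -> linear g ->
  bilinear_fun (fun x y => f x * z * g y).
Proof.
move=> lf lg; split=> [x a y y'|y a x x'].
  by rewrite lg mulrDr scalerAr.
by rewrite lf !mulrDl -!scalerAl.
Qed.

Section LinearFun.
Variable R : comNzRingType.
Lemma linear_mull (U : algType R) (a : U) : linear (fun x : U => a * x).
Proof. by move=> d x y; rewrite mulrDr scalerAr. Qed.
Lemma linear_mulr (U : algType R) (a : U) : linear (fun x : U => x * a).
Proof. by move=> d x y; rewrite mulrDl scalerAl. Qed.
Lemma linear_comp (M N P : lmodType R) (f : M -> N) (g : N -> P) :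
  linear f -> linear g -> linear (fun x => g (f x)).
Proof. by move=> lf lg a x y; rewrite lf lg. Qed.
Lemma linear_scale (M P : lmodType R) (f : M -> P) d : linear f -> linear (fun x => d *: f x).
Proof. by move=> lf a x y; rewrite lf scalerDr !scalerA mulrC. Qed.
Lemma linear_addf (M P : lmodType R) (f g : M -> P) : linear f -> linear g ->
  linear (fun x => f x + g x).
Proof. by move=> lf lg a x y; rewrite lf lg scalerDr addrACA. Qed.
End LinearFun.

(** * The Hopf structure carried by the dual *)

Section Dual.
Variables (k : fieldType) (E : Type) (A : augAlg k E) (hA : is_augAlg A).
Local Notation K := (fps k).
Local Notation F := (falg hA).
Local Notation A2 := (augAlg_sq A).
Local Notation hA2 := (sq_is_augAlg hA).
Local Notation F2 := (falg hA2).
Local Notation I n := (augIpow A n).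
Local Notation I2 n := (augIpow A2 n).
Local Notation eps := (aeps A).
Variables (T : eqType) (H : nat -> seq T) (b : T -> F) (c : T -> wmod k E -> K^o).
Variables (D : wmod k E -> wmod k (E * E)) (S : wmod k E -> wmod k E).
Hypothesis fH : filtered_Hopf H b c D S.
Variable V : veeDual A.
Local Notation U := (vU V).
Local Notation U2 := (vU2 V).
Local Notation U3 := (vU3 V).
Local Notation j := (vee_in (viota V)).
Local Notation j2 := (vee_in (@viota2 _ _ _ V)).
Local Notation tau := (@vtau _ _ _ V).
Local Notation tau3 := (@vtau3 _ _ _ V).
Implicit Types (x y : F) (s t : F2) (u v w z : U) (p q r : U2).

Let adic := fH_adic fH.
Let hb := fH_basis fH.
Let hH := fH_Hopf fH.
Let hU := vUP V.
Let hU2 := vU2P V.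
Let ht := halgtensor_htensor (vtauP V).
Let ht3 := halgtensor_htensor (vtau3P V).
Let D_map := wHopf_comul_map hH.
Let S_map := wHopf_antip_map hH.
Let e_form := aeps_form hA.

Lemma dual_complete : hcomplete U. Proof. exact: vee_complete hU. Qed.
Lemma dual2_complete : hcomplete U2. Proof. exact: vee_complete hU2. Qed.
Lemma dual3_complete : hcomplete U3. Proof. exact: htensor_complete ht3. Qed.
Lemma dual_htfree : htfree U. Proof. exact: (vee_htfree hA hU). Qed.
Lemma dual2_htfree : htfree U2. Proof. exact: (vee_htfree hA2 hU2). Qed.
Let cU := dual_complete.
Let cU2 := dual2_complete.
Let tU := dual_htfree.
Let tU2 := dual2_htfree.

Lemma dual_in_linear : linear (j : F -> U). Proof. exact: (vj_linear hU). Qed.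
Lemma dual2_in_linear : linear (j2 : F2 -> U2). Proof. exact: (vj_linear hU2). Qed.
Let lj := dual_in_linear.
Let lj2 := dual2_in_linear.
Lemma dual_inM x y : j (x * y) = j x * j y. Proof. exact: (vjM hU). Qed.
Lemma dual2_inM s t : j2 (s * t) = j2 s * j2 t. Proof. exact: (vjM hU2). Qed.
Lemma dual_in1 : j (1 : F) = 1. Proof. exact: (vj1 hA hU). Qed.
Lemma dual2_in1 : j2 (1 : F2) = 1. Proof. exact: (vj1 hA2 hU2). Qed.
Lemma dual_in_dvd n x : I n x -> hdvd n (j x). Proof. exact: (vj_dvd hU). Qed.
Lemma dual2_in_dvd n t : I2 n t -> hdvd n (j2 t). Proof. exact: (vj_dvd hU2). Qed.
Lemma dual_in_dvdE n x : hdvd n (j x) <-> I n x. Proof. exact: (vj_dvdE hU hb). Qed.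
Lemma dual_in_inj x y : j x = j y -> x = y. Proof. exact: (vj_inj hU hb adic). Qed.
Lemma dual_in_tens x y : j2 (tens x y) = tau (j x) (j y). Proof. exact: vtau_in. Qed.

Lemma tau_bilinear : bilinear_fun tau. Proof. exact: (htensor_bilinear ht). Qed.
Lemma tau3_bilinear : bilinear_fun tau3. Proof. exact: (htensor_bilinear ht3). Qed.
Lemma tau_mul u v u' v' : tau u v * tau u' v' = tau (u * u') (v * v').
Proof. exact: (halgtensor_mul (vtauP V)). Qed.
Lemma tau3_mul p u q v : tau3 p u * tau3 q v = tau3 (p * q) (u * v).
Proof. exact: (halgtensor_mul (vtau3P V)). Qed.
Lemma tau_one : tau 1 1 = 1. Proof. exact: (halgtensor_one (vtauP V)). Qed.
Lemma tau3_one : tau3 1 1 = 1. Proof. exact: (halgtensor_one (vtau3P V)). Qed.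

Lemma dual_ext (P : lmodType K) (g g' : U -> P) : hcomplete P -> htfree P ->
  linear g -> linear g' -> (forall x, g (j x) = g' (j x)) -> g =1 g'.
Proof. by move=> cP tP lg lg'; apply: (vee_ext_unique (hA := hA) hU). Qed.

Lemma tau_ext (P : lmodType K) (g g' : U2 -> P) : hcomplete P ->
  linear g -> linear g' -> (forall u v, g (tau u v) = g' (tau u v)) -> g =1 g'.
Proof. by move=> cP lg lg'; apply: (htensor_ext ht cP). Qed.

Lemma vee_extP (P : lmodType K) (f : wmod k E -> P) : hcomplete P -> htfree P ->
  linear f -> (forall n x, I n x -> hdvd n (f x)) ->
  linear (@vee_ext _ _ _ V _ f) /\ forall x, vee_ext f (j x) = f x.
Proof.
move=> cP tP lf fI; apply: (@xgetPex _ (fun=> 0)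
  [set g : U -> P | linear g /\ forall x, g (j x) = f x]%classic).
exact: (vee_ext_exists hU cP tP hb lf fI).
Qed.

Let comulP : linear (@vcomul _ _ _ D V) /\ forall x, vcomul D (j x) = j2 (D x).
Proof.
apply: vee_extP => // [a x y|n x xI]; first by rewrite D_map.1 [LHS]lj2.
by apply: dual2_in_dvd; apply: (comul_augIpow (hA := hA) hH).
Qed.
Lemma vcomul_linear : linear (@vcomul _ _ _ D V). Proof. exact: comulP.1. Qed.
Lemma vcomulE x : vcomul D (j x) = j2 (D x). Proof. exact: comulP.2. Qed.

Let counitP : linear (@vcounit _ _ _ V) /\ forall x, vcounit (j x) = eps x.
Proof.
apply: vee_extP => //.
- exact: fps_hcomplete.
- exact: fps_htfree.
- exact: e_form.1.
- by move=> n x; apply: eps_augIpow.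
Qed.
Lemma vcounit_linear : linear (@vcounit _ _ _ V). Proof. exact: counitP.1. Qed.
Lemma vcounitE x : vcounit (j x) = eps x. Proof. exact: counitP.2. Qed.

Let antipP : linear (@vantip _ _ _ S V) /\ forall x, vantip S (j x) = j (S x).
Proof.
apply: vee_extP => // [a x y|n x xI]; first by rewrite S_map.1 [LHS]lj.
by apply: dual_in_dvd; apply: (antip_augIpow adic hb hH).
Qed.
Lemma vantip_linear : linear (@vantip _ _ _ S V). Proof. exact: antipP.1. Qed.
Lemma vantipE x : vantip S (j x) = j (S x). Proof. exact: antipP.2. Qed.
Let lD := vcomul_linear.
Let le := vcounit_linear.
Let lS := vantip_linear.

Lemma vcomulM u v : vcomul D (u * v) = vcomul D u * vcomul D v :> U2.
Proof.
move: u; apply: (dual_ext cU2 tU2) => [||x].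
- exact: linear_comp (linear_mulr v) lD.
- exact: linear_comp lD (linear_mulr _).
move: v; apply: (dual_ext cU2 tU2) => [||y].
- exact: linear_comp (linear_mull _) lD.
- exact: linear_comp lD (linear_mull _).
rewrite -dual_inM !vcomulE -dual2_inM; congr j2.
exact: (wHopf_comulM hH).
Qed.

Lemma vcomul1 : vcomul D (1 : U) = 1.
Proof. by rewrite -dual_in1 vcomulE -dual2_in1; congr j2; apply: (wHopf_comul1 hH). Qed.

Lemma vcounitM u v : vcounit (u * v) = vcounit u * vcounit v.
Proof.
have cK := fps_hcomplete k; have tK := @fps_htfree k.
move: u; apply: (dual_ext cK tK) => [|a u u'|x].
- exact: linear_comp (linear_mulr v) le.
- by rewrite le mulrDl scalerAl.
move: v; apply: (dual_ext cK tK) => [|a v v'|y].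
- exact: linear_comp (linear_mull _) le.
- by rewrite le mulrDr scalerAr.
by rewrite -dual_inM !vcounitE epsM.
Qed.

Lemma vcounit1 : vcounit (1 : U) = 1.
Proof. by rewrite -dual_in1 vcounitE (eps1 hA). Qed.

Lemma vantipM u v : vantip S (u * v) = vantip S v * vantip S u.
Proof.
move: u; apply: (dual_ext cU tU) => [||x].
- exact: linear_comp (linear_mulr v) lS.
- exact: linear_comp lS (linear_mull _).
move: v; apply: (dual_ext cU tU) => [||y].
- exact: linear_comp (linear_mull _) lS.
- exact: linear_comp lS (linear_mulr _).
by rewrite -dual_inM !vantipE -dual_inM (antipM adic hb hH).
Qed.

Lemma vantip1 : vantip S (1 : U) = 1.
Proof. by rewrite -dual_in1 vantipE (antip1 hA hH). Qed.

Let counitl_bil : bilinear_fun (fun u v => vcounit u *: v).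
Proof.
by split=> [u a v w|v a u w]; [rewrite scalerDr !scalerA mulrC|rewrite le scalerDl scalerA].
Qed.
Let counitr_bil : bilinear_fun (fun u v => vcounit v *: u).
Proof.
by split=> [u a v w|v a u w]; [rewrite le scalerDl scalerA|rewrite scalerDr !scalerA mulrC].
Qed.
Lemma vcounitl_linear : linear (@vcounitl _ _ _ V).
Proof. exact: (hlift_linear ht cU counitl_bil). Qed.
Lemma vcounitr_linear : linear (@vcounitr _ _ _ V).
Proof. exact: (hlift_linear ht cU counitr_bil). Qed.
Lemma vcounitlE u v : vcounitl (tau u v) = vcounit u *: v.
Proof. exact: (hliftE ht cU counitl_bil). Qed.
Lemma vcounitrE u v : vcounitr (tau u v) = vcounit v *: u.
Proof. exact: (hliftE ht cU counitr_bil). Qed.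

Lemma vcounitlM p q : vcounitl (p * q) = vcounitl p * vcounitl q.
Proof.
move: p; apply: (tau_ext cU) => [||u v].
- exact: linear_comp (linear_mulr q) vcounitl_linear.
- exact: linear_comp vcounitl_linear (linear_mulr _).
move: q; apply: (tau_ext cU) => [||u' v'].
- exact: linear_comp (linear_mull _) vcounitl_linear.
- exact: linear_comp vcounitl_linear (linear_mull _).
by rewrite tau_mul !vcounitlE vcounitM -scalerAl -scalerAr scalerA.
Qed.

Lemma vcounitrM p q : vcounitr (p * q) = vcounitr p * vcounitr q.
Proof.
move: p; apply: (tau_ext cU) => [||u v].
- exact: linear_comp (linear_mulr q) vcounitr_linear.
- exact: linear_comp vcounitr_linear (linear_mulr _).
move: q; apply: (tau_ext cU) => [||u' v'].
- exact: linear_comp (linear_mull _) vcounitr_linear.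
- exact: linear_comp vcounitr_linear (linear_mull _).
by rewrite tau_mul !vcounitrE vcounitM -scalerAl -scalerAr scalerA.
Qed.

Lemma vcounitl1 : vcounitl (1 : U2) = 1.
Proof. by rewrite -tau_one vcounitlE vcounit1 scale1r. Qed.
Lemma vcounitr1 : vcounitr (1 : U2) = 1.
Proof. by rewrite -tau_one vcounitrE vcounit1 scale1r. Qed.

Lemma tcont_comp (X : Type) (M P : lmodType K) (f : wmod k (X * E) -> M) (g : M -> P) :
  tcont A f -> linear g -> tcont A (fun t : wmod k (X * E) => g (f t)).
Proof.
move=> [lf cf] lg; split; first exact: linear_comp lf lg.
by move=> m; have [N NP] := cf m; exists N => t /NP; apply: linear_hdvd.
Qed.

Lemma tcont_in (X : Type) (f : wmod k (X * E) -> F) : linear f ->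
  (forall m (t : wmod k (X * E)), slices_in A m t -> I m (f t)) -> tcont A (fun t : wmod k (X * E) => j (f t)).
Proof.
move=> lf fI; split; first exact: linear_comp lf lj.
by move=> m; exists m => t /fI; apply: dual_in_dvd.
Qed.

(** The bridge from F2 to U2: [vtau_in] describes j2 on pure tensors, and this continuity lets
    [tcont_ext] identify composites with j2 on all of F2. *)
Lemma tcont_in2 : tcont A (j2 : wmod k (E * E) -> U2).
Proof.
split; first exact: lj2.
by move=> m; exists m => t tI; apply/dual2_in_dvd/(slices_in_augIpow adic).
Qed.

Lemma vcounitl_in t : vcounitl (j2 t) = j (wslicel eps t).
Proof.
move: t; apply: (tcont_ext hb cU) => [||x y].
- exact: tcont_comp tcont_in2 vcounitl_linear.
- apply: tcont_in; first exact: (wmap_slicel _ e_form).1.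
  by move=> m t; apply: (slices_in_slicel adic).
rewrite [j2 _]dual_in_tens vcounitlE vcounitE (wslicel_tensor _ _ e_form.1).
by rewrite [RHS](linfZ lj).
Qed.

Lemma vcounitr_in t : vcounitr (j2 t) = j (wslicer eps t).
Proof.
move: t; apply: (tcont_ext hb cU) => [||x y].
- exact: tcont_comp tcont_in2 vcounitr_linear.
- apply: tcont_in; first exact: (wmap_slicer _ e_form).1.
  by move=> m t /(slices_in_eps hA) /hdvd_augIpow; apply.
rewrite [j2 _]dual_in_tens vcounitrE vcounitE (wslicer_tensor _ _ e_form.1).
by rewrite [RHS](linfZ lj).
Qed.

(** With the slot z, [antl] and [antr] become a right and a left action of U2 on U, by
    anti-multiplicativity of S; at z = 1 they are m (S (x) id) and m (id (x) S). *)
Definition antl z : U2 -> U := hlift tau (fun u v => vantip S u * z * v).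
Definition antr z : U2 -> U := hlift tau (fun u v => u * z * vantip S v).

Let antl_bil z : bilinear_fun (fun u v => vantip S u * z * v).
Proof. exact: (bilinear_insert (g := id)). Qed.
Let antr_bil z : bilinear_fun (fun u v => u * z * vantip S v).
Proof. exact: (bilinear_insert (f := id)). Qed.
Lemma antl_linear z : linear (antl z). Proof. exact: (hlift_linear ht cU (antl_bil z)). Qed.
Lemma antr_linear z : linear (antr z). Proof. exact: (hlift_linear ht cU (antr_bil z)). Qed.
Lemma antlE z u v : antl z (tau u v) = vantip S u * z * v.
Proof. exact: (hliftE ht cU (antl_bil z)). Qed.
Lemma antrE z u v : antr z (tau u v) = u * z * vantip S v.
Proof. exact: (hliftE ht cU (antr_bil z)). Qed.

Lemma antlZ d z p : antl (d *: z) p = d *: antl z p.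
Proof.
move: p; apply: (tau_ext cU) => [||u v]; first exact: antl_linear.
  exact: linear_scale (antl_linear z).
by rewrite !antlE -scalerAr -scalerAl.
Qed.

Lemma antrZ d z p : antr (d *: z) p = d *: antr z p.
Proof.
move: p; apply: (tau_ext cU) => [||u v]; first exact: antr_linear.
  exact: linear_scale (antr_linear z).
by rewrite !antrE -scalerAr -scalerAl.
Qed.

Lemma antl_mul z p q : antl z (p * q) = antl (antl z p) q.
Proof.
move: q; apply: (tau_ext cU) => [||u v].
- exact: linear_comp (linear_mull _) (antl_linear z).
- exact: antl_linear.
move: p; apply: (tau_ext cU) => [||u' v'].
- exact: linear_comp (linear_mulr _) (antl_linear z).
- under eq_fun do rewrite antlE.
  exact: linear_comp (linear_comp (antl_linear z) (linear_mull _)) (linear_mulr _).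
by rewrite tau_mul !antlE vantipM !mulrA.
Qed.

Lemma antr_mul z p q : antr z (p * q) = antr (antr z q) p.
Proof.
move: p; apply: (tau_ext cU) => [||u v].
- exact: linear_comp (linear_mulr _) (antr_linear z).
- exact: antr_linear.
move: q; apply: (tau_ext cU) => [||u' v'].
- exact: linear_comp (linear_mull _) (antr_linear z).
- under eq_fun do rewrite antrE.
  exact: linear_comp (linear_comp (antr_linear z) (linear_mull _)) (linear_mulr _).
by rewrite tau_mul !antrE vantipM !mulrA.
Qed.

Lemma antl1 z : antl z 1 = z.
Proof. by rewrite -tau_one antlE vantip1 mul1r mulr1. Qed.
Lemma antr1 z : antr z 1 = z.
Proof. by rewrite -tau_one antrE vantip1 mul1r mulr1. Qed.

Lemma antl_in t : antl 1 (j2 t) = j (amul A (wtensl S t)).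
Proof.
move: t; apply: (tcont_ext hb cU) => [||x y].
- exact: tcont_comp tcont_in2 (antl_linear 1).
- apply: tcont_in; first exact: (wmap_comp (amul_map hA) (wmap_tensl _ S_map)).1.
  by move=> m t tI; apply: (slices_in_mul adic); apply: (slices_in_tensl adic).
rewrite [j2 _]dual_in_tens antlE mulr1 vantipE (wtensl_tensor _ _ S_map.1).
by rewrite -dual_inM.
Qed.

Lemma antr_in t : antr 1 (j2 t) = j (amul A (wtensr S t)).
Proof.
move: t; apply: (tcont_ext hb cU) => [||x y].
- exact: tcont_comp tcont_in2 (antr_linear 1).
- apply: tcont_in; first exact: (wmap_comp (amul_map hA) (wmap_tensr _ S_map)).1.
  move=> m t tI; apply: (slices_in_mul adic); apply: slices_in_tensr tI.
  exact: (antip_augIpow adic hb hH).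
rewrite [j2 _]dual_in_tens antrE mulr1 vantipE (wtensr_tensor _ _ S_map.1).
by rewrite -dual_inM.
Qed.

Lemma antl_comul u : antl 1 (vcomul D u) = vcounit u *: 1.
Proof.
move: u; apply: (dual_ext cU tU) => [|a u v|x].
- exact: linear_comp lD (antl_linear 1).
- by rewrite le scalerDl scalerA.
rewrite vcomulE antl_in (wHopf_antipl hH) vcounitE -dual_in1.
exact: (linfZ lj).
Qed.

Lemma antr_comul u : antr 1 (vcomul D u) = vcounit u *: 1.
Proof.
move: u; apply: (dual_ext cU tU) => [|a u v|x].
- exact: linear_comp lD (antr_linear 1).
- by rewrite le scalerDl scalerA.
rewrite vcomulE antr_in (wHopf_antipr hH) vcounitE -dual_in1.
exact: (linfZ lj).
Qed.

End Dual.

(** * Descent of identities from tensor powers of U to tensor powers of F *)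

Section DualEmbedding.
Variables (k : fieldType) (E : Type) (A : augAlg k E) (hA : is_augAlg A).
Local Notation K := (fps k).
Local Notation F := (falg hA).
Local Notation A2 := (augAlg_sq A).
Local Notation hA2 := (sq_is_augAlg hA).
Local Notation F2 := (falg hA2).
Local Notation I n := (augIpow A n).
Local Notation I2 n := (augIpow A2 n).
Variables (T : eqType) (H : nat -> seq T) (b : T -> F) (c : T -> wmod k E -> K^o).
Variables (D : wmod k E -> wmod k (E * E)) (S : wmod k E -> wmod k E).
Hypothesis fH : filtered_Hopf H b c D S.
Variable V : veeDual A.
Local Notation U := (vU V).
Local Notation U2 := (vU2 V).
Local Notation U3 := (vU3 V).
Local Notation j := (vee_in (viota V)).
Local Notation j2 := (vee_in (@viota2 _ _ _ V)).
Local Notation tau := (@vtau _ _ _ V).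
Local Notation tau3 := (@vtau3 _ _ _ V).
Implicit Types (x y : F) (s t : F2) (u v w z : U) (p q r : U2).

Let adic := fH_adic fH.
Let hb := fH_basis fH.
Let ht := halgtensor_htensor (vtauP V).
Let ht3 := halgtensor_htensor (vtau3P V).
Let cU := dual_complete V.
Let cU2 := dual2_complete V.
Let cU3 := dual3_complete V.
Let lj := dual_in_linear (hA := hA) V.
Let lj2 := dual2_in_linear (hA := hA) V.
Let btau := tau_bilinear V.
Let btau3 := tau3_bilinear V.

Let vput_bil u : bilinear_fun (fun v w => tau3 (tau u v) w).
Proof.
split=> [v|w]; first exact: (btau3.1 _).
exact: linear_comp (btau.1 u) (btau3.2 w).
Qed.

Lemma vput_linear u : linear (vput u : U2 -> U3).
Proof. exact: (hlift_linear ht cU3 (vput_bil u)). Qed.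
Lemma vputE u v w : vput u (tau v w) = tau3 (tau u v) w.
Proof. exact: (hliftE ht cU3 (vput_bil u)). Qed.

Lemma vput_linearl p : linear (fun u => vput u p : U3).
Proof.
move=> a u v; move: p; apply: (tau_ext cU3) => [||w z].
- exact: vput_linear.
- exact: linear_addf (linear_scale a (vput_linear u)) (vput_linear v).
by rewrite !vputE (btau.2 w) (btau3.2 z).
Qed.

Lemma coords_eq0 (X : Type) (t : wmod k (X * E)) :
  (forall d al, al \in H d -> hbar ^+ d *: wslicer (c al) t = 0) -> t = 0.
Proof.
move=> ct; apply/funext => -[a e].
suff /(congr1 (fun z : wmod k E => z e)) : (fun e => t (a, e)) = (0 : F) by [].
apply: (augIpow_sep adic) => m; rewrite subr0; apply: (augIpow_coord hb) => i al alH.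
have /(congr1 (fun z : wmod k X => z a)) := ct _ _ alH.
by rewrite wmodZ /wslicer fps_scaleE => ->; apply: hdvd0.
Qed.

(** On I^p the coordinate [c al] may lose d powers of hbar, so it is hbar^d [c al] that satisfies
    the extension condition. *)
Let coord_ext d al : al \in H d ->
  exists theta : U -> K^o, linear theta /\ forall x, theta (j x) = hbar ^+ d *: c al x.
Proof.
move=> alH; have [|n x xI|lt tE] := vee_extP fH V (fps_hcomplete k) (@fps_htfree k)
  (f := fun x => hbar ^+ d *: c al x).
- exact: linear_scale (ab_linear hb al).
- exact: (ab_coord hb alH xI).
by exists (vee_ext (fun x => hbar ^+ d *: c al x)).
Qed.

Let tcont_coord (X : Type) (M : lmodType K) (f : wmod k X -> M) d al : al \in H d ->
  linear f -> tcont A (fun t : wmod k (X * E) => f (hbar ^+ d *: wslicer (c al) t)).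
Proof.
move=> alH lf; split=> [a s t|m].
  rewrite -lf; congr f; rewrite scalerA mulrC -scalerA -scalerDr; congr (_ *: _).
  by apply/funext => x; rewrite /wslicer -[RHS](ab_linear hb al).
exists m => t tI; apply: (linear_hdvd lf); apply/hdvd_wmodP => x.
exact: (ab_coord hb alH (tI x)).
Qed.

Let scale_bil (M : lmodType K) (theta : U -> K^o) : linear theta ->
  bilinear_fun (fun (p : M) u => theta u *: p).
Proof.
move=> lt; split=> [p a u v|u a p q]; first by rewrite lt scalerDl scalerA.
by rewrite scalerDr !scalerA mulrC.
Qed.

(** Contracting the second leg with the functionals theta turns j2 into j of a coordinate slice,
    which reduces the claim to injectivity of j and avoids an adapted basis of F2. *)
Lemma dual2_in_inj s t : j2 s = j2 t -> s = t.
Proof.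
move=> st; apply/eqP; rewrite -subr_eq0; apply/eqP/coords_eq0 => d al alH.
have [theta [lt tE]] := coord_ext alH.
have bil := scale_bil U lt.
apply: (dual_in_inj fH (V := V)).
have H2 : forall r : wmod k (E * E), hlift tau (fun u v => theta v *: u) (j2 r) =
    j (hbar ^+ d *: wslicer (c al) r).
  apply: (tcont_ext hb cU) => [||x y].
  - exact: (tcont_comp (tcont_in2 fH V) (hlift_linear ht cU bil)).
  - exact: tcont_coord alH lj.
  rewrite [j2 _](dual_in_tens V (hA := hA)) (hliftE ht cU bil) tE.
  by rewrite (wslicer_tensor _ _ (ab_linear hb al)) -(linfZ lj) scalerA.
by rewrite -H2 (linfB lj2) st subrr (linf0 lj) (linf0 (hlift_linear ht cU bil)).
Qed.

Definition wassoc (X Y Z : Type) (t : wmod k (X * (Y * Z))) : wmod k ((X * Y) * Z) :=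
  fun o => t (o.1.1, (o.1.2, o.2)).

Section Embed3.
Variable j3 : wmod k ((E * E) * E) -> U3.
Hypotheses (lj3 : linear j3)
  (j3E : forall (s : F2) x, j3 (wtensor s x) = tau3 (j2 s) (j x))
  (j3_dvd : forall m (t : wmod k ((E * E) * E)), slices_in A m t -> hdvd m (j3 t)).

Let tc3 : tcont A j3.
Proof. by split=> // m; exists m => t; apply: j3_dvd. Qed.

Let j3_inj (t : wmod k ((E * E) * E)) : j3 t = 0 -> t = 0.
Proof.
move=> t0; apply: coords_eq0 => d al alH.
have [theta [lt tE]] := coord_ext alH.
have bil := scale_bil U2 lt.
apply: dual2_in_inj.
have H3 : forall r : wmod k ((E * E) * E), hlift tau3 (fun p u => theta u *: p) (j3 r) =
    j2 (hbar ^+ d *: wslicer (c al) r).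
  apply: (tcont_ext hb cU2) => [||x y].
  - exact: (tcont_comp tc3 (hlift_linear ht3 cU2 bil)).
  - exact: tcont_coord alH lj2.
  rewrite j3E (hliftE ht3 cU2 bil) tE.
  by rewrite (wslicer_tensor _ _ (ab_linear hb al)) -(linfZ lj2) scalerA.
by rewrite -H3 t0 (linf0 (hlift_linear ht3 cU2 bil)) (linf0 lj2).
Qed.

Let j3M (s : F2) (t : wmod k ((E * E) * E)) : j3 (wtensl (fun r : wmod k (E * E) => s * (r : F2) : F2) t) =
  tau3 (j2 s) 1 * j3 t.
Proof.
have sm : wmap (fun r : wmod k (E * E) => s * (r : F2) : F2) by apply: wmap_mull.
move: t; apply: (tcont_ext hb cU3) => [||r x].
- split; first exact: linear_comp (wmap_tensl _ sm).1 lj3.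
  by move=> m; exists m => t tI; apply: j3_dvd; apply: (slices_in_tensl adic).
- exact: (tcont_comp tc3 (linear_mull _)).
by rewrite (wtensl_tensor _ _ sm.1) !j3E tau3_mul mul1r dual2_inM.
Qed.

Let j3_put x s : vput (j x) (j2 s) = j3 (wassoc (wtensor x s)).
Proof.
move: s; apply: (tcont_ext hb cU3) => [||y z].
- exact: (tcont_comp (tcont_in2 fH V) (vput_linear _)).
- split=> [a s t|m].
    rewrite -lj3; congr j3; apply/funext => p.
    by rewrite /wassoc /wtensor /= wmodD !wmodZ mulrDr mulrCA.
  exists m => t tI; apply: j3_dvd => -[e e'].
  exact: (@augIpowZ _ _ _ hA m (x e) (fun e => t (e', e)) (tI e')).
rewrite [j2 _](dual_in_tens V (hA := hA)) vputE -dual_in_tens -j3E; congr j3.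
by apply/funext => p; rewrite /wassoc /wtensor /= mulrA.
Qed.

Variables (D0 : wmod k E -> wmod k (E * E)) (Delta : U -> U2) (L R : U2 -> U3).
Hypotheses (D0_map : wmap D0) (D0_I : forall n x, I n x -> I2 n (D0 x))
  (DeltaE : forall x, Delta (j x) = j2 (D0 x))
  (lL : linear L) (lR : linear R)
  (LE : forall u v, L (tau u v) = tau3 (Delta u) v)
  (RE : forall u v, R (tau u v) = vput u (Delta v)).

Let L_in t : L (j2 t) = j3 (wtensl D0 t).
Proof.
move: t; apply: (tcont_ext hb cU3) => [||x y].
- exact: (tcont_comp (tcont_in2 fH V) lL).
- split; first exact: linear_comp (wmap_tensl _ D0_map).1 lj3.
  by move=> m; exists m => t tI; apply: j3_dvd; apply: (slices_in_tensl adic).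
by rewrite [j2 _](dual_in_tens V (hA := hA)) LE DeltaE (wtensl_tensor _ _ D0_map.1) j3E.
Qed.

(** Smallness in the last two legs jointly must be turned into smallness in one leg. The part u is
    small in the third leg. For v, small in the second, a finite family 1 (x) w_i is pulled out as a
    left factor, and j3 turns it into an element divisible by hbar^m. *)
Let j3_middle m (t : wmod k (E * (E * E))) :
  (forall a, I2 (m + m) (fun o => t (a, o))) -> hdvd m (j3 (wassoc t)).
Proof.
move=> tI.
have /choice[u /choice[v uvP]] : forall a, exists u v : F2,
    [/\ (fun o => t (a, o)) = u + v, slices_in A m u & slices_in A m.+1 (wflip v)].
  by move=> a; apply: (sq_augIpow_split adic _ (tI a)); rewrite addnS.
pose v' : wmod k ((E * E) * E) := fun o => v o.1.1 (o.2, o.1.2).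
have v'I : slices_in A m v'.
  by move=> [a e]; have [_ _ /(_ e)] := uvP a; apply: (augIpowS (hB := hA)).
have [J [w [wI wP]]] := slices_in_fgl adic (E * E)%type m.
have [f fE] := wP v' v'I.
have -> : wassoc t = (fun o => u o.1.1 (o.1.2, o.2)) + \sum_i wtensl
    (fun r : wmod k (E * E) => tens 1 (w i) * (r : F2) : F2)
    (fun o => f i ((o.1.1, o.2), o.1.2)).
  apply/funext => -[[a e] e']; rewrite wmodD wmod_sum /wassoc /=.
  have [tE _ _] := uvP a.
  have /(congr1 (fun r : wmod k (E * E) => r (e, e'))) /= -> := tE.
  rewrite wmodD; congr (_ + _).
  have /(congr1 (fun r : wmod k ((E * E) * E) => r ((a, e'), e))) := fE.
  rewrite {1}/v' /= => ->; rewrite wmod_sum; apply: eq_bigr => i _.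
  by rewrite /wtensl tens1M.
rewrite (linfD lj3) (linf_sum lj3); apply: hdvdD.
  by apply: j3_dvd => -[a e]; have [_ /(_ e)] := uvP a.
apply: hdvd_sum => i _; rewrite j3M; apply: (linear_hdvd (linear_mulr _)).
apply: (linear_hdvd (btau3.2 _)); apply: dual2_in_dvd.
exact: sq_augIpow_tensr.
Qed.

Let R_in t : R (j2 t) = j3 (wassoc (wtensr D0 t)).
Proof.
move: t; apply: (tcont_ext hb cU3) => [||x y].
- exact: (tcont_comp (tcont_in2 fH V) lR).
- split=> [a s t|m].
    by rewrite (wmap_tensr _ D0_map).1 [LHS]lj3.
  by exists (m + m)%N => t tI; apply: j3_middle => a; apply: D0_I (tI a).
rewrite [j2 _](dual_in_tens V (hA := hA)) RE DeltaE (wtensr_tensor _ _ D0_map.1).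
exact: j3_put.
Qed.

Lemma coassoc_embed t : L (j2 t) = R (j2 t) <-> wtensl D0 t = wassoc (wtensr D0 t).
Proof.
rewrite L_in R_in; split=> [tE|->//].
by apply/eqP; rewrite -subr_eq0; apply/eqP/j3_inj; rewrite (linfB lj3) tE subrr.
Qed.

End Embed3.

(** [veeDual] carries no map from the tensor cube of F to U3; [tensor_extension] builds it from (s,
    x) |-> j2 s (x) j x. The equivalence serves both ways: coassociativity of D goes up to U, that
    of the twisted coproduct comes down to F. *)
Lemma coassoc_transfer (D0 : wmod k E -> wmod k (E * E)) (Delta : U -> U2) (L R : U2 -> U3) :
  wmap D0 -> (forall n x, I n x -> I2 n (D0 x)) ->
  (forall x, Delta (j x) = j2 (D0 x)) -> linear L -> linear R ->
  (forall u v, L (tau u v) = tau3 (Delta u) v) ->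
  (forall u v, R (tau u v) = vput u (Delta v)) ->
  forall t, L (j2 t) = R (j2 t) <-> wtensl D0 t = wassoc (wtensr D0 t).
Proof.
have bil : bilinear_fun (fun s x => tau3 (j2 s) (j x)).
  split=> [s|x]; first exact: linear_comp lj (btau3.1 _).
  exact: linear_comp lj2 (btau3.2 _).
have [|j3 [lj3 j3E j3_dvd]] := tensor_extension hb cU3 bil.
  move=> m s x xI; apply: (linear_hdvd (btau3.1 _)); exact: dual_in_dvd xI.
by move=> D0_map D0_I DeltaE lL lR LE RE t; apply: (coassoc_embed lj3 j3E j3_dvd D0_map D0_I DeltaE).
Qed.

End DualEmbedding.

(** * Polar twists *)

Section ExpAd.
Variables (k : fieldType) (hk : [pchar k] =i pred0) (R : algType (fps k)).
Variables (x y : R) (ad : nat -> R).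
Hypotheses (ad0 : ad 0%N = y) (adS : forall i, x * ad i - ad i * x = ad i.+1).
Local Notation divfact n z := (fps_const (n`!%:R^-1 : k) *: z).

Let natr_neq0 n : (n.+1%:R : k) != 0.
Proof. by move/pcharf0P: hk => ->. Qed.

Lemma divfactS n (z : R) : divfact n.+1 z *+ n.+1 = divfact n z.
Proof.
rewrite -scaler_nat scalerA -(rmorph_nat (@fps_const k)) -rmorphM factS natrM invfM.
by rewrite mulrA divff // mul1r.
Qed.

Let mulrn_inj n (z z' : R) : z *+ n.+1 = z' *+ n.+1 -> z = z'.
Proof.
rewrite -!scaler_nat -!(rmorph_nat (@fps_const k)).
move/(congr1 (fun z => fps_const (n.+1%:R^-1) *: z)).
by rewrite !scalerA -!rmorphM mulVf // !rmorph1 !scale1r.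
Qed.

(* The degree n part of exp(x) y = exp(ad x)(y) exp(x). *)
Lemma exp_ad n : divfact n (x ^+ n) * y =
  \sum_(i < n.+1) divfact i (ad i) * divfact (n - i) (x ^+ (n - i)).
Proof.
elim: n => [|n IH].
  by rewrite big_ord1 subnn fact0 invr1 rmorph1 !scale1r expr0 mul1r mulr1 ad0.
(* Both sides are multiplied by n + 1, which characteristic 0 permits. The recursions for a and d
   then give the term of index i the weights i and n + 1 - i, whose sum is n + 1. *)
apply: (@mulrn_inj n); pose a i := divfact i (x ^+ i); pose d i := divfact i (ad i).
have aS i : a i.+1 *+ i.+1 = x * a i by rewrite divfactS exprS scalerAr.
have dS i : x * d i = d i.+1 *+ i.+1 + d i * x.
  by rewrite divfactS -adS -scalerAr -scalerAl -scalerDr subrK.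
rewrite -mulrnAl -/(a n.+1) aS -mulrA {}IH mulr_sumr -sumrMnl.
rewrite -[LHS]/(\sum_(i < n.+1) x * (d i * a (n - i)%N)).
transitivity (\sum_(i < n.+1) (d i.+1 * a (n - i)%N) *+ i.+1 +
  \sum_(i < n.+1) (d i * a (n.+1 - i)%N) *+ (n.+1 - i)).
  rewrite -big_split; apply: eq_bigr => i _ /=.
  rewrite mulrA dS mulrDl mulrnAl -mulrA -aS subSn -1?ltnS // mulrnAr.
  by [].
transitivity (\sum_(i < n.+2) (d i * a (n.+1 - i)%N) *+ i +
  \sum_(i < n.+2) (d i * a (n.+1 - i)%N) *+ (n.+1 - i)).
  congr (_ + _); first by rewrite [RHS]big_ord_recl mulr0n add0r.
  by rewrite [RHS]big_ord_recr /= subnn mulr0n addr0.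
rewrite -big_split; apply: eq_bigr => i _ /=.
by rewrite -mulrnDr subnKC // -ltnS.
Qed.

End ExpAd.

Lemma alg_hdvdM (k : fieldType) (R : algType (fps k)) m n (a a' : R) :
  hdvd m a -> hdvd n a' -> hdvd (m + n) (a * a').
Proof.
by move=> [d ->] [d' ->]; exists (d * d'); rewrite -scalerAl -scalerAr scalerA exprD.
Qed.

Lemma sum_triangle (M : nmodType) (G : nat -> nat -> M) N :
  \sum_(n < N) \sum_(i < n.+1) G i (n - i)%N = \sum_(i < N) \sum_(l < N - i) G i l.
Proof.
elim: N => [|N IH]; first by rewrite !big_ord0.
rewrite big_ord_recr IH /= [RHS]big_ord_recr /= subSnn big_ord1.
rewrite [X in _ + X = _]big_ord_recr /= subnn addrA; congr (_ + _).
rewrite -big_split; apply: eq_bigr => i _ /=.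
by rewrite subSn ?(ltnW (ltn_ord i)) // big_ord_recr.
Qed.

(** * Conjugation by a polar twist preserves F2 *)

Section PolarTwist.
Variables (k : fieldType) (E : Type) (A : augAlg k E) (hA : is_augAlg A).
Local Notation K := (fps k).
Local Notation F := (falg hA).
Local Notation A2 := (augAlg_sq A).
Local Notation hA2 := (sq_is_augAlg hA).
Local Notation F2 := (falg hA2).
Local Notation I n := (augIpow A n).
Local Notation I2 n := (augIpow A2 n).
Local Notation eps := (aeps A).
Variables (T : eqType) (H : nat -> seq T) (b : T -> F) (c : T -> wmod k E -> K^o).
Variables (D : wmod k E -> wmod k (E * E)) (S : wmod k E -> wmod k E).
Hypothesis fH : filtered_Hopf H b c D S.
Variable V : veeDual A.
Local Notation U := (vU V).
Local Notation U2 := (vU2 V).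
Local Notation U3 := (vU3 V).
Local Notation j := (vee_in (viota V)).
Local Notation j2 := (vee_in (@viota2 _ _ _ V)).
Local Notation tau := (@vtau _ _ _ V).
Local Notation tau3 := (@vtau3 _ _ _ V).
Implicit Types (x y : F) (s t : F2) (u v w z : U) (p q r : U2).

Let adic := fH_adic fH.
Let hb := fH_basis fH.
Let hH := fH_Hopf fH.
Let adic2 := sq_adic adic.
Let D_map := wHopf_comul_map hH.
Let e_form := aeps_form hA.
Let ht := halgtensor_htensor (vtauP V).
Let ht3 := halgtensor_htensor (vtau3P V).
Let cU := dual_complete V.
Let cU2 := dual2_complete V.
Let cU3 := dual3_complete V.
Let tU2 := @dual2_htfree _ _ _ hA V.
Let lj := dual_in_linear (hA := hA) V.
Let lj2 := dual2_in_linear (hA := hA) V.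
Let btau3 := tau3_bilinear V.
Let lD := @vcomul_linear _ _ _ _ _ _ _ _ _ _ fH V.

Section Twisting.
Hypothesis hk : [pchar k] =i pred0.
Variables (phi : wmod k (E * E)) (Tw Twi : U2).
Hypothesis hphi : is_polar_twist D phi Tw Twi.
Let tw := polar_twist hphi.

(** The right counit condition gives phi = sum_i (1 (x) w_i) f_i with w_i in I. By the left one, 1
    (x) (eps (x) id)(phi) = 0 may be subtracted, which replaces f_i by f_i - 1 (x) (eps (x)
    id)(f_i); this is killed by the counit and gives the second factor in I2. *)
Lemma polar_augIpow2 : I2 2 phi.
Proof.
have phiI : slices_in A 1 phi.
  move=> a; apply/(augIpow1 (hB := hA))/(augI_eps0 (hB := hA)).
  by have /(congr1 (fun z : wmod k E => z a)) := polar_counitr hphi.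
have [J [w [wI wP]]] := slices_in_fgl adic E 1; have [f fE] := wP phi phiI.
pose e (t : F2) : F := wslicel eps t.
have le : linear e := (wmap_slicel _ e_form).1.
have lt1 : linear (fun y => tens 1 y) := (wmap_tensor_r _ (1 : F)).1.
have {}fE : (phi : F2) = \sum_i tens 1 (w i) * (f i : F2).
  by rewrite [LHS]fE; apply: eq_bigr => i _; rewrite tens1M.
have e0 : tens 1 (e phi) = 0 by rewrite /e (polar_counitl hphi) (linf0 lt1).
suff -> : (phi : F2) = \sum_i tens 1 (w i) * ((f i : F2) - tens 1 (e (f i))); last first.
  transitivity ((phi : F2) - tens 1 (e phi)); first by rewrite e0 subr0.
  rewrite fE (linf_sum le) (linf_sum lt1) -sumrB.
  apply: eq_bigr => i _; rewrite mulrBr tensM mul1r; congr (_ - tens 1 _).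
  by rewrite /e tens1M -(wmap_slicer_exchange _ e_form (wmap_mull (w i))).
apply: (augIpow_sum (hB := hA2)) => i _; rewrite -[2%N]/(1 + 1)%N.
apply: (augIpowM (hB := hA2)); first exact: sq_augIpow_tensr.
apply/(augIpow1 (hB := hA2))/(augI_eps0 (hB := hA2)).
rewrite (linfB (sq_eps_form hA).1) [X in _ - X](sq_eps_tensor hA).
rewrite -/(aeps A (1 : F)) (eps1 hA) mul1r.
rewrite /= -(wslice_exchange _ e_form e_form) -/(e (f i)).
exact: subrr.
Qed.

Let delta_ex t : exists d : F2, (phi : F2) * t - t * (phi : F2) = hbar *: d.
Proof. by have [d dE] := adic_comm adic2 phi t; exists d; rewrite dE expr1. Qed.

(** The derivation hbar^-1 [phi, -]; the chosen quotient is unique since F2 has no hbar-torsion. *)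
Let delta t : F2 := xget 0 [set d : F2 | (phi : F2) * t - t * (phi : F2) = hbar *: d]%classic.

Let deltaE t : (phi : F2) * t - t * (phi : F2) = hbar *: delta t.
Proof.
exact: (@xgetPex _ _ [set d : F2 | (phi : F2) * t - t * (phi : F2) = hbar *: d]%classic
  (delta_ex t)).
Qed.

Let tF2 : htfree F2 := @wmod_htfree k (E * E)%type.

Let delta_map : wmap delta.
Proof.
have cm : wmap (fun t : wmod k (E * E) => (phi : F2) * (t : F2) - (t : F2) * (phi : F2) : F2).
  exact: (wmapB (sq_mull_map hA phi) (sq_mulr_map hA phi)).
split=> [a s t|p].
  apply: (@htfree_inj _ _ 1 _ _ tF2); rewrite expr1 -deltaE [LHS](cm.1 a s t).
  by rewrite [in RHS]scalerDr [in RHS]scalerA [hbar * a]mulrC -scalerA -!deltaE.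
apply: (wcont_div (n := 1)).
have := cm.2 p; congr wcontinuous_form; apply/funext => t.
by rewrite deltaE wmodZ expr1.
Qed.

Let delta_I n t : I2 n t -> I2 n.+1 (delta t).
Proof.
move=> tI; have [d dI] := comm_augIpow2 (adic_comm adic2) polar_augIpow2 tI.
by rewrite deltaE -[hbar]expr1 => /(htfree_inj tF2) ->.
Qed.

Let xi : U2 := @viota2 _ _ _ V (hfrac 1 phi).

Let xiE : j2 phi = hbar *: xi.
Proof.
have := vj_frac (hA := hA2) (vU2P V) (augIpowS (hB := hA2) polar_augIpow2).
by rewrite expr1.
Qed.

(** As phi lies in I2^2, hbar^2 divides j2 phi = hbar xi. This is what makes exp(xi) converge. *)
Let xi_dvd : hdvd 1 xi.
Proof.
apply: (@htfree_hdvd _ _ 1) => //; rewrite expr1 -xiE.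
exact: (dual2_in_dvd V polar_augIpow2).
Qed.

Let xi_comm t : xi * j2 t - j2 t * xi = j2 (delta t).
Proof.
apply: (@htfree_inj _ _ 1) tU2 _; rewrite expr1 scalerBr scalerAl scalerAr -xiE.
rewrite -!dual2_inM -[RHS](linfZ lj2) -deltaE.
by rewrite [RHS](linfB lj2).
Qed.

Local Notation divfact n z := (fps_const (n`!%:R^-1 : k) *: z).

Let term t i : F2 := divfact i (iter i delta t).

Let iter_delta_I n i t : I2 n t -> I2 (i + n) (iter i delta t).
Proof. by move=> tI; elim: i => //= i IH; apply: delta_I. Qed.

Let term_I t i : I2 i (term t i).
Proof. by apply: augIpowZ; rewrite -[i in I2 i]addn0; apply: iter_delta_I. Qed.

(* Ad = exp(ad phi / h), that is conjugation by the twist *)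
Let Ad t : F2 := isum (term t).

Let AdP t n : I2 n (Ad t - \sum_(i < n) term t i).
Proof. exact: (isumP adic2 (term_I t)). Qed.

Let Ad_I n t : I2 n t -> I2 n (Ad t).
Proof.
move=> tI; apply: (isum_in adic2) => i; apply: augIpowZ.
apply: (augIpow_le (hB := hA2)) (iter_delta_I i tI).
by rewrite geq_max leq_addr leq_addl.
Qed.

Let xiX_dvd i : hdvd i (divfact i (xi ^+ i)).
Proof.
apply: hdvdZ; elim: i => [|i IH]; first exact: hdvd00.
by rewrite exprS -add1n; apply: alg_hdvdM.
Qed.

(** [is_hexp] gives a limit without a rate; divisibility of xi by hbar gives the rate. *)
Let exp_dvd n : hdvd n (Tw - \sum_(i < n) divfact i (xi ^+ i)).
Proof.
have [N NP] := polar_exp hphi n; have := NP _ (leq_maxl N n).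
rewrite -/xi; move: (leq_maxr N n) => /subnKC <-; rewrite big_split_ord /= opprD addrA.
move=> /hdvd_sub; apply.
apply: hdvd_sum => i _; apply: hdvd_le (xiX_dvd _).
exact: leq_addr.
Qed.

(** Both exponentials are truncated at N. [exp_ad] sums the products d_i a_l over the triangle i + l
    < N, and the rest of the square i, l < N consists of terms divisible by hbar^N. *)
Lemma twist_exchange t : Tw * j2 t = j2 (Ad t) * Tw.
Proof.
apply: (hsep cU2) => N.
pose a i : U2 := divfact i (xi ^+ i); pose d i : U2 := j2 (term t i).
have dd i : hdvd i (d i) by apply: (dual2_in_dvd V (term_I t i)).
have TwN := exp_dvd N; have AdN := dual2_in_dvd V (AdP t N).
rewrite (linfB lj2) (linf_sum lj2) in AdN.
apply: (@hdvd_trans _ _ _ _ ((\sum_(i < N) a i) * j2 t)).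
  by rewrite -mulrBl; apply: (linear_hdvd (linear_mulr _)).
apply: (@hdvd_trans _ _ _ _ ((\sum_(i < N) d i) * \sum_(i < N) a i)); last first.
  apply: (@hdvd_trans _ _ _ _ ((\sum_(i < N) d i) * Tw)).
    by rewrite -mulrBr; apply: (linear_hdvd (linear_mull _)); apply: hdvd_subC.
  by rewrite -mulrBl; apply: (linear_hdvd (linear_mulr _)); apply: hdvd_subC.
have aE n : a n * j2 t = \sum_(i < n.+1) d i * a (n - i)%N.
  rewrite /a (exp_ad hk (ad := fun i => j2 (iter i delta t))) //.
  by apply: eq_bigr => i _; rewrite /d /term (linfZ lj2 _ (iter i delta t)).
rewrite mulr_suml; under eq_bigr do rewrite aE.
rewrite (sum_triangle (fun i l => d i * a l)) mulr_suml -sumrB; apply: hdvd_sum => i _.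
rewrite -mulr_sumr -mulrBr; have iN := ltnW (ltn_ord i).
have -> : \sum_(l < N) a l = \sum_(l < N - i + i) a l by rewrite subnK.
rewrite big_split_ord /= opprD addrA subrr add0r mulrN; apply: hdvdN.
rewrite -[N in hdvd N](subnKC iN); apply: alg_hdvdM => //.
apply: hdvd_sum => l _; apply: hdvd_le (xiX_dvd _).
exact: leq_addr.
Qed.

Let AdE t : j2 (Ad t) = Tw * j2 t * Twi.
Proof. by rewrite twist_exchange -mulrA (twist_invr tw) mulr1. Qed.

Definition twisted_comul (x : wmod k E) : wmod k (E * E) := Ad (D x).

Lemma twisted_comulE x : j2 (twisted_comul x) = Tw * j2 (D x) * Twi.
Proof. exact: AdE. Qed.

Lemma twisted_comul_in x : twist_comul D Tw Twi (j x) = j2 (twisted_comul x).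
Proof. by rewrite /twist_comul (vcomulE fH) twisted_comulE. Qed.

Lemma twisted_comul_augIpow n x : I n x -> I2 n (twisted_comul x).
Proof. by move=> xI; apply/Ad_I/(comul_augIpow (hA := hA) hH). Qed.

Lemma twisted_comul_map : wmap twisted_comul.
Proof.
split=> [a x y|p].
  apply: (dual2_in_inj fH (V := V)); rewrite twisted_comulE D_map.1.
  rewrite (linfD lj2 (a *: twisted_comul x)) (linfZ lj2 a (twisted_comul x)) !twisted_comulE.
  by rewrite [j2 (_ + _)]lj2 mulrDr mulrDl -scalerAr -scalerAl.
(* At coordinate p and modulo hbar^n only N terms of the exponential count, and each of them is
   weakly continuous. *)
apply: wcont_approx => n; have [N NP] := augIpow_weak adic2 n p.
exists (fun x => (\sum_(i < N) term (D x) i : wmod k (E * E)) p) => [|x]; last first.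
  by have := NP _ (AdP (D x) N).
have iter_map i : wmap (iter i delta : wmod k (E * E) -> wmod k (E * E)).
  by elim: i => [|i IH]; [apply: wmap_id|apply: (wmap_comp delta_map IH)].
have sm : wmap (fun t : wmod k (E * E) => \sum_(i < N) term t i).
  by apply: wmap_sum => i; apply: wmapZ; apply: iter_map.
exact: ((wmap_comp sm D_map).2 p).
Qed.

Lemma twisted_counitl x : wslicel eps (twisted_comul x) = x.
Proof.
apply: (dual_in_inj fH (V := V)); rewrite -(vcounitl_in fH V) twisted_comulE !(vcounitlM fH).
rewrite (vcounitl_in fH V) (wHopf_counitl hH) (twist_counitl tw) mul1r.
have : vcounitl (Tw * Twi) = 1 by rewrite (twist_invr tw) (vcounitl1 fH).
by rewrite (vcounitlM fH) (twist_counitl tw) mul1r => ->; rewrite mulr1.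
Qed.

Lemma twisted_counitr x : wslicer eps (twisted_comul x) = x.
Proof.
apply: (dual_in_inj fH (V := V)); rewrite -(vcounitr_in fH V) twisted_comulE !(vcounitrM fH).
rewrite (vcounitr_in fH V) (wHopf_counitr hH) (twist_counitr tw) mul1r.
have : vcounitr (Tw * Twi) = 1 by rewrite (twist_invr tw) (vcounitr1 fH).
by rewrite (vcounitrM fH) (twist_counitr tw) mul1r => ->; rewrite mulr1.
Qed.

Lemma twisted_comulM x y :
  twisted_comul (x * y) = (twisted_comul x : F2) * (twisted_comul y : F2).
Proof.
apply: (dual2_in_inj fH (V := V)); rewrite dual2_inM !twisted_comulE.
rewrite [D _](wHopf_comulM hH) [j2 _](dual2_inM V (hA := hA)).
by rewrite -!mulrA (mulrA Twi) (twist_invl tw) mul1r.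
Qed.

Lemma twisted_comul1 : twisted_comul (1 : F) = (1 : F2).
Proof.
apply: (dual2_in_inj fH (V := V)); rewrite twisted_comulE [D _](wHopf_comul1 hH).
by rewrite [j2 _](dual2_in1 hA V) mulr1 (twist_invr tw) -(dual2_in1 hA V).
Qed.

(** * Coassociativity of the twisted coproduct *)

Let v12_linear : linear (@v12 _ _ _ V). Proof. exact: (btau3.2 1). Qed.

Lemma v12M p q : v12 (p * q) = v12 p * v12 q :> U3.
Proof. by rewrite /v12 tau3_mul mulr1. Qed.

Lemma vputM u v p q : vput u p * vput v q = vput (u * v) (p * q) :> U3.
Proof.
move: p; apply: (tau_ext cU3) => [||a a'].
- exact: linear_comp (vput_linear u) (linear_mulr _).
- exact: linear_comp (linear_mulr q) (vput_linear _).
move: q; apply: (tau_ext cU3) => [||d d'].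
- exact: linear_comp (vput_linear v) (linear_mull _).
- exact: linear_comp (linear_mull _) (vput_linear _).
by rewrite tau_mul !vputE tau3_mul tau_mul.
Qed.

Let vcomull_bil : bilinear_fun (fun u v => tau3 (vcomul D u) v).
Proof. by split=> [u|v]; [exact: btau3.1|exact: linear_comp lD (btau3.2 v)]. Qed.
Let vcomulr_bil : bilinear_fun (fun u v => vput u (vcomul D v) : U3).
Proof.
by split=> [u|v]; [exact: linear_comp lD (vput_linear u)|exact: vput_linearl].
Qed.
Lemma vcomull_linear : linear (@vcomull _ _ _ D V).
Proof. exact: (hlift_linear ht cU3 vcomull_bil). Qed.
Lemma vcomullE u v : vcomull D (tau u v) = tau3 (vcomul D u) v.
Proof. exact: (hliftE ht cU3 vcomull_bil). Qed.
Lemma vcomulr_linear : linear (@vcomulr _ _ _ D V).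
Proof. exact: (hlift_linear ht cU3 vcomulr_bil). Qed.
Lemma vcomulrE u v : vcomulr D (tau u v) = vput u (vcomul D v).
Proof. exact: (hliftE ht cU3 vcomulr_bil). Qed.

Lemma vcomullM p q : vcomull D (p * q) = vcomull D p * vcomull D q :> U3.
Proof.
move: p; apply: (tau_ext cU3) => [||a a'].
- exact: linear_comp (linear_mulr q) vcomull_linear.
- exact: linear_comp vcomull_linear (linear_mulr _).
move: q; apply: (tau_ext cU3) => [||d d'].
- exact: linear_comp (linear_mull _) vcomull_linear.
- exact: linear_comp vcomull_linear (linear_mull _).
by rewrite tau_mul !vcomullE (vcomulM fH) tau3_mul.
Qed.

Lemma vcomulrM p q : vcomulr D (p * q) = vcomulr D p * vcomulr D q :> U3.
Proof.
move: p; apply: (tau_ext cU3) => [||a a'].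
- exact: linear_comp (linear_mulr q) vcomulr_linear.
- exact: linear_comp vcomulr_linear (linear_mulr _).
move: q; apply: (tau_ext cU3) => [||d d'].
- exact: linear_comp (linear_mull _) vcomulr_linear.
- exact: linear_comp vcomulr_linear (linear_mull _).
by rewrite tau_mul !vcomulrE (vcomulM fH) vputM.
Qed.

Lemma vcomull1 : vcomull D (1 : U2) = 1 :> U3.
Proof. by rewrite -tau_one vcomullE (vcomul1 fH) tau3_one. Qed.
Lemma vput1 : vput (1 : U) 1 = 1 :> U3.
Proof. by rewrite -tau_one vputE tau_one tau3_one. Qed.
Lemma vcomulr1 : vcomulr D (1 : U2) = 1 :> U3.
Proof. by rewrite -tau_one vcomulrE (vcomul1 fH) vput1. Qed.
Lemma v12_1 : v12 (1 : U2) = 1 :> U3. Proof. exact: tau3_one. Qed.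

Lemma vcomul_coassoc x : vcomull D (j2 (D x)) = vcomulr D (j2 (D x)) :> U3.
Proof.
apply/(coassoc_transfer fH D_map (comul_augIpow (hA := hA) hH) (vcomulE fH V)
  vcomull_linear vcomulr_linear vcomullE vcomulrE).
by apply/funext => -[[e e'] e'']; apply: (wHopf_coassoc hH).
Qed.

Let cocycle := twist_cocycle tw.

(** The two sides are a left and a right inverse of the common value of the cocycle identity, so
    they agree. *)
Let cocycle_inv : vcomull D Twi * v12 Twi = vcomulr D Twi * v23 Twi :> U3.
Proof.
have ll : vcomull D Twi * v12 Twi * (v12 Tw * vcomull D Tw) = 1 :> U3.
  rewrite mulrA -(mulrA _ (v12 Twi)) -v12M (twist_invl tw) v12_1 mulr1.
  by rewrite -vcomullM (twist_invl tw) vcomull1.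
have rr : v23 Tw * vcomulr D Tw * (vcomulr D Twi * v23 Twi) = 1 :> U3.
  rewrite mulrA -(mulrA _ (vcomulr D Tw)) -vcomulrM (twist_invr tw) vcomulr1 mulr1.
  by rewrite /v23 vputM mul1r (twist_invr tw) vput1.
by rewrite -[LHS]mulr1 -rr mulrA -cocycle ll mul1r.
Qed.

(** In U3, coassociativity of Delta stands between the cocycle identity on the left and its inverse
    on the right. *)
Lemma twisted_coassoc x :
  wtensl twisted_comul (twisted_comul x) = wassoc (wtensr twisted_comul (twisted_comul x)).
Proof.
pose L p : U3 := v12 Tw * vcomull D p * v12 Twi.
pose R p : U3 := v23 Tw * vcomulr D p * v23 Twi.
have lL : linear L.
  exact: linear_comp (linear_comp vcomull_linear (linear_mull _)) (linear_mulr _).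
have lR : linear R.
  exact: linear_comp (linear_comp vcomulr_linear (linear_mull _)) (linear_mulr _).
apply/(coassoc_transfer fH twisted_comul_map twisted_comul_augIpow
  twisted_comul_in lL lR) => [u v|u v|].
- by rewrite /L vcomullE /v12 !tau3_mul mul1r mulr1.
- by rewrite /R vcomulrE /v23 !vputM mul1r mulr1.
rewrite /L /R twisted_comulE !vcomullM !vcomulrM vcomul_coassoc !mulrA cocycle.
by rewrite -!mulrA cocycle_inv.
Qed.

(** * The twisted antipode *)

Let antl' := @antl _ _ _ S V.
Let antr' := @antr _ _ _ S V.
Let lantl z : linear (antl' z) := @antl_linear _ _ _ _ _ _ _ _ _ _ fH V z.
Let lantr z : linear (antr' z) := @antr_linear _ _ _ _ _ _ _ _ _ _ fH V z.
Let lS := @vantip_linear _ _ _ _ _ _ _ _ _ _ fH V.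

(* a (x) b (x) c |-> S(a) b S(c) and a (x) b (x) c |-> a S(b) c *)
Let N : U3 -> U := hlift tau3 (fun p u => antl' 1 p * 1 * vantip S u).
Let N' : U3 -> U := hlift tau3 (fun p u => antr' 1 p * 1 * u).
Let N_bil : bilinear_fun (fun p u => antl' 1 p * 1 * vantip S u).
Proof. exact: bilinear_insert. Qed.
Let N'_bil : bilinear_fun (fun p u => antr' 1 p * 1 * u).
Proof. exact: (bilinear_insert (g := id)). Qed.
Let lN : linear N. Proof. exact: (hlift_linear ht3 cU N_bil). Qed.
Let lN' : linear N'. Proof. exact: (hlift_linear ht3 cU N'_bil). Qed.
Let NE a a' d : N (tau3 (tau a a') d) = vantip S a * a' * vantip S d.
Proof. by rewrite /N (hliftE ht3 cU N_bil) /antl' (antlE fH) !mulr1. Qed.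
Let N'E a a' d : N' (tau3 (tau a a') d) = a * vantip S a' * d.
Proof. by rewrite /N' (hliftE ht3 cU N'_bil) /antr' (antrE fH) !mulr1. Qed.

(** On (a (x) a' (x) 1)(1 (x) d (x) d') the functional N gives S(a) a' d S(d'), which factors. This
    expresses v w as a value of N. *)
Lemma antl_antr p q : N (v12 p * v23 q) = antl' 1 p * antr' 1 q.
Proof.
move: p; apply: (tau_ext cU) => [||a a'].
- exact: linear_comp (linear_comp v12_linear (linear_mulr _)) lN.
- exact: linear_comp (lantl 1) (linear_mulr _).
move: q; apply: (tau_ext cU) => [||d d'].
- exact: linear_comp (linear_comp (vput_linear 1) (linear_mull _)) lN.
- exact: linear_comp (lantr 1) (linear_mull _).
rewrite /v12 /v23 vputE tau3_mul tau_mul NE mulr1 mul1r /antl' /antr' (antlE fH) (antrE fH).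
by rewrite !mulr1 !mulrA.
Qed.

Lemma antr_antl p q : N' (v23 q * v12 p) = antr' 1 p * antl' 1 q.
Proof.
move: p; apply: (tau_ext cU) => [||a a'].
- exact: linear_comp (linear_comp v12_linear (linear_mull _)) lN'.
- exact: linear_comp (lantr 1) (linear_mulr _).
move: q; apply: (tau_ext cU) => [||d d'].
- exact: linear_comp (linear_comp (vput_linear 1) (linear_mulr _)) lN'.
- exact: linear_comp (lantl 1) (linear_mull _).
rewrite /v12 /v23 vputE tau3_mul tau_mul N'E mulr1 mul1r /antl' /antr' (antlE fH) (antrE fH).
by rewrite !mulr1 (vantipM fH) !mulrA.
Qed.

Let N_legs p q u v : N (tau3 p u * vput v q) =
  vantip S v * antl' 1 p * antr' 1 q * vantip S u.
Proof.
move: p; apply: (tau_ext cU) => [||a a'].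
- exact: linear_comp (linear_comp (btau3.2 u) (linear_mulr _)) lN.
- exact: linear_comp (linear_comp (linear_comp (lantl 1) (linear_mull _)) (linear_mulr _))
    (linear_mulr _).
move: q; apply: (tau_ext cU) => [||d d'].
- exact: linear_comp (linear_comp (vput_linear v) (linear_mull _)) lN.
- exact: linear_comp (linear_comp (lantr 1) (linear_mull _)) (linear_mulr _).
rewrite vputE tau3_mul tau_mul NE !(vantipM fH) /antl' /antr' (antlE fH) (antrE fH).
by rewrite !mulr1 !mulrA.
Qed.

Let N'_legs p q u v : N' (vput v q * tau3 p u) =
  v * antr' 1 p * antl' 1 q * u.
Proof.
move: p; apply: (tau_ext cU) => [||a a'].
- exact: linear_comp (linear_comp (btau3.2 u) (linear_mull _)) lN'.
- exact: linear_comp (linear_comp (linear_comp (lantr 1) (linear_mull _)) (linear_mulr _))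
    (linear_mulr _).
move: q; apply: (tau_ext cU) => [||d d'].
- exact: linear_comp (linear_comp (vput_linear v) (linear_mulr _)) lN'.
- exact: linear_comp (linear_comp (lantl 1) (linear_mull _)) (linear_mulr _).
rewrite vputE tau3_mul tau_mul N'E !(vantipM fH) /antl' /antr' (antlE fH) (antrE fH).
by rewrite !mulr1 !mulrA.
Qed.

(** The antipode axioms contract S(a_1) a_2 and d_1 S(d_2) inside N, so that only counits of the
    doubled legs remain. *)
Let N_comul p q : N (vcomull D p * vcomulr D q) =
  vantip S (vcounitr q) * vantip S (vcounitl p).
Proof.
have lcr := @vcounitr_linear _ _ _ _ _ _ _ _ _ _ fH V.
have lcl := @vcounitl_linear _ _ _ _ _ _ _ _ _ _ fH V.
move: p; apply: (tau_ext cU) => [||a a'].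
- exact: linear_comp (linear_comp vcomull_linear (linear_mulr _)) lN.
- exact: linear_comp (linear_comp lcl lS) (linear_mull _).
move: q; apply: (tau_ext cU) => [||d d'].
- exact: linear_comp (linear_comp vcomulr_linear (linear_mull _)) lN.
- exact: linear_comp (linear_comp lcr lS) (linear_mulr _).
rewrite vcomullE vcomulrE N_legs /antl' /antr' (antl_comul fH) (antr_comul fH).
rewrite (vcounitrE fH) (vcounitlE fH) !(linfZ lS) -!scalerAr -!scalerAl !mulr1.
by rewrite scalerA mulrC -scalerA.
Qed.

Let N'_comul p q : N' (vcomulr D p * vcomull D q) = vcounitr p * vcounitl q.
Proof.
have lcr := @vcounitr_linear _ _ _ _ _ _ _ _ _ _ fH V.
have lcl := @vcounitl_linear _ _ _ _ _ _ _ _ _ _ fH V.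
move: p; apply: (tau_ext cU) => [||a a'].
- exact: linear_comp (linear_comp vcomulr_linear (linear_mulr _)) lN'.
- exact: linear_comp lcr (linear_mulr _).
move: q; apply: (tau_ext cU) => [||d d'].
- exact: linear_comp (linear_comp vcomull_linear (linear_mull _)) lN'.
- exact: linear_comp lcl (linear_mull _).
rewrite vcomullE vcomulrE N'_legs /antl' /antr' (antl_comul fH) (antr_comul fH).
rewrite (vcounitrE fH) (vcounitlE fH) -!scalerAr -!scalerAl !mulr1.
by rewrite scalerA mulrC -scalerA.
Qed.

(** m (id (x) S)([Tw]), which turns out to be the inverse of v. *)
Definition twist_w : U := antr S 1 Tw.
Let vv : U := twist_v S Twi.
Let ww : U := twist_w.

Let vvE : vv = antl' 1 Twi.
Proof.
rewrite /vv /twist_v /antl' /antl; congr (hlift _ _ _).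
by apply/funext => u; apply/funext => v; rewrite mulr1.
Qed.

Let counitl_inv : vcounitl Twi = 1.
Proof.
have : vcounitl (Tw * Twi) = 1 by rewrite (twist_invr tw) (vcounitl1 fH).
by rewrite (vcounitlM fH) (twist_counitl tw) mul1r.
Qed.

Let counitr_inv : vcounitr Twi = 1.
Proof.
have : vcounitr (Tw * Twi) = 1 by rewrite (twist_invr tw) (vcounitr1 fH).
by rewrite (vcounitrM fH) (twist_counitr tw) mul1r.
Qed.

(** The cocycle identity rewrites [Twi]_12 [Tw]_23 as (Delta (x) id)([Tw]) (id (x) Delta)([Twi]).
    There N leaves only counits of the twist and its inverse, which are 1. *)
Lemma twist_v_w : vv * ww = 1.
Proof.
rewrite vvE /ww /twist_w -antl_antr.
have -> : v12 Twi * v23 Tw = vcomull D Tw * vcomulr D Twi :> U3.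
  transitivity (v12 Twi * (v23 Tw * vcomulr D Tw) * vcomulr D Twi : U3).
    by rewrite -!mulrA -vcomulrM (twist_invr tw) vcomulr1 mulr1.
  by rewrite -cocycle !mulrA -v12M (twist_invl tw) v12_1 mul1r.
by rewrite N_comul counitr_inv (twist_counitl tw) (vantip1 fH) mulr1.
Qed.

Lemma twist_w_v : ww * vv = 1.
Proof.
rewrite vvE /ww /twist_w -antr_antl.
have -> : v23 Twi * v12 Tw = vcomulr D Tw * vcomull D Twi :> U3.
  transitivity (v23 Twi * (v12 Tw * vcomull D Tw) * vcomull D Twi : U3).
    by rewrite -!mulrA -vcomullM (twist_invr tw) vcomull1 mulr1.
  by rewrite cocycle !mulrA /v23 vputM mul1r (twist_invl tw) vput1 mul1r.
by rewrite N'_comul counitl_inv (twist_counitr tw) mulr1.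
Qed.

Let Tv (u : U) : U := twist_antip S vv ww u.
Let lTv : linear Tv.
Proof. exact: linear_comp (linear_comp lS (linear_mull _)) (linear_mulr _). Qed.

(** The identity S(f_1) v f_2 = 1: v is the result of [Twi] acting on 1, and the action of [Tw]
    undoes it. *)
Let antl_unit : antl' vv Tw = 1.
Proof. by rewrite vvE /antl' -(antl_mul fH) (twist_invl tw) (antl1 fH). Qed.
Let antr_unit : antr' ww Twi = 1.
Proof. by rewrite /ww /twist_w /antr' -(antr_mul fH) (twist_invl tw) (antr1 fH). Qed.

(** The right action takes in the three factors of [Tw] Delta(x) [Twi] in turn: v becomes 1, then
    eps x, then eps x v, and w v = 1. *)
Let Tv_left x : ww * antl' vv (j2 (twisted_comul x)) = eps x *: 1.
Proof.
rewrite twisted_comulE /antl' !(antl_mul fH) [antl _ vv Tw]antl_unit -(vcomulE fH).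
rewrite (antl_comul fH) (antlZ fH) -/antl' -vvE (vcounitE fH) -scalerAr.
by rewrite twist_w_v.
Qed.

Let Tv_right x : antr' ww (j2 (twisted_comul x)) * vv = eps x *: 1.
Proof.
rewrite twisted_comulE /antr' !(antr_mul fH) [antr _ ww Twi]antr_unit -(vcomulE fH).
rewrite (antr_comul fH) (antrZ fH) -/twist_w -/ww (vcounitE fH) -scalerAl.
by rewrite twist_w_v.
Qed.

Let q1 (x : wmod k E) : F := (x : F) - eps x *: (1 : F).
Let q1_map : wmap q1.
Proof. exact: (wmapB (@wmap_id _ _) (wform_wmap (1 : F) e_form)). Qed.
Let q1_aug x : augI A (q1 x).
Proof.
apply: (augI_eps0 (hB := hA)); rewrite (linfB e_form.1) (linfZ e_form.1) (eps1 hA).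
by rewrite fps_scaleE mulr1 subrr.
Qed.
Let q1_I m x : I m x -> I m (q1 x).
Proof.
move=> xI; apply: (augIpowB (hB := hA)) => //; apply: hdvd_augIpow.
by have [a ->] := eps_augIpow xI; rewrite fps_scaleE -scalerA; apply: hdvd_hbar.
Qed.

Let conv (f : wmod k E -> wmod k E) (t : wmod k (E * E)) : F :=
  amul A (wtensl f (wtensr q1 t)).

Let conv_map f : wmap f -> wmap (conv f).
Proof.
move=> fm; exact: (wmap_comp (amul_map hA) (wmap_comp (wmap_tensl _ fm) (wmap_tensr _ q1_map))).
Qed.

Let conv_slices f m t : wmap f -> slices_in A m t -> I m (conv f t).
Proof.
move=> fm tI; apply: (slices_in_mul adic); apply: (slices_in_tensl adic) => //.
exact: (slices_in_tensr (q1_I (m := m))).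
Qed.

Fixpoint antip_approx (n : nat) (x : wmod k E) : wmod k E :=
  if n is m.+1 then eps x *: (1 : F) - conv (antip_approx m) (twisted_comul x) else 0.

Let approx_map n : wmap (antip_approx n).
Proof.
elim: n => [|n IH] /=.
  by split=> [a x y|e]; [rewrite scaler0 addr0|apply: wcont0].
exact: (wmapB (wform_wmap (1 : F) e_form) (wmap_comp (conv_map IH) twisted_comul_map)).
Qed.

(** On y (x) z this is Tv(y) (z - eps z), that is, the map whose composite with the twisted
    coproduct is Tv convolved with id - eps. *)
Let convT p : U := ww * antl' vv p - Tv (vcounitr p).
Let lconvT : linear convT.
Proof.
have lcr := @vcounitr_linear _ _ _ _ _ _ _ _ _ _ fH V.
have := linear_addf (linear_comp (lantl vv) (linear_mull ww))
  (linear_scale (-1) (linear_comp lcr lTv)).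
by congr (linear _); apply/funext => p; rewrite scaleN1r.
Qed.

Let convT_in x : convT (j2 (twisted_comul x)) = eps x *: 1 - Tv (j x).
Proof. by rewrite /convT Tv_left (vcounitr_in fH) twisted_counitr. Qed.

(* T = S^F is the unique solution of T = eps - T * (id - eps), solved by iteration
   in F: the n-th iterate is exact modulo I^n. *)
Lemma antip_approxP n x : hdvd n (Tv (j x) - j (antip_approx n x)).
Proof.
elim: n x => [|n IH] x; first exact: hdvd00.
have tcl := tcont_comp (tcont_in2 fH V) lconvT.
have tcr : tcont A (fun t : wmod k (E * E) => j (conv (antip_approx n) t)).
  apply: (tcont_in (hA := hA)); first exact: (conv_map (approx_map n)).1.
  by move=> m t; apply: conv_slices.
(* On y (x) z the difference is (Tv y - its n-th approximation) times z - eps z. The first factor is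
   divisible by hbar^n, the second by hbar, as z - eps z lies in I. *)
have step : forall t, hdvd n.+1 (convT (j2 t) - j (conv (antip_approx n) t)).
  apply: (tcont_dvd hb (tcontB hA tcl tcr)) => y z.
  rewrite [j2 _](dual_in_tens V (hA := hA)) /convT /antl' (antlE fH) (vcounitrE fH).
  rewrite /conv (wtensr_tensor _ _ q1_map.1) (wtensl_tensor _ _ (approx_map n).1).
  rewrite [j (amul _ _)](dual_inM V (hA := hA)) (vcounitE fH) (linfZ lTv).
  have -> : ww * (vantip S (j y) * vv * j z) - eps z *: Tv (j y) = Tv (j y) * j (q1 z).
    rewrite /q1 (linfB lj) (linfZ lj) (dual_in1 hA V) mulrBr -scalerAr mulr1.
    by rewrite /Tv /twist_antip !mulrA.
  rewrite -mulrBl -addn1; apply: alg_hdvdM; first exact: IH.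
  by apply: (dual_in_dvd V (hA := hA)); apply: augIpow1; apply: q1_aug.
have -> : Tv (j x) - j (antip_approx n.+1 x) =
    - (convT (j2 (twisted_comul x)) - j (conv (antip_approx n) (twisted_comul x))).
  rewrite convT_in /= (linfB lj) (linfZ lj) (dual_in1 hA V).
  by rewrite !opprB addrCA.
exact: hdvdN.
Qed.

(** Consecutive iterates differ by elements of I^n, because [dual_in_dvdE] turns divisibility in U
    into membership in F; so they have an I-adic limit in F. Linearity comes from U by injectivity
    of j, continuity from the iterates. *)
Lemma twisted_antip_exists : exists S' : wmod k E -> wmod k E,
  wmap S' /\ forall x, Tv (j x) = j (S' x).
Proof.
have /choice[S' S'P] : forall x : wmod k E, exists y : F, forall n, I n (y - (antip_approx n x : F)).
  move=> x; pose d i : F := (antip_approx i.+1 x : F) - (antip_approx i x : F).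
  have dI i : I i (d i).
    apply/(dual_in_dvdE fH V); rewrite (linfB lj).
    apply: hdvd_trans (hdvd_subC (hdvd_le (leqnSn i) (antip_approxP i.+1 x))) _.
    exact: antip_approxP.
  have [y yP] := augIpow_complete adic dI; exists y => n.
  have := yP n; congr augIpow; congr (_ - _); rewrite /d.
  by elim: n => [|n IH]; rewrite ?big_ord0 // big_ord_recr /= IH addrC subrK.
have TS' x : Tv (j x) = j (S' x).
  apply: (hsep cU) => n; apply: hdvd_trans (antip_approxP n x) _.
  by apply: hdvd_subC; rewrite -(linfB lj); apply: dual_in_dvd; apply: S'P.
exists S'; split=> //; split=> [a x y|e].
  apply: (dual_in_inj fH (V := V)); rewrite -TS' [RHS](linfD lj) (linfZ lj a (S' x)).
  by rewrite -!TS' [j _]lj lTv.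
apply: wcont_approx => n; have [M MP] := augIpow_weak adic n e.
exists (fun x => antip_approx M x e); first exact: (approx_map M).2.
by move=> x; have := MP _ (S'P x M).
Qed.

Section Antipode.
Variable S' : wmod k E -> wmod k E.
Hypotheses (S'_map : wmap S') (S'E : forall x, Tv (j x) = j (S' x)).

Let S'_I m x : I m x -> I m (S' x).
Proof.
move=> xI; apply/(dual_in_dvdE fH V); rewrite -S'E.
by apply: (linear_hdvd lTv); apply: dual_in_dvd.
Qed.

Lemma twisted_antipl x : amul A (wtensl S' (twisted_comul x)) = eps x *: (1 : F).
Proof.
apply: (dual_in_inj fH (V := V)); rewrite (linfZ lj) (dual_in1 hA V) -Tv_left.
apply/esym; move: (twisted_comul x); apply: (tcont_ext hb cU) => [||y z].
- exact: (tcont_comp (tcont_in2 fH V) (linear_comp (lantl vv) (linear_mull ww))).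
- apply: (tcont_in (hA := hA)); first exact: (wmap_comp (amul_map hA) (wmap_tensl _ S'_map)).1.
  by move=> m t tI; apply: (slices_in_mul adic); apply: (slices_in_tensl adic).
rewrite [j2 _](dual_in_tens V (hA := hA)) /antl' (antlE fH).
rewrite (wtensl_tensor _ _ S'_map.1) [RHS](dual_inM V (hA := hA)) -S'E.
by rewrite /Tv /twist_antip !mulrA.
Qed.

Lemma twisted_antipr x : amul A (wtensr S' (twisted_comul x)) = eps x *: (1 : F).
Proof.
apply: (dual_in_inj fH (V := V)); rewrite (linfZ lj) (dual_in1 hA V) -Tv_right.
apply/esym; move: (twisted_comul x); apply: (tcont_ext hb cU) => [||y z].
- exact: (tcont_comp (tcont_in2 fH V) (linear_comp (lantr ww) (linear_mulr vv))).
- apply: (tcont_in (hA := hA)); first exact: (wmap_comp (amul_map hA) (wmap_tensr _ S'_map)).1.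
  move=> m t tI; apply: (slices_in_mul adic).
  exact: (slices_in_tensr (S'_I (m := m))).
rewrite [j2 _](dual_in_tens V (hA := hA)) /antr' (antrE fH).
rewrite (wtensr_tensor _ _ S'_map.1) [RHS](dual_inM V (hA := hA)) -S'E.
by rewrite /Tv /twist_antip !mulrA.
Qed.

Lemma twisted_Hopf : is_wHopf A twisted_comul S'.
Proof.
split.
- exact: hA.
- exact: twisted_comul_map.
- exact: S'_map.
- move=> x e e' e''.
  by have /(congr1 (fun t : wmod k ((E * E) * E) => t ((e, e'), e''))) := twisted_coassoc x.
- exact: twisted_counitl.
- exact: twisted_counitr.
- exact: twisted_comulM.
- exact: twisted_comul1.
- exact: twisted_antipl.
- exact: twisted_antipr.
Qed.

End Antipode.

Lemma polar_twist_restricts : exists (D' : wmod k E -> wmod k (E * E)%type)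
    (S' : wmod k E -> wmod k E) (vinv : U),
  [/\ twist_v S Twi * vinv = 1, vinv * twist_v S Twi = 1,
      (forall x, twist_comul D Tw Twi (j x) = j2 (D' x)),
      (forall x, twist_antip S (twist_v S Twi) vinv (j x) = j (S' x)) &
      is_wHopf A D' S'].
Proof.
have [S' [S'_map S'E]] := twisted_antip_exists.
exists twisted_comul, S', twist_w; split.
- exact: twist_v_w.
- exact: twist_w_v.
- exact: twisted_comul_in.
- exact: S'E.
- exact: twisted_Hopf.
Qed.

End Twisting.
End PolarTwist.

Theorem theorem3p4p4 (k : fieldType) (hk : [pchar k]%R =i pred0)
    (E : Type) (A : augAlg k E)
    (D : wmod k E -> wmod k (E * E)%type) (S : wmod k E -> wmod k E)
    (hF : is_QFSHA A D S)
    (V : veeDual A) (phi : wmod k (E * E)%type) (F Finv : vU2 V)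
    (hphi : is_polar_twist D phi F Finv) :
  exists (D' : wmod k E -> wmod k (E * E)%type) (S' : wmod k E -> wmod k E)
         (vinv : vU V),
    [/\ twist_v S Finv * vinv = 1,
        vinv * twist_v S Finv = 1,
        (forall x : wmod k E,
           twist_comul D F Finv (vee_in (viota V) x) = vee_in (viota2 V) (D' x)),
        (forall x : wmod k E,
           twist_antip S (twist_v S Finv) vinv (vee_in (viota V) x)
             = vee_in (viota V) (S' x)) &
        is_QFSHA A D' S'].
Proof.
have hH := QFSHA_Hopf hF; have hL := QFSHA_limit hF.
have [adic [H [b [c hb]]]] := formal_group_limit_basis (wHopf_alg hH) hL.
have fH : filtered_Hopf H b c D S by [].
have [D' [S' [vinv [vw wv D'E S'E hH']]]] := polar_twist_restricts fH hk hphi.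
(* Product, unit and counit are unchanged, so [hL] applies to the twisted structure as it stands. *)
by exists D', S', vinv.
Qed.
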